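(* For every $B\ge1$ and $0<a_1\le a_2$ there exist constants $c,C>0$, depending only on $B,a_1,a_2$, such that the following holds. Let $n,d,s\ge1$ and $t\ge2$ be integers, $\delta\in(0,1)$, $\sigma>0$, $\Sigma\in\mathbb{R}^{d\times d}$ a positive semidefinite diagonal matrix, and $w^\star\in\mathbb{R}^d$ with $\|w^\star\|_0\le s$. Assume $B^{-1}\le\|\Sigma\|_2\le B$, $\|w^\star\|_2\le B$ and $$n\ge C\,t^2\big(\mathrm{tr}(\Sigma)+\log(1/\delta)\big).$$ Let the step size $\eta>0$ satisfy $\eta\le c/\|\Sigma\|_2$ and $$a_1\Big(\frac{\sigma^2\mathrm{tr}(\Sigma)\log(d/\delta)}{n}\Big)^{-1/2}\le\eta t\le a_2\Big(\frac{\sigma^2\mathrm{tr}(\Sigma)\log(d/\delta)}{n}\Big)^{-1/2}.$$ Let $(x_1,y_1),\dots,(x_n,y_n)$ be i.i.d. from $\mathsf P$, and let $w^t_{\mathsf{gd}}$ be the result of $t$ steps of gradient descent with step size $\eta$ on the raw data. Then, with probability at least $1-\delta$, $$\mathcal E(w^t_{\mathsf{gd}})\le C\,\log t\cdot\sqrt{\frac{\sigma^2\,\mathrm{tr}(\Sigma)\log(d/\delta)}{n}} .$$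
   Context: Distribution $\mathsf P$: $x\sim N(0,\Sigma)$ and $y=\langle w^\star,x\rangle+\epsilon$ with $\epsilon\sim N(0,\sigma^2)$ independent of $x$. Gradient descent on raw data: $w^0_{\mathsf{gd}}=0$ and $w^{\ell+1}_{\mathsf{gd}}=w^\ell_{\mathsf{gd}}-\eta\nabla\big[\frac1{2n}\sum_{i=1}^n(y_i-\langle w,x_i\rangle)^2\big]_{w=w^\ell_{\mathsf{gd}}}$. Excess risk: $L(w)=\mathbb{E}_{(x,y)\sim\mathsf P}[(\langle x,w\rangle-y)^2]$ with $(x,y)$ a fresh sample and $\mathcal E(w)=L(w)-\min_{w'}L(w')$. $\|\cdot\|_2$ on matrices is the spectral norm; $\|w\|_0$ is the number of nonzero entries. *)

(* Defs.v *)
From mathcomp Require Import all_boot all_order all_algebra.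
From mathcomp Require Import all_classical all_reals all_analysis.
Set Implicit Arguments.
Unset Strict Implicit.
Unset Printing Implicit Defensive.
Import Order.TTheory GRing.Theory Num.Theory numFieldNormedType.Exports.
Local Open Scope classical_set_scope.
Local Open Scope ring_scope.

Definition dotprod (R : realType) (d : nat) (u v : 'cV[R]_d) : R :=
  \sum_(j < d) u j 0 * v j 0.

Definition l2norm (R : realType) (d : nat) (v : 'cV[R]_d) : R :=
  Num.sqrt (\sum_(j < d) v j 0 ^+ 2).

Definition l0norm (R : realType) (d : nat) (v : 'cV[R]_d) : nat :=
  #|[set j : 'I_d | v j 0 != 0]%SET|.

Definition spectral_norm (R : realType) (d : nat) (A : 'M[R]_d) : R :=
  sup [set l2norm (A *m v) | v in [set v : 'cV[R]_d | l2norm v <= 1]].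

Definition psd (R : realType) (d : nat) (A : 'M[R]_d) : Prop :=
  A^T = A /\ forall u : 'cV[R]_d, 0 <= dotprod u (A *m u).

Definition gradient (R : realType) (d : nat) (f : 'cV[R]_d -> R)
    (w : 'cV[R]_d) : 'cV[R]_d :=
  \col_(j < d) 'D_(delta_mx j 0) f w.

(* The centred Gaussian law N(0, v) of variance v.  [normal_prob m s] takes the
   standard deviation s, and is not a point mass when s = 0. *)
Definition centred_normal (R : realType) (v : R) (A : set R) : \bar R :=
  if v == 0 then \d_(0 : R) A else normal_prob 0 (Num.sqrt v) A.

(* A feature vector is stored as a tuple, the type that carries the product
   sigma-algebra, and read as a column vector. *)
Definition vec (R : realType) (d : nat) (x : d.-tuple R) : 'cV[R]_d :=
  \col_(j < d) tnth x j.

(* X ~ N(0, Sigma), for a possibly singular Sigma: each linear form <u, X> is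
   N(0, u^T Sigma u). *)
Definition gaussian_vector (R : realType) (dT : measure_display)
    (T : measurableType dT) (Q : probability T R) (d : nat)
    (X : T -> d.-tuple R) (Sigma : 'M[R]_d) : Prop :=
  forall (u : 'cV[R]_d) (A : set R), measurable A ->
    Q [set o | A (dotprod u (vec (X o)))] =
    centred_normal (dotprod u (Sigma *m u)) A.

Definition independent2 (R : realType) (dT d1 d2 : measure_display)
    (T : measurableType dT) (T1 : measurableType d1) (T2 : measurableType d2)
    (Q : probability T R) (X : T -> T1) (Y : T -> T2) : Prop :=
  forall (A : set T1) (B : set T2), measurable A -> measurable B ->
    (Q (X @^-1` A `&` Y @^-1` B) = Q (X @^-1` A) * Q (Y @^-1` B))%E.

Definition mutually_independent (R : realType) (dT dV : measure_display)
    (T : measurableType dT) (V : measurableType dV) (Q : probability T R)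
    (I : finType) (Z : I -> T -> V) : Prop :=
  forall (J : {set I}) (A : I -> set V), (forall i, measurable (A i)) ->
    Q (\bigcap_(i in [set` J]) (Z i @^-1` A i)) =
    (\prod_(i in J) Q (Z i @^-1` A i))%E.

Definition iid_from (R : realType) (dT dV : measure_display)
    (T : measurableType dT) (V : measurableType dV) (Q : probability T R)
    (D : probability V R) (I : finType) (Z : I -> {mfun T >-> V}) : Prop :=
  mutually_independent Q (fun i => Z i : T -> V) /\
  forall (i : I) (A : set V), measurable A -> distribution Q (Z i) A = D A.

(* D is the law of (x, y) with x ~ N(0, Sigma) and y = <wstar, x> + eps, where
   eps ~ N(0, sigma^2) is independent of x; so eps is y - <wstar, x>. *)
Definition linear_model (R : realType) (d : nat) (Sigma : 'M[R]_d)
    (wstar : 'cV[R]_d) (sigma : R)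
    (D : probability (d.-tuple R * R)%type R) : Prop :=
  let x := fun z : d.-tuple R * R => z.1 in
  let eps := fun z : d.-tuple R * R => z.2 - dotprod wstar (vec z.1) in
  [/\ gaussian_vector D x Sigma,
      forall A : set R, measurable A ->
        D (eps @^-1` A) = centred_normal (sigma ^+ 2) A
    & independent2 D x eps].

Definition risk (R : realType) (d : nat)
    (D : probability (d.-tuple R * R)%type R) (w : 'cV[R]_d) : \bar R :=
  (\int[D]_z ((dotprod (vec z.1) w - z.2) ^+ 2)%:E)%E.

Definition excess_risk (R : realType) (d : nat)
    (D : probability (d.-tuple R * R)%type R) (w : 'cV[R]_d) : \bar R :=
  (risk D w - ereal_inf (range (risk D)))%E.

Definition empirical_loss (R : realType) (n d : nat)
    (z : 'I_n -> d.-tuple R * R) (w : 'cV[R]_d) : R :=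
  (2 * n%:R)^-1 * \sum_(i < n) ((z i).2 - dotprod w (vec (z i).1)) ^+ 2.

Definition gd (R : realType) (n d : nat) (z : 'I_n -> d.-tuple R * R)
    (eta : R) (t : nat) : 'cV[R]_d :=
  iter t (fun w => w - eta *: gradient (empirical_loss z) w) 0.

(* Main.v *)
(* Write [H] for the empirical covariance, [xi] for the mean of [eps_i x_i],
   [e = w_t - wstar] and [rho = sqrt (sigma^2 tr(Sigma) log(d/delta) / n)], so
   that [eta t] is of order [1 / rho].  The iteration for [e] is linear and
   splits into a bias started at [- wstar] and a variance driven by [xi]; energy
   estimates give [<e, H e> <~ |wstar|^2 / (eta t) + eta t |xi|^2] and
   [|e|^2 <~ |wstar|^2 + (eta t)^2 |xi|^2].  Hence the excess risk, a multiple of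
   [<e, Sigma e>], is O(rho) as soon as, simultaneously in [v],
   [<v, H v> <= M |v|^2],  [<v, Sigma v> <= C1 <v, H v> + (kap / t) |v|^2]  and
   [|xi|^2 <= K rho^2].

   The two comparisons of [H] with [Sigma] are dimension-free PAC-Bayes bounds.
   A direction [v] is randomised into a scaled sum of random signs with mean
   [v]; replacing the posterior by the uniform prior costs only [|v|^2 / r^2], so
   that it suffices to apply Markov's inequality to one prior average of Gaussian
   exponential moments.  The bound on [xi] averages the exponential moments of
   its coordinates with weights proportional to the variances.

   This requires [log(d/delta)] to be bounded below.  Otherwise [d = 1] and
   [delta] is close to 1, and only a small probability [1 - delta <=
   log(1/delta)] of success is needed.  Flipping the signs of half of the
   features turns [sum x_i eps_i] into a difference of two i.i.d. variables
   (up to one leftover term when [n] is odd), and by pigeonhole these fall into a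
   common short interval with sufficient probability. *)
From HB Require Import structures.
Require Import Defs.
From mathcomp Require Import all_boot all_order all_algebra.
From mathcomp Require Import all_classical all_reals all_analysis.
From mathcomp Require Import measurable_realfun.
From mathcomp Require Import ring lra.
Import Order.TTheory GRing.Theory Num.Theory numFieldNormedType.Exports.
Local Open Scope classical_set_scope.
Local Open Scope ring_scope.

Set Implicit Arguments.
Unset Strict Implicit.
Unset Printing Implicit Defensive.

Import HBNNSimple.

(** * Integrals against normal laws *)

(** The error [e] depends on the sample, so both comparisons must hold for all [v] at once. A net of
    the ball would cost a factor of order [d]. A posterior of variance [r2] in each direction costs
    [|v|^2 / r2] and adds an error of order [r2 tr(Sigma)], so that only the trace enters. For the
    bound by [M], [r2 = 1 / tr(Sigma)] makes this error a constant. For the other comparison,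
    [r2 = 1 / (t tr(Sigma))] makes it of order [1 / t]; the cost [t tr(Sigma) + log(1/delta)],
    divided by [n], is again of order [1 / t], and this is the role of [t^2] in the sample size. The
    remainder [kap / t] is affordable: [eta] is bounded and [eta t rho >= a1], so [1 / t] is O(rho),
    while [|e|] stays bounded. A factor [C1] instead of one close to 1 is enough, since [<e, H e>]
    is itself O(rho). The tail of [xi] gives [log(1/delta)] plus an absolute constant. Absorbing
    that constant into [log(d/delta)] is the step that needs a lower bound on the logarithm. *)

Lemma ge0_integral_weighted {R : realType} {d1 d2 : measure_display}
    {T : measurableType d1} {V : measurableType d2}
    (mu : {measure set T -> \bar R}) (nu : {measure set V -> \bar R})
    (g : T -> R) (phi : T -> V) (c : R) :
  measurable_fun [set: T] g -> (forall x, 0 <= g x) ->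
  measurable_fun [set: T] phi -> 0 <= c ->
  (forall A, measurable A ->
    (\int[mu]_x (g x * \1_A (phi x))%:E = c%:E * nu A)%E) ->
  forall f : V -> \bar R, measurable_fun [set: V] f ->
    (forall y, (0 <= f y)%E) ->
  (\int[mu]_x ((g x)%:E * f (phi x)) = c%:E * \int[nu]_y f y)%E.
Proof.
move=> mg g0 mphi c0 H f mf f0.
pose h := nnsfun_approx measurableT mf.
have fE x : f x = lim ((EFin \o h^~ x) n @[n --> \oo]).
  by apply/esym/cvg_lim => //; exact: cvg_nnsfun_approx.
have ndh y : {homo (fun n => h n y) : a b / (a <= b)%N >-> a <= b}.
  by move=> a b ab; exact/lefP/nd_nnsfun_approx.
have mind n y : measurable_fun [set: T]
    (fun x => \1_(h n @^-1` [set y]) (phi x) : R).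
  apply: (@measurableT_comp _ _ _ _ _ _ (\1_(h n @^-1` [set y]) : V -> R)) => //.
have simp n : (\int[mu]_x ((g x)%:E * (h n (phi x))%:E) =
    \int[nu]_y (c%:E * (h n y)%:E))%E.
  transitivity (\int[mu]_x (\sum_(y \in range (h n))
      ((g x)%:E * (y * \1_(h n @^-1` [set y]) (phi x))%:E)))%E.
    apply: eq_integral => x _; rewrite [in LHS]fimfunE -fsumEFin//.
    by rewrite ge0_mule_fsumr// => y; exact: nnfun_muleindic_ge0.
  transitivity (\int[nu]_x (\sum_(y \in range (h n))
      (c%:E * (y * \1_(h n @^-1` [set y]) x)%:E)))%E; last first.
    apply: eq_integral => x _; rewrite [in RHS]fimfunE -fsumEFin//.
    by rewrite ge0_mule_fsumr// => y; exact: nnfun_muleindic_ge0.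
  rewrite ge0_integral_fsum//; last 2 first.
  - move=> y; apply/measurable_EFinP.
    apply: measurable_funM => //; apply: measurable_funM => //.
  - by move=> y x _; rewrite mule_ge0 ?lee_fin//; exact: nnfun_muleindic_ge0.
  rewrite ge0_integral_fsum//; last 2 first.
  - move=> y; apply/measurable_EFinP.
    by apply: measurable_funM => //; apply: measurable_funM.
  - by move=> y x _; rewrite mule_ge0 ?lee_fin//; exact: nnfun_muleindic_ge0.
  apply: eq_fsbigr => r /[!inE] -[z _ rE].
  have r0 : 0 <= r by rewrite -rE.
  have mA : measurable (h n @^-1` [set r]) by [].
  under eq_integral do rewrite -EFinM mulrCA EFinM.
  rewrite ge0_integralZl_EFin//; last 2 first.
  - by move=> x _; rewrite lee_fin mulr_ge0.
  - apply/measurable_EFinP; apply: measurable_funM => //.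
  rewrite H//.
  under eq_integral do rewrite -EFinM mulrA EFinM.
  rewrite ge0_integralZl_EFin//; last 2 first.
  - exact/measurable_EFinP.
  - by rewrite mulr_ge0.
  by rewrite integral_indic// setIT muleA -EFinM [r * c]mulrC.
transitivity (limn (fun n => \int[mu]_x ((g x)%:E * (h n (phi x))%:E)))%E.
  rewrite -monotone_convergence//; last 3 first.
  - move=> n; apply/measurable_EFinP; apply: measurable_funM => //.
    exact: measurableT_comp.
  - by move=> n x _; rewrite lee_fin mulr_ge0.
  - by move=> x _ a b ab; rewrite lee_fin ler_wpM2l// ndh.
  apply: eq_integral => x _; apply/esym/cvg_lim => //.
  by apply: cvgeZl => //; exact: cvg_nnsfun_approx.
under eq_fun do rewrite simp.
rewrite -monotone_convergence//; last 3 first.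
- by move=> n; apply/measurable_EFinP; exact: measurable_funM.
- by move=> n x _; rewrite lee_fin mulr_ge0.
- by move=> x _ a b ab; rewrite lee_fin ler_wpM2l// ndh.
rewrite -ge0_integralZl_EFin//.
apply: eq_integral => x _; apply/cvg_lim => //.
by apply: cvgeZl => //; exact: cvg_nnsfun_approx.
Qed.

Section normal_mgf.
Context {R : realType}.
Notation leb := (@lebesgue_measure R).

Lemma ge0_integral_normal_prob (m s : R) (f : R -> R) : s != 0 ->
  measurable_fun [set: R] f -> (forall x, 0 <= f x) ->
  (\int[normal_prob m s]_x (f x)%:E =
   \int[leb]_x (normal_pdf m s x * f x)%:E)%E.
Proof.
move=> s0 mf f0.
have := @ge0_integral_weighted _ _ _ _ _ leb (normal_prob m s) (normal_pdf m s)
  idfun 1 (measurable_normal_pdf _ _) (fun x => normal_pdf_ge0 _ _ _)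
  (@measurable_id _ _ _) ler01 _ (EFin \o f).
rewrite mul1e => <-//.
- move=> A mA; rewrite mul1e [RHS]integral_mkcond/=.
  apply: eq_integral => x _; rewrite patchE indicE/=.
  by case: ifP => xA; rewrite ?mulr1 ?mulr0.
- exact/measurable_EFinP.
Qed.

(** The tilted density is [(1 - 2 c v)^(-1/2)] times the centred normal density of variance
    [v / (1 - 2 c v)]. Negative [c] is allowed and serves the lower tail. *)
Lemma integral_normal_prob_expR_sqr (v c : R) : 0 < v -> 2 * c * v < 1 ->
  (\int[normal_prob 0 (Num.sqrt v)]_x (expR (c * x ^+ 2))%:E =
   ((Num.sqrt (1 - 2 * c * v))^-1)%:E)%E.
Proof.
move=> v0 cv1; have sv0 : Num.sqrt v != 0 by rewrite sqrtr_eq0 -ltNge.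
have mf : measurable_fun [set: R] (fun x : R => expR (c * x ^+ 2)).
  by apply: measurableT_comp => //; exact: measurable_funM.
rewrite ge0_integral_normal_prob; [|exact: sv0|exact: mf|by move=> x; exact: expR_ge0].
have D0 : 0 < 1 - 2 * c * v by lra.
have w0 : 0 < v / (1 - 2 * c * v) by rewrite divr_gt0.
have sw0 : Num.sqrt (v / (1 - 2 * c * v)) != 0 by rewrite sqrtr_eq0 -ltNge.
rewrite -[RHS]mule1 -(integral_normal_pdf 0 (Num.sqrt (v / (1 - 2 * c * v)))).
rewrite -ge0_integralZl_EFin//; last 2 first.
- by move=> x _; rewrite lee_fin normal_pdf_ge0.
- by apply/measurable_EFinP; exact: measurable_normal_pdf.
apply: eq_integral => x _; rewrite -EFinM; congr EFin.
rewrite !normal_pdfE// /normal_peak /normal_fun !sqr_sqrtr ?ltW//.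
rewrite -[LHS]mulrA -expRD [RHS]mulrA; congr (_ * expR _); last first.
  by field; rewrite ?gt_eqF//=; apply/andP; split; lra.
rewrite -invfM; congr (_^-1); rewrite -sqrtrM ?ltW//; congr Num.sqrt.
by field; rewrite gt_eqF.
Qed.

(** Completing the square produces the normal density of mean [s v] and variance [v]. *)
Lemma integral_normal_prob_expR_lin (v s : R) : 0 < v ->
  (\int[normal_prob 0 (Num.sqrt v)]_x (expR (s * x))%:E =
   (expR (s ^+ 2 * v / 2))%:E)%E.
Proof.
move=> v0; have sv0 : Num.sqrt v != 0 by rewrite sqrtr_eq0 -ltNge.
have mf : measurable_fun [set: R] (fun x : R => expR (s * x)).
  by apply: measurableT_comp => //; exact: measurable_funM.
rewrite ge0_integral_normal_prob; [|exact: sv0|exact: mf|by move=> x; exact: expR_ge0].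
rewrite -[RHS]mule1 -(integral_normal_pdf (s * v) (Num.sqrt v)).
rewrite -ge0_integralZl_EFin//; last 2 first.
- by move=> x _; rewrite lee_fin normal_pdf_ge0.
- by apply/measurable_EFinP; exact: measurable_normal_pdf.
apply: eq_integral => x _; rewrite -EFinM; congr EFin.
rewrite !normal_pdfE// /normal_peak /normal_fun !sqr_sqrtr ?ltW//.
rewrite -[LHS]mulrA -expRD [RHS]mulrCA -expRD; congr (_ * expR _).
by field; rewrite gt_eqF.
Qed.

End normal_mgf.

Lemma measurable_fun_prodr {R : realType} {d : measure_display}
    {T : measurableType d} {I : Type} (s : seq I) (p : pred I)
    (h : I -> T -> R) :
  (forall i, measurable_fun [set: T] (h i)) ->
  measurable_fun [set: T] (fun x => \prod_(i <- s | p i) h i x).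
Proof.
move=> mh; elim: s => [|i s IH].
  by under eq_fun do rewrite big_nil; exact: measurable_cst.
under eq_fun do rewrite big_cons.
by case: (p i) => //; exact: measurable_funM.
Qed.

Section laws.
Context {R : realType}.

Lemma ge0_integral_law {d1 d2 : measure_display}
    {T : measurableType d1} {V : measurableType d2}
    (Q : {measure set T -> \bar R}) (nu : {measure set V -> \bar R})
    (X : T -> V) (f : V -> \bar R) :
  measurable_fun [set: T] X ->
  (forall A, measurable A -> Q (X @^-1` A) = nu A) ->
  measurable_fun [set: V] f -> (forall y, (0 <= f y)%E) ->
  (\int[Q]_x f (X x) = \int[nu]_y f y)%E.
Proof.
move=> mX H mf f0.
have := @ge0_integral_weighted _ _ _ _ _ Q nu (fun=> 1) X 1
  (measurable_cst _) (fun=> ler01) mX ler01 _ f mf f0.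
rewrite mul1e => <-.
  by apply: eq_integral => x _; rewrite mul1e.
move=> A mA; rewrite mul1e -H//.
under eq_integral do rewrite mul1r.
rewrite -[X in Q X]setIT -integral_indic//.
by rewrite -[X in measurable X]setTI; exact: mX.
Qed.

Context {d : measure_display} {T : measurableType d} (Q : probability T R).

Lemma integral_centred_normal_expR_sqr (X : T -> R) (v c : R) :
  measurable_fun [set: T] X ->
  (forall A, measurable A -> Q (X @^-1` A) = centred_normal v A) ->
  0 <= v -> 2 * c * v < 1 ->
  (\int[Q]_x (expR (c * X x ^+ 2))%:E =
   ((Num.sqrt (1 - 2 * c * v))^-1)%:E)%E.
Proof.
move=> mX; rewrite /centred_normal => H v0.
have mf : measurable_fun [set: R] (fun x : R => (expR (c * x ^+ 2))%:E).
  by apply/measurable_EFinP; apply: measurableT_comp => //;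
    exact: measurable_funM.
have f0 y : (0 <= (expR (c * y ^+ 2))%:E)%E by rewrite lee_fin expR_ge0.
have [vE|vn0] := eqVneq v 0; rewrite ?vE ?eqxx ?(negbTE vn0) in H *.
  rewrite (ge0_integral_law mX H mf f0) integral_dirac// diracE in_setT mul1e.
  by rewrite expr0n !mulr0 expR0 subr0 sqrtr1 invr1.
move=> cv; rewrite (ge0_integral_law (nu := normal_prob 0 (Num.sqrt v)) mX H mf f0).
by rewrite integral_normal_prob_expR_sqr// lt0r vn0.
Qed.

Lemma integral_centred_normal_expR_lin (X : T -> R) (v c : R) :
  measurable_fun [set: T] X ->
  (forall A, measurable A -> Q (X @^-1` A) = centred_normal v A) ->
  0 <= v ->
  (\int[Q]_x (expR (c * X x))%:E = (expR (c ^+ 2 * v / 2))%:E)%E.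
Proof.
move=> mX; rewrite /centred_normal => H v0.
have mf : measurable_fun [set: R] (fun x : R => (expR (c * x))%:E).
  by apply/measurable_EFinP; apply: measurableT_comp => //;
    exact: measurable_funM.
have f0 y : (0 <= (expR (c * y))%:E)%E by rewrite lee_fin expR_ge0.
have [vE|vn0] := eqVneq v 0; rewrite ?vE ?eqxx ?(negbTE vn0) in H *.
  rewrite (ge0_integral_law mX H mf f0) integral_dirac// diracE in_setT mul1e.
  by rewrite !mulr0 mul0r expR0.
rewrite (ge0_integral_law (nu := normal_prob 0 (Num.sqrt v)) mX H mf f0).
by rewrite integral_normal_prob_expR_lin// lt0r vn0.
Qed.

End laws.

Section product_formula.
Context {R : realType} {d dV : measure_display} {T : measurableType d}
  {V : measurableType dV} (P : probability T R) (D : probability V R).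

(** Induction on the number [k] of factors that may be arbitrary, the remaining ones being
    indicators. For [k = 0] this is the hypothesis on sets. *)
Lemma integral_prod_independent (n : nat) (Z : 'I_n -> {mfun T >-> V})
    (f : 'I_n -> V -> R) (e : 'I_n -> R) :
  (forall A : 'I_n -> set V, (forall i, measurable (A i)) ->
    P (\bigcap_i (Z i @^-1` A i)) = (\prod_i D (A i))%E) ->
  (forall i, measurable_fun [set: V] (f i)) -> (forall i y, 0 <= f i y) ->
  (forall i, (\int[D]_y (f i y)%:E = (e i)%:E)%E) ->
  (\int[P]_o (\prod_i f i (Z i o))%:E = (\prod_i e i)%:E)%E.
Proof.
move=> ZD.
suff main (k : nat) : forall (f : 'I_n -> V -> R) (e : 'I_n -> R),
    (forall i, measurable_fun [set: V] (f i)) -> (forall i y, 0 <= f i y) ->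
    (forall i, (\int[D]_y (f i y)%:E = (e i)%:E)%E) ->
    (forall i : 'I_n, (k <= i)%N ->
      exists2 A, measurable A & f i = (\1_A : V -> R)) ->
    (\int[P]_o (\prod_i f i (Z i o))%:E = (\prod_i e i)%:E)%E.
  move=> mf f0 ef; apply: (main n) => // i.
  by rewrite leqNgt ltn_ord.
clear f e; elim: k => [|k IH] f e mf f0 ef indf.
  have /choice[A AP] i : exists A, measurable A /\ f i = (\1_A : V -> R).
    by have [A mA fA] := indf i (leq0n _); exists A.
  have mA i : measurable (A i) by have [] := AP i.
  have fE i : f i = \1_(A i) by have [] := AP i.
  have eE i : (e i)%:E = D (A i).
    by rewrite -ef fE integral_indic// setIT.
  rewrite -prodEFin; under [RHS]eq_bigr do rewrite eE.
  rewrite -ZD//.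
  transitivity (\int[P]_o (\1_(\bigcap_i (Z i @^-1` A i)) o)%:E)%E.
    apply: eq_integral => o _; congr EFin; rewrite indicE.
    have [/set_mem oA|] := boolP (o \in _).
      by rewrite big1// => i _; rewrite fE indicE mem_set//; exact: oA.
    rewrite notin_setE => oA; apply/eqP; rewrite prodf_seq_eq0.
    apply: contrapT => /negP/hasPn oA'; apply: oA => i _ /=.
    have := oA' i (mem_index_enum _).
    by rewrite /= fE indicE pnatr_eq0 eqb0 negbK => /set_mem.
  rewrite integral_indic// ?setIT//.
  apply: fin_bigcap_measurable => // i _.
  by rewrite -[X in measurable X]setTI; exact: measurable_funPT.
have [kn|nk] := ltnP k n; last first.
  by apply: IH => // i ki; have := ltn_ord i; rewrite ltnNge (leq_trans nk ki).
pose i0 := Ordinal kn.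
pose g o := \prod_(i | i != i0) f i (Z i o).
pose c := \prod_(i | i != i0) e i.
have e0 i : 0 <= e i.
  by rewrite -lee_fin -ef integral_ge0// => y _; rewrite lee_fin.
have mZ i : measurable_fun [set: T] (Z i) by exact: measurable_funPT.
rewrite [in RHS](bigD1 i0)//= mulrC EFinM -/c -ef.
(* The other factors act as a density [g]. The identity on sets is the induction hypothesis with an
   indicator at [i0]. *)
have := @ge0_integral_weighted _ _ _ _ _ P D g (Z i0) c _ _ (mZ i0) _ _
  (EFin \o f i0).
move=> /= <-//.
- apply: eq_integral => o _; rewrite -EFinM; congr EFin.
  by rewrite (bigD1 i0)//= mulrC.
- by apply: measurable_fun_prodr => i; exact: measurableT_comp.
- by move=> o; apply: prodr_ge0.
- by apply: prodr_ge0.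
- move=> A mA.
  pose f' i := if i == i0 then (\1_A : V -> R) else f i.
  pose e' i := if i == i0 then fine (D A) else e i.
  have gE o : g o * \1_A (Z i0 o) = \prod_i f' i (Z i o).
    rewrite (bigD1 i0)//= mulrC /f' eqxx; congr (_ * _).
    by apply: eq_bigr => i /negbTE ->.
  under eq_integral do rewrite gE.
  rewrite (IH f' e').
  + rewrite (bigD1 i0)//= mulrC /e' eqxx EFinM fineK ?fin_num_measure//.
    by congr (_%:E * _)%E; apply: eq_bigr => i /negbTE ->.
  + by move=> i; rewrite /f'; case: eqP.
  + by move=> i y; rewrite /f'; case: eqP.
  + move=> i; rewrite /f' /e'; case: eqP => // _.
    by rewrite integral_indic// setIT fineK// fin_num_measure.
  + move=> i ki; rewrite /f'; case: eqP => [_|/eqP ii0]; first by exists A.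
    by apply: indf; rewrite ltn_neqAle ki andbT eq_sym.
- by apply/measurable_EFinP.
- by move=> y; rewrite lee_fin.
Qed.

End product_formula.

(** * Independent pairs of real variables *)

Section independent_pairs.
Context {R : realType} {d : measure_display} {T : measurableType d}
  (Q : probability T R).

Lemma independent2_comp {d1 d2 d3 d4 : measure_display}
    {T1 : measurableType d1} {T2 : measurableType d2}
    {T3 : measurableType d3} {T4 : measurableType d4}
    (X : T -> T1) (Y : T -> T2) (phi : T1 -> T3) (psi : T2 -> T4) :
  independent2 Q X Y -> measurable_fun [set: T1] phi ->
  measurable_fun [set: T2] psi -> independent2 Q (phi \o X) (psi \o Y).
Proof.
move=> XY mphi mpsi A B mA mB.
apply: (XY (phi @^-1` A) (psi @^-1` B)).
  by rewrite -[X in measurable X]setTI; exact: mphi.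
by rewrite -[X in measurable X]setTI; exact: mpsi.
Qed.

(** Independence identifies the joint law with the product of the marginals; Tonelli does the
    rest. *)
Lemma ge0_integral_independent2 (X Y : T -> R) (F : R * R -> \bar R)
    (mX : measurable_fun [set: T] X) (mY : measurable_fun [set: T] Y) :
  independent2 Q X Y ->
  measurable_fun [set: R * R] F -> (forall z, (0 <= F z)%E) ->
  (\int[Q]_o F (X o, Y o) = \int[Q]_o \int[Q]_o' F (X o, Y o'))%E.
Proof.
move=> XY mF F0.
pose X' : {mfun T >-> R} := HB.pack X (isMeasurableFun.Build _ _ _ _ X mX).
pose Y' : {mfun T >-> R} := HB.pack Y (isMeasurableFun.Build _ _ _ _ Y mY).
pose m1 : probability R R := distribution Q X'.
pose m2 : probability R R := distribution Q Y'.
have mXY : measurable_fun [set: T] (fun o => (X o, Y o)).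
  exact: measurable_fun_pair.
pose XY' : {mfun T >-> (R * R)%type} :=
  HB.pack (fun o => (X o, Y o)) (isMeasurableFun.Build _ _ _ _ _ mXY).
have law (A : set (R * R)) : measurable A ->
    Q ((fun o => (X o, Y o)) @^-1` A) = (m1 \x m2)%E A.
  move=> mA; apply/esym.
  rewrite (@product_measure_unique _ _ _ _ _ m1 m2 (distribution Q XY'))//.
rewrite (ge0_integral_law mXY law mF F0) fubini_tonelli1//.
have mFx x : measurable_fun [set: R] (fun y => F (x, y)).
  exact: measurableT_comp.
have E1 x : fubini_F m2 F x = (\int[Q]_o' F (x, Y o'))%E.
  rewrite /fubini_F.
  by rewrite (ge0_integral_law (nu := m2) (f := fun y => F (x, y)) mY).
transitivity (\int[m1]_x \int[Q]_o' F (x, Y o'))%E.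
  by apply: eq_integral => x _; rewrite E1.
rewrite (ge0_integral_law (nu := m1)
  (f := fun x => \int[Q]_o' F (x, Y o'))%E mX)//.
- under eq_fun do rewrite -E1.
  exact: measurable_fun_fubini_tonelli_F.
- by move=> y; exact: integral_ge0.
Qed.

(** Both joint laws are products of the same marginals. It is applied with [X' = - X], to remove the
    cross term of the risk and to flip the features of a sample. *)
Lemma ge0_integral_independent2_eq (X X' Y : T -> R) (F : R * R -> \bar R) :
  measurable_fun [set: T] X -> measurable_fun [set: T] X' ->
  measurable_fun [set: T] Y -> independent2 Q X Y -> independent2 Q X' Y ->
  (forall A, measurable A -> Q (X @^-1` A) = Q (X' @^-1` A)) ->
  measurable_fun [set: R * R] F -> (forall z, (0 <= F z)%E) ->
  (\int[Q]_o F (X o, Y o) = \int[Q]_o F (X' o, Y o))%E.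
Proof.
move=> mX mX' mY XY X'Y XX' mF F0.
pose X2 : {mfun T >-> R} := HB.pack X' (isMeasurableFun.Build _ _ _ _ X' mX').
pose Y2 : {mfun T >-> R} := HB.pack Y (isMeasurableFun.Build _ _ _ _ Y mY).
rewrite (ge0_integral_independent2 mX)// (ge0_integral_independent2 mX')//.
have mG : measurable_fun [set: R] (fun x => \int[Q]_o' F (x, Y o'))%E.
  have -> : (fun x => \int[Q]_o' F (x, Y o'))%E =
      fubini_F (distribution Q Y2) F.
    apply/funext => x; rewrite /fubini_F.
    rewrite (ge0_integral_law (nu := distribution Q Y2)
      (f := fun y => F (x, y)) mY)//.
    exact: measurableT_comp.
  exact: measurable_fun_fubini_tonelli_F.
have G0 x : (0 <= \int[Q]_o' F (x, Y o'))%E by exact: integral_ge0.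
rewrite (ge0_integral_law (nu := distribution Q X2) mX XX' mG G0).
by rewrite (ge0_integral_law (nu := distribution Q X2) mX' _ mG G0).
Qed.

(** Integrating over [Y] leaves [exp(s^2 b X^2 / 2)], a Gaussian moment of quadratic type. *)
Lemma integral_expR_normal_product (X Y : T -> R) (a b s : R) :
  measurable_fun [set: T] X -> measurable_fun [set: T] Y ->
  independent2 Q X Y ->
  (forall A, measurable A -> Q (X @^-1` A) = centred_normal a A) ->
  (forall A, measurable A -> Q (Y @^-1` A) = centred_normal b A) ->
  0 <= a -> 0 <= b -> s ^+ 2 * a * b < 1 ->
  (\int[Q]_o (expR (s * (X o * Y o)))%:E =
   ((Num.sqrt (1 - s ^+ 2 * a * b))^-1)%:E)%E.
Proof.
move=> mX mY XY lX lY a0 b0 sab.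
rewrite (ge0_integral_independent2 (X := X) (Y := Y)
  (F := fun z => (expR (s * (z.1 * z.2)))%:E))//; last first.
  apply/measurable_EFinP; apply: measurableT_comp => //.
  by apply: measurable_funM => //; exact: measurable_funM.
rewrite (_ : s ^+ 2 * a * b = 2 * (s ^+ 2 * b / 2) * a); last by field.
rewrite -(integral_centred_normal_expR_sqr mX lX)//; last first.
  by move: sab; congr (_ < _); field.
apply: eq_integral => o _ /=.
under eq_integral do rewrite mulrA.
rewrite (integral_centred_normal_expR_lin _ mY lY)//.
by congr (expR _)%:E; field.
Qed.

End independent_pairs.

(** * The linear model *)

Lemma invr_sqrt_le {R : realType} (a b : R) :
  0 < a -> 0 <= b -> 1 <= b ^+ 2 * a -> (Num.sqrt a)^-1 <= b.
Proof.
move=> a0 b0 h; rewrite -div1r ler_pdivrMr ?sqrtr_gt0//.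
rewrite -(sqrtr1 R) -{1}(ger0_norm b0) -sqrtr_sqr -sqrtrM ?sqr_ge0//.
exact: ler_wsqrtr.
Qed.

Section linear_model_risk.
Context {R : realType} {d : nat}.

Lemma dotprodDl (u v w : 'cV[R]_d) :
  dotprod (u + v) w = dotprod u w + dotprod v w.
Proof.
by rewrite -big_split; apply: eq_bigr => j _; rewrite !mxE mulrDl.
Qed.

Lemma dotprodC (u v : 'cV[R]_d) : dotprod u v = dotprod v u.
Proof. by apply: eq_bigr => j _; rewrite mulrC. Qed.

Lemma dotprodDr (u v w : 'cV[R]_d) :
  dotprod w (u + v) = dotprod w u + dotprod w v.
Proof. by rewrite dotprodC dotprodDl !(dotprodC w). Qed.

Lemma dotprodZl (a : R) (u v : 'cV[R]_d) :
  dotprod (a *: u) v = a * dotprod u v.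
Proof.
by rewrite /dotprod mulr_sumr; apply: eq_bigr => j _; rewrite !mxE mulrA.
Qed.

Lemma dotprodZr (a : R) (u v : 'cV[R]_d) :
  dotprod u (a *: v) = a * dotprod u v.
Proof. by rewrite dotprodC dotprodZl dotprodC. Qed.

Lemma dotprodNl (u v : 'cV[R]_d) : dotprod (- u) v = - dotprod u v.
Proof. by rewrite -scaleN1r dotprodZl mulN1r. Qed.

Lemma dotprodNr (u v : 'cV[R]_d) : dotprod u (- v) = - dotprod u v.
Proof. by rewrite dotprodC dotprodNl dotprodC. Qed.

Lemma dotprodBl (u v w : 'cV[R]_d) :
  dotprod (u - v) w = dotprod u w - dotprod v w.
Proof. by rewrite dotprodDl dotprodNl. Qed.

Lemma dotprodBr (u v w : 'cV[R]_d) :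
  dotprod w (u - v) = dotprod w u - dotprod w v.
Proof. by rewrite dotprodDr dotprodNr. Qed.

Lemma dotprod0l (u : 'cV[R]_d) : dotprod 0 u = 0.
Proof. by rewrite -(scale0r u) dotprodZl mul0r. Qed.

Lemma measurable_dotprod_vec (u : 'cV[R]_d) :
  measurable_fun [set: d.-tuple R] (fun x => dotprod u (vec x)).
Proof.
rewrite /dotprod; apply: measurable_sum => j.
apply: measurable_funM => //.
by under eq_fun do rewrite mxE; exact: measurable_tnth.
Qed.

Lemma measurable_dotprod_vec1 (u : 'cV[R]_d) :
  measurable_fun [set: d.-tuple R * R] (fun z => dotprod u (vec z.1)).
Proof. exact: (measurableT_comp (measurable_dotprod_vec u)). Qed.

Lemma measurable_noise (w : 'cV[R]_d) :
  measurable_fun [set: d.-tuple R * R] (fun z => z.2 - dotprod w (vec z.1)).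
Proof. by apply: measurable_funB => //; exact: measurable_dotprod_vec1. Qed.

Variables (Sigma : 'M[R]_d) (wstar : 'cV[R]_d) (sigma : R)
  (D : probability (d.-tuple R * R)%type R).
Hypothesis hD : linear_model Sigma wstar sigma D.
Hypothesis hpsd : forall u : 'cV[R]_d, 0 <= dotprod u (Sigma *m u).

Let q (u : 'cV[R]_d) := dotprod u (Sigma *m u).
Let X (u : 'cV[R]_d) (z : d.-tuple R * R) := dotprod u (vec z.1).
Let eps (z : d.-tuple R * R) := z.2 - dotprod wstar (vec z.1).

Lemma feature_law (u : 'cV[R]_d) (A : set R) : measurable A ->
  D (X u @^-1` A) = centred_normal (q u) A.
Proof. by case: hD => H _ _; exact: H. Qed.

Lemma noise_law (A : set R) : measurable A ->
  D (eps @^-1` A) = centred_normal (sigma ^+ 2) A.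
Proof. by case: hD => _ H _; exact: H. Qed.

Lemma feature_noise_independent (u : 'cV[R]_d) : independent2 D (X u) eps.
Proof.
case: hD => _ _ H.
exact: (independent2_comp H (measurable_dotprod_vec u) (@measurable_id _ _ _)).
Qed.

(** From [x^2 <= 4 v exp(x^2 / (4 v))]: the exponential moment is [sqrt 2 <= 3 / 2], and
    [6 = 4 * 3 / 2]. *)
Lemma integral_centred_normal_sqr_le (f : d.-tuple R * R -> R) (v : R) :
  measurable_fun [set: d.-tuple R * R] f ->
  (forall A, measurable A -> D (f @^-1` A) = centred_normal v A) -> 0 <= v ->
  (\int[D]_z (f z ^+ 2)%:E <= (6 * v)%:E)%E.
Proof.
move=> mf lf; rewrite le_eqVlt => /orP[/eqP v0|v0].
  have l0 A : measurable A -> D (f @^-1` A) = \d_(0 : R) A.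
    by move=> mA; rewrite lf// /centred_normal -v0 eqxx.
  rewrite -v0 mulr0 (ge0_integral_law (nu := \d_(0 : R))
    (f := fun x => (x ^+ 2)%:E) mf l0)//.
  - rewrite integral_dirac ?expr0n ?mule0//.
    by apply/measurable_EFinP; exact: measurable_funX.
  - by apply/measurable_EFinP; exact: measurable_funX.
  - by move=> y; rewrite lee_fin sqr_ge0.
have mE : measurable_fun [set: d.-tuple R * R]
    (fun z => (expR ((4 * v)^-1 * f z ^+ 2))%:E).
  apply/measurable_EFinP; apply: measurableT_comp => //.
  by apply: measurable_funM => //; exact: measurable_funX.
have le1 : (\int[D]_z (f z ^+ 2)%:E <=
    \int[D]_z ((4 * v)%:E * (expR ((4 * v)^-1 * f z ^+ 2))%:E))%E.
  apply: ge0_le_integral => //.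
  - by move=> z _; rewrite lee_fin sqr_ge0.
  - by apply/measurable_EFinP; exact: measurable_funX.
  - by apply: emeasurable_funM.
  - move=> z _; rewrite -EFinM lee_fin -ler_pdivrMl ?mulr_gt0//.
    by apply: le_trans (expR_ge1Dx _); rewrite lerDr.
apply: le_trans le1 _; rewrite ge0_integralZl_EFin//; last by rewrite mulr_ge0// ltW.
rewrite (integral_centred_normal_expR_sqr mf lf (ltW v0)); last first.
  rewrite (_ : 2 * (4 * v)^-1 * v = 2^-1); first by lra.
  by field; rewrite gt_eqF.
rewrite -EFinM lee_fin (_ : 1 - 2 * (4 * v)^-1 * v = 2^-1); last first.
  by field; rewrite gt_eqF.
rewrite (_ : 6 * v = 4 * v * (3 / 2)); last by field.
rewrite ler_wpM2l ?mulr_ge0 ?(ltW v0)//.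
by apply: invr_sqrt_le; lra.
Qed.

(** Every [X u] has the law of a multiple of one fixed nondegenerate form, so the second moments are
    proportional to [q u]. The factor [kappa] only affects constants. *)
Lemma integral_feature_sqr : exists kappa : R, [/\ 0 <= kappa, kappa <= 6 &
  forall u, (\int[D]_z (X u z ^+ 2)%:E = (kappa * q u)%:E)%E].
Proof.
have le6 u : (\int[D]_z (X u z ^+ 2)%:E <= (6 * q u)%:E)%E.
  apply: integral_centred_normal_sqr_le (hpsd u).
    exact: measurable_dotprod_vec1.
  exact: feature_law.
have ge0 u : (0 <= \int[D]_z (X u z ^+ 2)%:E)%E.
  by apply: integral_ge0 => z _; rewrite lee_fin sqr_ge0.
have [[u0 u00]|/forallNP noq] := pselect (exists u, q u != 0); last first.
  exists 0; split => // u; have /negP/negPn/eqP qu0 := noq u.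
  by apply/eqP; rewrite eq_le mul0r ge0 andbT -(mulr0 6) -qu0 le6.
have qu0 : 0 < q u0 by rewrite lt0r u00 hpsd.
have fin0 : (\int[D]_z (X u0 z ^+ 2)%:E \is a fin_num)%E.
  by rewrite ge0_fin_numE// (le_lt_trans (le6 u0))// ltry.
exists (fine (\int[D]_z (X u0 z ^+ 2)%:E)%E / q u0); split.
- by rewrite divr_ge0 ?fine_ge0// ltW.
- by rewrite ler_pdivrMr// -lee_fin fineK.
move=> u; set c := Num.sqrt (q u / q u0).
have c2 : c ^+ 2 = q u / q u0 by rewrite sqr_sqrtr// divr_ge0 ?hpsd// ltW.
have qc : q (c *: u0) = q u.
  by rewrite /q -scalemxAr dotprodZl dotprodZr mulrA -expr2 c2 divfK.
have law A : measurable A -> D (X u @^-1` A) = D (X (c *: u0) @^-1` A).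
  by move=> mA; rewrite (feature_law u mA) (feature_law (c *: u0) mA) qc.
have mX v := measurable_dotprod_vec1 v.
pose Xc : {mfun (d.-tuple R * R)%type >-> R} :=
  HB.pack (X (c *: u0)) (isMeasurableFun.Build _ _ _ _ _ (mX (c *: u0))).
have mf : measurable_fun [set: R] (fun x : R => (x ^+ 2)%:E).
  by apply/measurable_EFinP; exact: measurable_funX.
have f0 (y : R) : (0 <= (y ^+ 2)%:E)%E by rewrite lee_fin sqr_ge0.
rewrite (ge0_integral_law (nu := distribution D Xc) (mX u) law mf f0).
rewrite -(ge0_integral_law (Q := D) (mX (c *: u0)) _ mf f0)//.
under eq_integral do rewrite dotprodZl exprMn c2 EFinM.
rewrite ge0_integralZl_EFin//; last 2 first.
- by apply/measurable_EFinP; exact: measurable_funX.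
- by rewrite divr_ge0 ?hpsd// ltW.
by rewrite -[X in (_ * X)%E]fineK// -EFinM; congr EFin; ring.
Qed.

(** Since [(X u, eps)] and [(X (- u), eps)] have the same law, the risk is computed twice with
    opposite signs of the cross term, and the product cancels pointwise in the sum. *)
Lemma riskE (w : 'cV[R]_d) :
  risk D w = (\int[D]_z (X (w - wstar) z ^+ 2)%:E +
              \int[D]_z (eps z ^+ 2)%:E)%E.
Proof.
set u := w - wstar.
have mX v : measurable_fun [set: d.-tuple R * R] (X v).
  exact: measurable_dotprod_vec1.
have me : measurable_fun [set: d.-tuple R * R] eps by exact: measurable_noise.
have mX2 v : measurable_fun [set: d.-tuple R * R] (fun z => X v z ^+ 2).
  exact: measurable_funX.
have me2 : measurable_fun [set: d.-tuple R * R] (fun z => eps z ^+ 2).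
  exact: measurable_funX.
have q_opp : q (- u) = q u by rewrite /q mulmxN dotprodNl dotprodNr opprK.
have fin2 f v : measurable_fun [set: d.-tuple R * R] f -> 0 <= v ->
    (forall A, measurable A -> D (f @^-1` A) = centred_normal v A) ->
    exists2 r : R, 0 <= r & (\int[D]_z (f z ^+ 2)%:E = r%:E)%E.
  move=> mf v0 lf; have ge0 : (0 <= \int[D]_z (f z ^+ 2)%:E)%E.
    by apply: integral_ge0 => z _; rewrite lee_fin sqr_ge0.
  exists (fine (\int[D]_z (f z ^+ 2)%:E)%E); first exact: fine_ge0.
  rewrite fineK// ge0_fin_numE// (le_lt_trans _ (ltry (6 * v)))//.
  exact: integral_centred_normal_sqr_le.
have [a a0 aE] := fin2 _ _ (mX u) (hpsd u) (feature_law u).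
have [b b0 bE] := fin2 _ _ me (sqr_ge0 _) noise_law.
have sym : (\int[D]_z ((X u z - eps z) ^+ 2)%:E =
            \int[D]_z ((X (- u) z - eps z) ^+ 2)%:E)%E.
  apply: (ge0_integral_independent2_eq (X := X u) (X' := X (- u)) (Y := eps)
    (F := fun z => ((z.1 - z.2) ^+ 2)%:E)) => //.
  - exact: feature_noise_independent.
  - exact: feature_noise_independent.
  - by move=> A mA; rewrite (feature_law u mA) (feature_law (- u) mA) q_opp.
  - apply/measurable_EFinP; apply: measurable_funX.
    exact: measurable_funB.
  - by move=> z; rewrite lee_fin sqr_ge0.
have rE : risk D w = (\int[D]_z ((X u z - eps z) ^+ 2)%:E)%E.
  rewrite /risk; apply: eq_integral => z _; congr ((_ ^+ 2)%:E).
  by rewrite /X /eps /u dotprodBl (dotprodC w); ring.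
have two : (risk D w + risk D w = (a + b)%:E + (a + b)%:E)%E.
  rewrite {1}rE rE {2}sym -ge0_integralD//; last 4 first.
  - by move=> z _; rewrite lee_fin sqr_ge0.
  - apply/measurable_EFinP; apply: measurable_funX; exact: measurable_funB.
  - by move=> z _; rewrite lee_fin sqr_ge0.
  - apply/measurable_EFinP; apply: measurable_funX; exact: measurable_funB.
  rewrite EFinD -aE -bE -ge0_integralD//; last 4 first.
  - by move=> z _; rewrite lee_fin sqr_ge0.
  - exact/measurable_EFinP.
  - by move=> z _; rewrite lee_fin sqr_ge0.
  - exact/measurable_EFinP.
  rewrite -ge0_integralD//; last 4 first.
  - by move=> z _; rewrite adde_ge0// lee_fin sqr_ge0.
  - by apply: emeasurable_funD; exact/measurable_EFinP.
  - by move=> z _; rewrite adde_ge0// lee_fin sqr_ge0.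
  - by apply: emeasurable_funD; exact/measurable_EFinP.
  apply: eq_integral => z _; rewrite -!EFinD; congr EFin.
  by rewrite /X dotprodNl; ring.
rewrite aE bE -EFinD.
case: (risk D w) two => [r|//|//] /=; rewrite -!EFinD => -[rab].
by congr EFin; lra.
Qed.

Lemma excess_riskE : exists kappa : R, [/\ 0 <= kappa, kappa <= 6 &
  forall w, excess_risk D w = (kappa * q (w - wstar))%:E].
Proof.
have [kappa [k0 k6 kE]] := integral_feature_sqr.
exists kappa; split => // w.
pose b := (\int[D]_z (eps z ^+ 2)%:E)%E.
have bge0 : (0 <= b)%E.
  by apply: integral_ge0 => z _; rewrite lee_fin sqr_ge0.
have bfin : b \is a fin_num.
  rewrite ge0_fin_numE// (le_lt_trans _ (ltry (6 * sigma ^+ 2)))//.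
  apply: integral_centred_normal_sqr_le (sqr_ge0 _).
    exact: measurable_noise.
  exact: noise_law.
have infE : ereal_inf (range (risk D)) = b.
  apply/eqP; rewrite eq_le; apply/andP; split.
    apply: ereal_inf_lbound; exists wstar => //.
    by rewrite riskE kE subrr /q mulmx0 dotprodC dotprod0l mulr0 add0e.
  apply: le_ereal_inf_tmp => _ [v _ <-].
  by rewrite riskE kE leeDr// lee_fin mulr_ge0// hpsd.
by rewrite /excess_risk infE riskE kE -/b addeK.
Qed.

End linear_model_risk.

(** * Gradient descent *)

Section gradient_descent_energy.
Context {R : realType} {d : nat}.
Variables (H : 'M[R]_d) (M eta : R).
Hypothesis Hsym : forall u v : 'cV[R]_d,
  dotprod u (H *m v) = dotprod (H *m u) v.
Hypothesis Hpsd : forall v : 'cV[R]_d, 0 <= dotprod v (H *m v).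
Hypothesis HM : forall v : 'cV[R]_d, dotprod v (H *m v) <= M * dotprod v v.
Hypothesis M0 : 0 < M.
Hypothesis eta0 : 0 < eta.
Hypothesis etaM : eta * M <= 1.

Let N (v : 'cV[R]_d) := dotprod v v.
Let E (v : 'cV[R]_d) := dotprod v (H *m v).

Lemma dotprodvv_ge0 (v : 'cV[R]_d) : 0 <= dotprod v v.
Proof. by apply: sumr_ge0 => j _; rewrite -expr2 sqr_ge0. Qed.

Lemma normsqD (u v : 'cV[R]_d) :
  dotprod (u + v) (u + v) = dotprod u u + 2 * dotprod u v + dotprod v v.
Proof. by rewrite dotprodDl !dotprodDr (dotprodC v u); ring. Qed.

Lemma energyD (u v : 'cV[R]_d) : E (u + v) = E u + 2 * dotprod u (H *m v) + E v.
Proof.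
rewrite /E mulmxDr dotprodDl !dotprodDr (Hsym v u) (dotprodC (H *m v) u); ring.
Qed.

Lemma energyZ (a : R) (u : 'cV[R]_d) : E (a *: u) = a ^+ 2 * E u.
Proof. by rewrite /E -scalemxAr dotprodZl dotprodZr; ring. Qed.

Lemma two_dotprod_le (s : R) (u v : 'cV[R]_d) : 0 < s ->
  2 * dotprod u v <= s * dotprod u u + s^-1 * dotprod v v.
Proof.
move=> s0; have := dotprodvv_ge0 (s *: u - v).
rewrite normsqD !(dotprodNr, dotprodNl, dotprodZl, dotprodZr) => h.
rewrite -(ler_pM2l s0) mulrDr mulVKf ?gt_eqF//.
by move: h; set a := dotprod u u; set b := dotprod v v; set c := dotprod u v; lra.
Qed.

Lemma energyD_le (u v : 'cV[R]_d) : E (u + v) <= 2 * E u + 2 * E v.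
Proof.
have := Hpsd (u - v); rewrite -/(E _) energyD energyD mulmxN dotprodNr.
rewrite -[- v]scaleN1r energyZ sqrrN expr1n mul1r; lra.
Qed.

(** Positivity of [H] at [v - M^-1 H v], combined with [HM] at [H v]. *)
Lemma normsq_mulmx_le (v : 'cV[R]_d) : N (H *m v) <= M * E v.
Proof.
have := Hpsd (v - M^-1 *: (H *m v)); rewrite -/(E _) energyD -scaleNr energyZ.
rewrite -scalemxAr dotprodZr Hsym -/(N _) => h.
have h2 := HM (H *m v); rewrite -/(E _) -/(N _) in h2.
have h3 : (- M^-1) ^+ 2 * E (H *m v) <= M^-1 * N (H *m v).
  rewrite sqrrN expr2 -mulrA ler_pM2l ?invr_gt0//.
  by rewrite -ler_pdivlMl ?invr_gt0// invrK.
have h4 : M^-1 * N (H *m v) <= E v by move: h h3; rewrite mulNr; lra.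
by move: h4; rewrite -ler_pdivlMl ?invr_gt0// invrK.
Qed.

Lemma eta_normsq_mulmx_le (v : 'cV[R]_d) : eta * N (H *m v) <= E v.
Proof.
apply: le_trans (_ : eta * M * E v <= _).
  by rewrite -mulrA ler_pM2l// normsq_mulmx_le.
by rewrite ler_piMl// Hpsd.
Qed.

Lemma normsq_step_le (v : 'cV[R]_d) :
  N (v - eta *: (H *m v)) <= N v - eta * E v.
Proof.
rewrite /N normsqD dotprodNr dotprodNl dotprodNr !dotprodZr dotprodZl.
rewrite -/(N v) -/(N (H *m v)) -/(E _) opprK.
have := eta_normsq_mulmx_le v; rewrite -(ler_pM2l eta0); lra.
Qed.

Lemma energy_step_le (v : 'cV[R]_d) : E (v - eta *: (H *m v)) <= E v.
Proof.
rewrite energyD -scaleNr -scalemxAr dotprodZr Hsym -/(N _) energyZ sqrrN.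
have h : eta ^+ 2 * E (H *m v) <= eta * N (H *m v).
  rewrite expr2 -mulrA ler_pM2l//.
  apply: le_trans (_ : eta * (M * N (H *m v)) <= _).
    by rewrite ler_pM2l// HM.
  by rewrite mulrA ler_piMl// dotprodvv_ge0.
have h2 : 0 <= eta * N (H *m v) by rewrite mulr_ge0 ?dotprodvv_ge0 ?ltW.
lra.
Qed.

(** [eta t E + N] is a Lyapunov function: each step lowers [N] by at least [eta E], which pays for
    the growth of the factor [t]. *)
Lemma bias_energy (v : 'cV[R]_d) (t : nat) :
  let b := iter t (fun u => u - eta *: (H *m u)) v in
  eta * t%:R * E b + N b <= N v.
Proof.
elim: t => [|t] /=; first by rewrite mulr0 mul0r add0r.
set b := iter t _ v => IH; apply: le_trans IH.
have h1 := normsq_step_le b; have h2 := energy_step_le b.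
set b' := b - _ in h1 h2 *.
have h3 : eta * t.+1%:R * E b' <= eta * t.+1%:R * E b.
  by rewrite ler_pM2l// mulr_gt0// ltr0n.
by move: h1 h3; rewrite -natr1 mulrDr mulr1 !mulrDl; lra.
Qed.

(** The first bound iterates [|r'| <= |r| + eta |xi|], written with squares. The second holds
    because the objective [E / 2 - <xi, .>], which vanishes at the start, never increases. *)
Lemma variance_energy (xi : 'cV[R]_d) (t : nat) :
  let r := iter t (fun u => u - eta *: (H *m u - xi)) 0 in
  N r <= (eta * t%:R) ^+ 2 * N xi /\ E r <= 2 * dotprod xi r.
Proof.
elim: t => [|t] /=.
  rewrite /E /N mulmx0 (dotprodC xi) !dotprod0l mulr0; split => //.
  by rewrite mulr_ge0 ?sqr_ge0 ?dotprodvv_ge0.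
set r := iter t _ 0 => -[IH1 IH2]; split.
  have -> : r - eta *: (H *m r - xi) = (r - eta *: (H *m r)) + eta *: xi.
    by rewrite scalerBr opprB addrA addrAC.
  have h1 := normsq_step_le r; set u := r - _ in h1 *.
  have h2 : N u <= (eta * t%:R) ^+ 2 * N xi.
    apply: le_trans IH1; apply: le_trans h1 _.
    by rewrite gerBl mulr_ge0 ?Hpsd ?ltW.
  have Nxi : 0 <= N xi by exact: dotprodvv_ge0.
  rewrite /N normsqD dotprodZl !dotprodZr -/(N u) -/(N xi).
  have [t0|t0] := posnP t.
    have -> : u = 0 by rewrite /u /r t0 /= mulmx0 scaler0 subrr.
    by rewrite /N !dotprod0l t0 !mulr0 !add0r mulr1 mulrA -expr2.
  have t0' : 0 < t%:R :> R by rewrite ltr0n.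
  (* Weight [1 / t] is sharp in the extreme case [u = eta t xi], so that [t^2 + 2 t + 1] closes the
     induction. *)
  have h3 := @two_dotprod_le (t%:R)^-1 u (eta *: xi).
  have {h3} := h3 _; rewrite invr_gt0 invrK => /(_ t0').
  rewrite dotprodZl !dotprodZr -/(N u) -/(N xi) => h3.
  have h4 : t%:R^-1 * N u <= eta ^+ 2 * t%:R * N xi.
    by rewrite ler_pdivrMl// (le_trans h2)// le_eqVlt; apply/orP; left; apply/eqP; ring.
  move: h2 h3 h4; rewrite (_ : (eta * t.+1%:R) ^+ 2 * N xi = (eta * t%:R) ^+ 2 * N xi +
    2 * (eta ^+ 2 * t%:R * N xi) + eta * (eta * N xi)); last first.
    by rewrite -[t.+1%:R]natr1; ring.
  rewrite (_ : t%:R * (eta * (eta * N xi)) = eta ^+ 2 * t%:R * N xi); last by ring.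
  lra.
set g := H *m r - xi.
rewrite energyD -scaleNr -scalemxAr dotprodZr energyZ sqrrN Hsym.
rewrite (dotprodDr r (- eta *: g) xi) dotprodZr.
have h : eta ^+ 2 * E g <= eta * N g.
  rewrite expr2 -mulrA ler_pM2l//.
  apply: le_trans (_ : eta * (M * N g) <= _); first by rewrite ler_pM2l// HM.
  by rewrite mulrA ler_piMl// dotprodvv_ge0.
have Ng : N g = dotprod (H *m r) g - dotprod xi g by rewrite /N {1}/g dotprodBl.
have h2 : 0 <= eta * N g by rewrite mulr_ge0 ?dotprodvv_ge0 ?ltW.
have : eta * N g = eta * dotprod (H *m r) g - eta * dotprod xi g.
  by rewrite Ng mulrBr.
lra.
Qed.

Lemma gradient_descent_error (xi w : 'cV[R]_d) (t : nat) : (0 < t)%N ->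
  let e := iter t (fun u => u - eta *: (H *m u - xi)) w in
  E e <= 2 * (N w / (eta * t%:R)) + 4 * (eta * t%:R * N xi) /\
  N e <= 2 * N w + 2 * ((eta * t%:R) ^+ 2 * N xi).
Proof.
move=> t0 /=.
have -> : iter t (fun u => u - eta *: (H *m u - xi)) w =
    iter t (fun u => u - eta *: (H *m u)) w +
    iter t (fun u => u - eta *: (H *m u - xi)) 0.
  clear t0; elim: t => [|t IH] /=; first by rewrite addr0.
  rewrite IH mulmxDr; set a := iter _ _ w; set b := iter _ _ 0.
  rewrite -addrA (addrA a) addrACA; congr (_ + _).
  by rewrite -addrA scalerDr opprD.
have /= h1 := bias_energy w t; have /= [h2 h3] := variance_energy xi t.
set b := iter _ _ w in h1 *; set r := iter _ _ 0 in h2 h3 *.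
have s0 : 0 < eta * t%:R by rewrite mulr_gt0// ltr0n.
have Nb : 0 <= N b by exact: dotprodvv_ge0.
have Eb : 0 <= eta * t%:R * E b by rewrite mulr_ge0 ?Hpsd ?ltW.
split.
  apply: le_trans (energyD_le _ _) _.
  have h4 : E b <= N w / (eta * t%:R) by rewrite ler_pdivlMr// mulrC; lra.
  have := two_dotprod_le xi r s0; rewrite -/(N _) -/(N _) => h5.
  have h6 : (eta * t%:R)^-1 * N r <= eta * t%:R * N xi.
    by rewrite ler_pdivrMl// mulrA -expr2.
  lra.
rewrite /N normsqD -/(N b) -/(N r) -/(N w) -/(N xi).
have := two_dotprod_le b r ltr01; rewrite invr1 !mul1r -/(N b) -/(N r); lra.
Qed.

End gradient_descent_energy.

(** * The gradient of the empirical loss *)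

Section empirical_gradient.
Context {R : realType} {n d : nat}.
Implicit Type z : 'I_n -> d.-tuple R * R.

Definition empirical_cov z : 'M[R]_d :=
  n%:R^-1 *: \sum_(i < n) vec (z i).1 *m (vec (z i).1)^T.

Definition mean_noise z (wstar : 'cV[R]_d) : 'cV[R]_d :=
  n%:R^-1 *: \sum_(i < n)
    ((z i).2 - dotprod wstar (vec (z i).1)) *: vec (z i).1.

Lemma dotprod_suml (I : Type) (r : seq I) (F : I -> 'cV[R]_d) (v : 'cV[R]_d) :
  dotprod (\sum_(i <- r) F i) v = \sum_(i <- r) dotprod (F i) v.
Proof.
elim: r => [|i r IH]; first by rewrite !big_nil dotprod0l.
by rewrite !big_cons dotprodDl IH.
Qed.

Lemma mulmx_vec (x v : 'cV[R]_d) : x *m x^T *m v = dotprod x v *: x.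
Proof.
apply/colP => j; rewrite -mulmxA [LHS]mxE big_ord1 [RHS]mxE mulrC.
by congr (_ * _); rewrite mxE; apply: eq_bigr => k _; rewrite mxE.
Qed.

Lemma empirical_cov_mul z (v : 'cV[R]_d) :
  empirical_cov z *m v =
  n%:R^-1 *: \sum_(i < n) dotprod (vec (z i).1) v *: vec (z i).1.
Proof.
rewrite -scalemxAl mulmx_suml; congr (_ *: _).
by apply: eq_bigr => i _; rewrite mulmx_vec.
Qed.

Lemma empirical_covE z (u v : 'cV[R]_d) :
  dotprod u (empirical_cov z *m v) =
  n%:R^-1 * \sum_(i < n) dotprod u (vec (z i).1) * dotprod v (vec (z i).1).
Proof.
rewrite empirical_cov_mul dotprodZr; congr (_ * _).
rewrite dotprodC dotprod_suml; apply: eq_bigr => i _.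
by rewrite dotprodZl mulrC (dotprodC u) (dotprodC v).
Qed.

Lemma gradient_empirical_loss z (wstar w : 'cV[R]_d) : (0 < n)%N ->
  gradient (empirical_loss z) w =
  empirical_cov z *m (w - wstar) - mean_noise z wstar.
Proof.
move=> n0; have n0' : n%:R != 0 :> R by rewrite pnatr_eq0 -lt0n.
pose res i := (z i).2 - dotprod w (vec (z i).1).
transitivity (- (n%:R^-1 *: \sum_(i < n) res i *: vec (z i).1)); last first.
  rewrite empirical_cov_mul -scalerN -scalerBr; congr (_ *: _).
  rewrite -sumrN -sumrB; apply: eq_bigr => i _.
  rewrite -scaleNr -scalerBl; congr (_ *: _).
  by rewrite /res dotprodBr !(dotprodC (vec _)); ring.
apply/colP => j; rewrite mxE [RHS]mxE.
rewrite [in RHS]mxE summxE -mulrN -sumrN.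
pose v : 'cV[R]_d := delta_mx j 0.
have vE i : dotprod v (vec (z i).1) = vec (z i).1 j 0.
  rewrite /dotprod (bigD1 j)//= big1 ?addr0 ?mxE ?eqxx ?mul1r//.
  by move=> k /negbTE kj; rewrite !mxE kj mul0r.
set A := RHS; pose Q := (2 * n%:R)^-1 * \sum_(i < n) (dotprod v (vec (z i).1)) ^+ 2.
(* The loss is quadratic along [v], so the difference quotient is exactly affine in [h]. *)
have expand h : empirical_loss z (h *: v + w) - empirical_loss z w =
    h * (A + h * Q).
  have -> : A = (2 * n%:R)^-1 *
      \sum_(i < n) (- 2 * res i * dotprod v (vec (z i).1)).
    rewrite (_ : (2 * n%:R)^-1 = n%:R^-1 * 2^-1); last by field.
    rewrite /A -mulrA; congr (_ * _); rewrite mulr_sumr; apply: eq_bigr => i _.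
    by rewrite mxE vE; field.
  rewrite /empirical_loss -mulrBr -sumrB /Q.
  set c := (2 * n%:R)^-1; set S1 := \sum_(i < n) (- 2 * _ * _).
  set S2 := \sum_(i < n) dotprod v _ ^+ 2.
  rewrite [RHS](_ : _ = c * (h * S1 + h ^+ 2 * S2)); last by ring.
  congr (_ * _); rewrite /S1 /S2 !mulr_sumr -big_split; apply: eq_bigr => i _ /=.
  by rewrite dotprodDl dotprodZl /res; ring.
have cv : (fun h : R => A + h * Q) h @[h --> 0^'] --> A + 0 * Q.
  apply: cvgD; first exact: cvg_cst.
  apply: cvgM; last exact: cvg_cst.
  exact: nbhs_dnbhs.
rewrite mul0r addr0 in cv.
rewrite /derive; apply/cvg_lim => //.
apply: cvg_trans cv; apply: near_eq_cvg.
near=> h.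
have h0 : h != 0 by near: h; exact: nbhs_dnbhs_neq.
by rewrite /= expand scalerA mulVf// scale1r.
Unshelve. all: by end_near.
Qed.

Lemma gd_errorE z (wstar : 'cV[R]_d) (eta : R) (t : nat) : (0 < n)%N ->
  gd z eta t - wstar =
  iter t (fun u => u - eta *: (empirical_cov z *m u - mean_noise z wstar))
    (- wstar).
Proof.
move=> n0; elim: t => [|t IH] /=; first by rewrite /gd /= sub0r.
by rewrite -IH {1}/gd /= (gradient_empirical_loss _ wstar)// addrAC.
Qed.

End empirical_gradient.

(** * Change of measure on the sign cube *)

Section finite_inequalities.
Context {R : realType} {I : finType}.

Lemma sum_cauchy_schwarz (a b : I -> R) :
  (\sum_i a i * b i) ^+ 2 <= (\sum_i a i ^+ 2) * (\sum_i b i ^+ 2).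
Proof.
set A := \sum_i a i ^+ 2; set B := \sum_i b i ^+ 2; set C := \sum_i a i * b i.
have B0 : 0 <= B by apply: sumr_ge0 => i _; exact: sqr_ge0.
have [B00|Bn0] := eqVneq B 0.
  have b0 i : b i = 0.
    apply/eqP; rewrite -sqrf_eq0; apply/eqP.
    move/eqP: B00; rewrite psumr_eq0; last by move=> j _; exact: sqr_ge0.
    by move/allP => /(_ i (mem_index_enum _)) /eqP.
  rewrite /C big1 ?expr0n ?B00 ?mulr0// => i _; by rewrite b0 mulr0.
have Bp : 0 < B by rewrite lt0r Bn0.
have : 0 <= \sum_i (a i * B - b i * C) ^+ 2.
  by apply: sumr_ge0 => i _; exact: sqr_ge0.
under eq_bigr do rewrite sqrrB !exprMn.
rewrite big_split sumrB /= -!mulr_suml.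
rewrite (_ : \sum_i (a i * B * (b i * C)) *+ 2 = 2 * B * C * C); last first.
  transitivity (2 * B * C * \sum_i a i * b i) => //; rewrite mulr_sumr.
  by apply: eq_bigr => i _; rewrite -mulr_natl; ring.
rewrite -/A -/B (_ : A * B ^+ 2 - 2 * B * C * C + B * C ^+ 2 =
  B * (A * B - C ^+ 2)); last by ring.
by rewrite pmulr_rge0// subr_ge0.
Qed.

(** The tangent to the exponential at the mean [m], averaged. *)
Lemma expR_jensen (w h : I -> R) :
  (forall i, 0 <= w i) -> \sum_i w i = 1 ->
  expR (\sum_i w i * h i) <= \sum_i w i * expR (h i).
Proof.
move=> w0 w1; set m := \sum_i w i * h i.
have tangent i : expR m * (1 + (h i - m)) <= expR (h i).
  by rewrite -[X in _ <= expR X](subrKC m) expRD ler_pM2l ?expR_gt0// expR_ge1Dx.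
apply: le_trans (_ : \sum_i w i * (expR m * (1 + (h i - m))) <= _); last first.
  by apply: ler_sum => i _; rewrite ler_wpM2l.
rewrite (_ : \sum_i _ = expR m * (\sum_i w i * (1 - m) + m)).
  by rewrite -mulr_suml w1 mul1r subrK mulr1.
rewrite /m -big_split /= mulr_sumr; apply: eq_bigr => i _; ring.
Qed.

End finite_inequalities.

Section sign_cube.
Context {R : realType} {K : finType}.
Implicit Types (b c : K -> R) (s : {ffun K -> bool}).

Definition sign_of (x : bool) : R := if x then 1 else -1.

(** The law of independent signs, the [k]-th of mean [b k]. It is a probability when all
    [|b k| <= 1], and the uniform law when [b = 0]. *)
Definition cube_weight b s : R := \prod_k ((1 + sign_of (s k) * b k) / 2).

Lemma cube_weight_prod b (f : K -> bool -> R) :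
  \sum_s cube_weight b s * \prod_k f k (s k) =
  \prod_k ((1 + b k) / 2 * f k true + (1 - b k) / 2 * f k false).
Proof.
under [RHS]eq_bigr => k _.
  rewrite (_ : _ + _ =
    \sum_(x : bool) (1 + sign_of x * b k) / 2 * f k x); last first.
    by rewrite big_bool /= mul1r mulN1r.
  over.
rewrite bigA_distr_bigA /=; apply: eq_bigr => s _.
by rewrite /cube_weight -big_split.
Qed.

Lemma sum_cube_weight b : \sum_s cube_weight b s = 1.
Proof.
transitivity (\sum_s cube_weight b s * \prod_(k : K) 1).
  by apply: eq_bigr => s _; rewrite big1_eq mulr1.
by rewrite (cube_weight_prod b (fun _ _ => 1)) big1// => k _; field.
Qed.

Lemma cube_weight_mean b (k : K) :
  \sum_s cube_weight b s * sign_of (s k) = b k.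
Proof.
transitivity (\sum_s cube_weight b s *
    \prod_l (if l == k then sign_of (s l) else 1)).
  apply: eq_bigr => s _; rewrite (bigD1 k)//= eqxx big1 ?mulr1//.
  by move=> l /negbTE ->.
rewrite (cube_weight_prod b (fun l x => if l == k then sign_of x else 1)).
rewrite (bigD1 k)//= eqxx big1 => [|l /negbTE ->]; last by field.
by rewrite mulr1; field.
Qed.

Lemma cube_weight_cov b (k l : K) :
  \sum_s cube_weight b s * (sign_of (s k) * sign_of (s l)) =
  if k == l then 1 else b k * b l.
Proof.
have [<-|kl] := eqVneq k l.
  rewrite -[RHS](sum_cube_weight b); apply: eq_bigr => s _.
  by case: (s k); rewrite /= ?mulr1 ?mulrNN ?mulr1.
transitivity (\sum_s cube_weight b s *
    \prod_j (if (j == k) || (j == l) then sign_of (s j) else 1)).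
  apply: eq_bigr => s _.
  rewrite (bigD1 k)//= eqxx (bigD1 l) 1?eq_sym//= eqxx orbT big1 ?mulr1//.
  by move=> j /andP[/negbTE -> /negbTE ->].
rewrite (cube_weight_prod b
  (fun j x => if (j == k) || (j == l) then sign_of x else 1)).
rewrite (bigD1 k)//= eqxx (bigD1 l) 1?eq_sym//= eqxx orbT big1.
  by rewrite mulr1 /=; field.
by move=> j /andP[/negbTE -> /negbTE ->] /=; field.
Qed.

Lemma cube_weight_lin b c :
  \sum_s cube_weight b s * (\sum_k c k * sign_of (s k)) = \sum_k c k * b k.
Proof.
under eq_bigr do rewrite mulr_sumr.
rewrite exchange_big; apply: eq_bigr => k _ /=.
rewrite -(cube_weight_mean b k) mulr_sumr; apply: eq_bigr => s _; ring.
Qed.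

Lemma cube_weight_sqr b c :
  \sum_s cube_weight b s * (\sum_k c k * sign_of (s k)) ^+ 2 =
  (\sum_k c k * b k) ^+ 2 + \sum_k c k ^+ 2 * (1 - b k ^+ 2).
Proof.
transitivity (\sum_k \sum_l c k * c l * (if k == l then 1 else b k * b l)).
  under eq_bigr do rewrite expr2 mulr_suml mulr_sumr.
  rewrite exchange_big; apply: eq_bigr => k _ /=.
  under eq_bigr do rewrite mulr_sumr mulr_sumr.
  rewrite exchange_big; apply: eq_bigr => l _ /=.
  rewrite -cube_weight_cov mulr_sumr; apply: eq_bigr => s _; ring.
rewrite expr2 mulr_suml -big_split; apply: eq_bigr => k _ /=.
rewrite mulr_sumr (bigD1 k)//= eqxx [in RHS](bigD1 k)//= addrAC.
congr (_ + _); first by ring.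
by apply: eq_bigr => l /negbTE; rewrite eq_sym => ->; ring.
Qed.

Lemma cube_weight_var_le b c :
  \sum_s cube_weight b s * (\sum_k c k * sign_of (s k) - \sum_k c k * b k) ^+ 2
  <= \sum_k c k ^+ 2.
Proof.
set m := \sum_k c k * b k.
rewrite [X in X <= _](_ : _ =
  \sum_s cube_weight b s * (\sum_k c k * sign_of (s k)) ^+ 2 -
  2 * m * (\sum_s cube_weight b s * (\sum_k c k * sign_of (s k))) +
  m ^+ 2 * \sum_s cube_weight b s); last first.
  rewrite [2 * m * _]mulr_sumr [m ^+ 2 * _]mulr_sumr -sumrB -big_split.
  by apply: eq_bigr => s _ /=; ring.
rewrite cube_weight_sqr cube_weight_lin sum_cube_weight -/m.
rewrite (_ : _ - _ + _ = \sum_k c k ^+ 2 * (1 - b k ^+ 2)); last by ring.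
apply: ler_sum => k _; rewrite ler_piMr ?sqr_ge0// gerBl; exact: sqr_ge0.
Qed.

Lemma cube_weight_ge0 b s : (forall k, `|b k| <= 1) -> 0 <= cube_weight b s.
Proof.
move=> b1; apply: prodr_ge0 => k _; rewrite divr_ge0//.
by have := b1 k; rewrite ler_norml => /andP[]; case: (s k) => /=; lra.
Qed.

Lemma cube_weight0 s : cube_weight (fun=> 0) s = 2^-1 ^+ #|K|.
Proof.
rewrite /cube_weight -prodr_const; apply: eq_bigr => k _.
by rewrite mulr0 addr0 mul1r.
Qed.

Lemma sum_cube_weight_sqr b :
  \sum_s cube_weight b s ^+ 2 = 2^-1 ^+ #|K| * \prod_k (1 + b k ^+ 2).
Proof.
transitivity (\sum_s cube_weight b s *
    \prod_k ((1 + sign_of (s k) * b k) / 2)).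
  by apply: eq_bigr => s _; rewrite expr2.
rewrite (cube_weight_prod b (fun k x => (1 + sign_of x * b k) / 2)).
by rewrite -prodr_const -big_split; apply: eq_bigr => k _ /=; field.
Qed.

(* The posterior has density [prod (1 + s_k b_k)] with respect to the uniform
   prior, whose second moment is [prod (1 + b_k^2)]; Cauchy-Schwarz then plays
   the role of the Donsker-Varadhan formula. *)
Lemma cube_change_of_measure b (h : {ffun K -> bool} -> R) :
  (forall k, `|b k| <= 1) ->
  expR (\sum_s cube_weight b s * h s) <=
  expR (\sum_k b k ^+ 2) * \sum_s cube_weight (fun=> 0) s * expR (h s).
Proof.
move=> b1; set W := cube_weight b.
have W0 s : 0 <= W s by exact: cube_weight_ge0.
have -> : expR (\sum_s W s * h s) = expR (\sum_s W s * (h s / 2)) ^+ 2.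
  by rewrite -expRM_natl mulr_sumr; congr expR; apply: eq_bigr => s _; field.
apply: le_trans (_ : (\sum_s W s * expR (h s / 2)) ^+ 2 <= _).
  rewrite ler_pXn2r ?nnegrE ?expR_ge0//.
    exact: expR_jensen (sum_cube_weight b).
  by apply: sumr_ge0 => s _; rewrite mulr_ge0 ?expR_ge0.
apply: le_trans (sum_cauchy_schwarz _ _) _.
have -> : \sum_s expR (h s / 2) ^+ 2 = \sum_s expR (h s).
  by apply: eq_bigr => s _; rewrite -expRM_natl mulrCA divff// mulr1.
have -> : \sum_s cube_weight (fun=> 0) s * expR (h s) =
    2^-1 ^+ #|K| * \sum_s expR (h s).
  by rewrite mulr_sumr; apply: eq_bigr => s _; rewrite cube_weight0.
rewrite sum_cube_weight_sqr mulrA [X in _ <= X * _]mulrC.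
rewrite ler_wpM2r//; first by apply: sumr_ge0 => s _; exact: expR_ge0.
rewrite ler_wpM2l ?exprn_ge0 ?invr_ge0//.
rewrite expR_sum; apply: ler_prod => k _.
by rewrite expR_ge1Dx addr_ge0 ?sqr_ge0.
Qed.

End sign_cube.

Lemma sumr_pair_const {R : realType} {d M : nat} (f : 'I_d -> R) :
  \sum_(k : 'I_d * 'I_M) f k.1 = M%:R * \sum_j f j.
Proof.
rewrite -(pair_big xpredT xpredT (fun j _ => f j)) /= mulr_sumr.
by apply: eq_bigr => j _; rewrite sumr_const card_ord mulr_natl.
Qed.

(* A finite prior [mu] on vectors [theta] and, for every [v] in the unit ball,
   a posterior [w] with mean [v], covariance at most [r2], and cost
   [|v|^2 / r2] independent of the dimension. *)
Lemma randomized_vectors {R : realType} {d : nat} (r2 : R) : 0 < r2 ->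
  exists (S : finType) (theta : S -> 'cV[R]_d) (mu : S -> R),
  [/\ forall s, 0 <= mu s, \sum_s mu s = 1 &
   forall v : 'cV[R]_d, dotprod v v <= 1 ->
   exists w : S -> R, [/\ forall s, 0 <= w s, \sum_s w s = 1,
     forall x, \sum_s w s * dotprod x (theta s) = dotprod x v,
     forall x, \sum_s w s * (dotprod x (theta s) - dotprod x v) ^+ 2 <=
       r2 * dotprod x x &
     forall h, expR (\sum_s w s * h s) <=
       expR (dotprod v v / r2) * \sum_s mu s * expR (h s)]].
Proof.
move=> r20.
(* Each coordinate is a sum of [M] signs scaled by [rho]. Then [rho M = sqrt (r2 M) >= 1] keeps the
   sign means [v_j / (rho M)] in [-1, 1], while the variance stays at most [rho^2 M = r2]. *)
have [M M0 Mr] : exists2 M : nat, (0 < M)%N & 1 <= r2 * M%:R.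
  exists (Num.trunc r2^-1).+1 => //.
  by rewrite -ler_pdivrMl// mulr1 ltW// truncnS_gt.
have M0' : 0 < M%:R :> R by rewrite ltr0n.
pose rho := Num.sqrt (r2 / M%:R).
have rho2 : rho ^+ 2 = r2 / M%:R by rewrite sqr_sqrtr// divr_ge0// ltW.
have rho0 : 0 < rho by rewrite sqrtr_gt0 divr_gt0.
have rhoM : 1 <= rho * M%:R.
  rewrite -(@expr_ge1 _ 2) ?mulr_ge0 ?(ltW rho0)//.
  rewrite exprMn rho2 (_ : r2 / M%:R * _ = r2 * M%:R)//.
  by field; rewrite gt_eqF.
pose K := ('I_d * 'I_M)%type.
pose theta (s : {ffun K -> bool}) : 'cV[R]_d :=
  \col_j (rho * \sum_(m < M) sign_of (s (j, m))).
have thetaE (x : 'cV[R]_d) s :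
    dotprod x (theta s) = \sum_(k : K) rho * x k.1 0 * sign_of (s k).
  transitivity (\sum_j \sum_m rho * x j 0 * sign_of (s (j, m))).
    by apply: eq_bigr => j _; rewrite mxE mulrCA mulrA mulr_sumr.
  by rewrite pair_big /=; apply: eq_bigr => -[j m] _.
exists {ffun K -> bool}, theta, (cube_weight (fun=> 0)); split.
- by move=> s; apply: cube_weight_ge0 => k; rewrite normr0.
- exact: sum_cube_weight.
move=> v v1; pose b (k : K) := v k.1 0 / (rho * M%:R).
have b1 k : `|b k| <= 1.
  have vk : v k.1 0 ^+ 2 <= 1.
    apply: le_trans v1; rewrite /dotprod (bigD1 k.1)//= expr2 lerDl.
    by apply: sumr_ge0 => j _; rewrite -expr2 sqr_ge0.
  rewrite normrM normfV ler_pdivrMr ?normr_gt0 ?gt_eqF ?mulr_gt0// mul1r.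
  rewrite [leRHS]gtr0_norm ?mulr_gt0//; apply: le_trans rhoM.
  by rewrite -(@expr_le1 _ 2)// real_normK// num_real.
have cb (x : 'cV[R]_d) : \sum_(k : K) rho * x k.1 0 * b k = dotprod x v.
  rewrite (sumr_pair_const (fun j => rho * x j 0 * (v j 0 / (rho * M%:R)))).
  rewrite mulr_sumr; apply: eq_bigr => j _.
  by field; rewrite !gt_eqF.
exists (cube_weight b); split.
- by move=> s; exact: cube_weight_ge0.
- exact: sum_cube_weight.
- move=> x; under eq_bigr do rewrite thetaE.
  by rewrite (cube_weight_lin b (fun k => rho * x k.1 0)) cb.
- move=> x; under eq_bigr do rewrite thetaE -cb.
  apply: le_trans (cube_weight_var_le b (fun k => rho * x k.1 0)) _.
  rewrite (sumr_pair_const (fun j => (rho * x j 0) ^+ 2)) /dotprod !mulr_sumr.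
  apply: ler_sum => j _; rewrite exprMn rho2 le_eqVlt; apply/orP; left.
  by apply/eqP; field; rewrite gt_eqF.
(* The number of signs cancels: [M |v|^2 / (rho M)^2 = |v|^2 / r2]. *)
- move=> h; rewrite (_ : dotprod v v / r2 = \sum_k b k ^+ 2).
    exact: cube_change_of_measure.
  rewrite (sumr_pair_const (fun j => (v j 0 / (rho * M%:R)) ^+ 2)).
  rewrite mulr_sumr /dotprod mulr_suml; apply: eq_bigr => j _.
  rewrite exprMn exprVn exprMn rho2; field.
  by rewrite !gt_eqF.
Qed.

Section posterior_moments.
Context {R : realType} {d : nat} {S : finType}.
Variables (theta : S -> 'cV[R]_d) (w : S -> R) (v : 'cV[R]_d) (r2 : R).
Hypothesis w0 : forall s, 0 <= w s.
Hypothesis w1 : \sum_s w s = 1.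
Hypothesis wmean : forall x, \sum_s w s * dotprod x (theta s) = dotprod x v.
Hypothesis wvar : forall x,
  \sum_s w s * (dotprod x (theta s) - dotprod x v) ^+ 2 <= r2 * dotprod x x.

Lemma posterior_sqr_le (x : 'cV[R]_d) :
  \sum_s w s * dotprod x (theta s) ^+ 2 <= dotprod x v ^+ 2 + r2 * dotprod x x.
Proof.
apply: le_trans (_ : dotprod x v ^+ 2 +
    \sum_s w s * (dotprod x (theta s) - dotprod x v) ^+ 2 <= _); last first.
  by rewrite lerD2l wvar.
rewrite le_eqVlt; apply/orP; left; apply/eqP.
set m := dotprod x v.
transitivity (m ^+ 2 * (\sum_s w s) +
  (\sum_s w s * (dotprod x (theta s) - m) ^+ 2) +
  2 * m * (\sum_s w s * dotprod x (theta s)) - 2 * m ^+ 2 * (\sum_s w s)).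
  rewrite [m ^+ 2 * _]mulr_sumr [2 * m * _]mulr_sumr [2 * m ^+ 2 * _]mulr_sumr.
  by rewrite -!big_split /= -sumrB; apply: eq_bigr => s _; ring.
by rewrite w1 wmean -/m; ring.
Qed.

Variable lam : 'I_d -> R.
Hypothesis lam0 : forall j, 0 <= lam j.
Let q (u : 'cV[R]_d) := \sum_j lam j * u j 0 ^+ 2.
Let tau := \sum_j lam j.

(** [wvar] at the basis vectors, summed with weights [lam j]: the spread is paid for with the trace,
    not with the dimension. *)
Lemma posterior_energy_var_le : \sum_s w s * q (theta s - v) <= r2 * tau.
Proof.
rewrite /q; under eq_bigr do rewrite mulr_sumr.
rewrite exchange_big /tau mulr_sumr; apply: ler_sum => j _.
have := wvar (delta_mx j 0).
have dE (u : 'cV[R]_d) : dotprod (delta_mx j 0) u = u j 0.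
  rewrite /dotprod (bigD1 j)//= big1 ?addr0 ?mxE ?eqxx ?mul1r//.
  by move=> k /negbTE kj; rewrite !mxE kj mul0r.
rewrite !dE !mxE !eqxx mulr1 => h.
rewrite mulrC; apply: le_trans (ler_wpM2l (lam0 j) h).
rewrite mulr_sumr; apply: ler_sum => s _; rewrite dE !mxE le_eqVlt.
by apply/orP; left; apply/eqP; ring.
Qed.

Lemma posterior_energy_le : \sum_s w s * q (theta s) <= 2 * q v + 2 * (r2 * tau).
Proof.
have pt s : q (theta s) <= 2 * q v + 2 * q (theta s - v).
  rewrite /q !mulr_sumr -big_split; apply: ler_sum => j _ /=.
  rewrite !mxE; set a := theta s j 0; set b := v j 0.
  rewrite (_ : _ + _ = lam j * (2 * b ^+ 2 + 2 * (a - b) ^+ 2)); last by ring.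
  rewrite ler_wpM2l// -subr_ge0 (_ : _ - _ = (a - 2 * b) ^+ 2) ?sqr_ge0//; ring.
have h := posterior_energy_var_le.
suff gen (f g : S -> R) (c e : R) : (forall s, f s <= 2 * c + 2 * g s) ->
  \sum_s w s * g s <= e -> \sum_s w s * f s <= 2 * c + 2 * e by exact: gen pt h.
move=> fg ge; apply: le_trans (_ : \sum_s w s * (2 * c + 2 * g s) <= _).
  by apply: ler_sum => s _; rewrite ler_wpM2l.
rewrite (_ : \sum_s _ = (\sum_s w s) * (2 * c) + 2 * \sum_s w s * g s).
  by rewrite w1 mul1r lerD2l ler_pM2l.
by rewrite mulr_suml mulr_sumr -big_split; apply: eq_bigr => s _ /=; ring.
Qed.

End posterior_moments.

(** * Exponential functionals of the sample *)

Lemma weighted_sum_affine {R : realType} {I : finType} (f g : I -> R)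
    (a b c : R) (w : I -> R) : \sum_i w i = 1 ->
  \sum_i w i * (a * f i + b * g i + c) =
  a * (\sum_i w i * f i) + b * (\sum_i w i * g i) + c.
Proof.
move=> w1; rewrite -[X in _ = _ + X]mulr1 -w1.
rewrite [a * _]mulr_sumr [b * _]mulr_sumr [c * _]mulr_sumr -!big_split /=.
by apply: eq_bigr => i _; ring.
Qed.

Section exponential_functionals.
Context {R : realType} {n d : nat}.
Variables (lam : 'I_d -> R) (x : 'I_n -> 'cV[R]_d) (K : R).
Hypothesis lam0 : forall j, 0 <= lam j.
Hypothesis K0 : 0 < K.
Let q (u : 'cV[R]_d) := \sum_j lam j * u j 0 ^+ 2.
Let tau := \sum_j lam j.

Lemma quadratic_ge0 (u : 'cV[R]_d) : 0 <= q u.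
Proof. by apply: sumr_ge0 => j _; rewrite mulr_ge0// sqr_ge0. Qed.

Lemma quadratic_scale (c : R) (u : 'cV[R]_d) : q (c *: u) = c ^+ 2 * q u.
Proof.
rewrite /q mulr_sumr; apply: eq_bigr => j _; rewrite mxE; ring.
Qed.

Lemma quadratic_le_homogeneous (f g : 'cV[R]_d -> R) (kappa : R) :
  (forall c u, f (c *: u) = c ^+ 2 * f u) ->
  (forall c u, g (c *: u) = c ^+ 2 * g u) ->
  (forall u, dotprod u u <= 1 -> f u <= g u + kappa) ->
  forall u, f u <= g u + kappa * dotprod u u.
Proof.
move=> fs gs H u; have [u0|u0] := eqVneq (dotprod u u) 0.
  have -> : u = 0.
    apply/colP => j; rewrite mxE; apply/eqP; rewrite -sqrf_eq0; apply/eqP.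
    move/eqP: u0; rewrite psumr_eq0 => [|k _]; last by rewrite -expr2 sqr_ge0.
    by move/allP => /(_ j (mem_index_enum _)) /eqP; rewrite -expr2.
  rewrite -(scale0r (0 : 'cV[R]_d)) fs gs dotprodZl.
  by rewrite expr0n /= !mul0r mulr0 add0r.
have N0 : 0 < dotprod u u by rewrite lt0r u0 dotprodvv_ge0.
pose c := (Num.sqrt (dotprod u u))^-1.
have c2 : c ^+ 2 * dotprod u u = 1.
  by rewrite /c exprVn sqr_sqrtr ?(ltW N0)// mulVf.
have := H (c *: u); rewrite dotprodZl dotprodZr mulrA -expr2 c2 lexx fs gs.
move=> /(_ isT) h; have c20 : 0 < c ^+ 2.
  by rewrite exprn_gt0// invr_gt0 sqrtr_gt0.
rewrite -(ler_pM2l c20) mulrDr (mulrCA _ kappa) c2; lra.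
Qed.

(** The vectors [theta s] may be long, so the exponent is divided by [q (theta s) + 1] to keep its
    exponential moment at most [sqrt 2]. The factor 1/2 then makes the mean of each term at most
    1. *)
Definition upper_functional {S : finType} (theta : S -> 'cV[R]_d)
    (mu : S -> R) : R :=
  \sum_s mu s * \prod_(i < n)
    (expR ((4 * (q (theta s) + 1))^-1 * dotprod (theta s) (x i) ^+ 2) / 2).

(** The normalised square is not linear in posterior moments. Young's inequality replaces it by a
    lower bound involving only [<theta, x_i>] and [q (theta)], whose posterior means are known. *)
Lemma upper_of_functional (B : R) {S : finType} (theta : S -> 'cV[R]_d)
    (mu w : S -> R) (v : 'cV[R]_d) (r2 : R) :
  upper_functional theta mu < K ->
  (forall s, 0 <= w s) -> \sum_s w s = 1 ->
  (forall y, \sum_s w s * dotprod y (theta s) = dotprod y v) ->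
  (forall y, \sum_s w s * (dotprod y (theta s) - dotprod y v) ^+ 2 <=
     r2 * dotprod y y) ->
  (forall h, expR (\sum_s w s * h s) <=
     expR (dotprod v v / r2) * \sum_s mu s * expR (h s)) ->
  q v <= B -> r2 * tau <= 1 -> 0 <= B ->
  \sum_i dotprod v (x i) ^+ 2 <=
    4 * (2 * B + 3) * (n%:R * ln 2 + dotprod v v / r2 + ln K).
Proof.
move=> WK w0 w1 wm wv wexp qB rt B0.
pose h s := \sum_(i < n)
  ((4 * (q (theta s) + 1))^-1 * dotprod (theta s) (x i) ^+ 2 - ln 2).
have hE : upper_functional theta mu = \sum_s mu s * expR (h s).
  apply: eq_bigr => s _; congr (_ * _); rewrite expR_sum.
  by apply: eq_bigr => i _; rewrite expRD expRN lnK// posrE.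
have Eh : \sum_s w s * h s <= dotprod v v / r2 + ln K.
  rewrite -ler_expR expRD lnK ?posrE//; apply: le_trans (wexp h) _.
  by rewrite ler_pM2l ?expR_gt0// -hE ltW.
have Eq := posterior_energy_le w0 w1 wv lam0.
have qth s : 0 <= q (theta s) by exact: quadratic_ge0.
set Y := \sum_i dotprod v (x i) ^+ 2.
have Y0 : 0 <= Y by apply: sumr_ge0 => i _; exact: sqr_ge0.
(* [2 * B + 3] bounds the posterior mean of [q (theta) + 1], so the quadratic loss is at most half
   of the linear gain [c Y / 2]. *)
pose c := (2 * B + 3)^-1; have c0 : 0 < c by rewrite invr_gt0; lra.
pose f s := \sum_i dotprod v (x i) * dotprod (theta s) (x i).
have pt s : 2^-1 * c * f s + - (4^-1 * c ^+ 2 * Y) * q (theta s) +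
    (- (4^-1 * c ^+ 2 * Y) - n%:R * ln 2) <= h s.
  rewrite (_ : _ + (_ - _) = 2^-1 * c * f s -
    4^-1 * c ^+ 2 * Y * (q (theta s) + 1) - n%:R * ln 2); last by ring.
  rewrite /h sumrB sumr_const card_ord mulr_natl lerD2r /Y /f.
  rewrite !mulr_sumr mulr_suml -sumrB; apply: ler_sum => i _.
  set a := dotprod v _; set b := dotprod _ _; set p := q (theta s) + 1.
  have p0 : 0 < p by rewrite ltr_wpDl.
  rewrite -subr_ge0 (_ : _ - _ = (4 * p)^-1 * (b - c * a * p) ^+ 2).
    by rewrite mulr_ge0 ?sqr_ge0// invr_ge0 mulr_ge0// ltW.
  by field; rewrite gt_eqF.
have Elin : \sum_s w s * f s = Y.
  rewrite /f; under eq_bigr do rewrite mulr_sumr.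
  rewrite exchange_big; apply: eq_bigr => i _ /=.
  rewrite expr2 [in X in _ = _ * X]dotprodC -wm mulr_sumr.
  by apply: eq_bigr => s _; rewrite (dotprodC (theta s)); ring.
have low : 2^-1 * c * Y + - (4^-1 * c ^+ 2 * Y) * (\sum_s w s * q (theta s)) +
    (- (4^-1 * c ^+ 2 * Y) - n%:R * ln 2) <= \sum_s w s * h s.
  rewrite -{1}Elin -(weighted_sum_affine f (fun s => q (theta s)) _ _ _ w1).
  by apply: ler_sum => s _; rewrite ler_wpM2l.
have Eq' : \sum_s w s * q (theta s) <= 2 * B + 2.
  by apply: le_trans Eq _; rewrite lerD ?ler_pM2l// ger_pMr.
have cB : c * (2 * B + 3) = 1 by rewrite mulVf// gt_eqF//; lra.
have low2 : 4^-1 * c ^+ 2 * Y * (\sum_s w s * q (theta s) + 1) <= 4^-1 * c * Y.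
  rewrite (_ : 4^-1 * c * Y = 4^-1 * c ^+ 2 * Y * (2 * B + 3)); last first.
    transitivity (4^-1 * c * Y * (c * (2 * B + 3))); last by ring.
    by rewrite cB mulr1.
  rewrite ler_wpM2l//; last by lra.
  by rewrite mulr_ge0// mulr_ge0 ?invr_ge0 ?sqr_ge0.
have cY : c * Y <= 4 * (n%:R * ln 2 + dotprod v v / r2 + ln K) by lra.
rewrite (_ : Y = (2 * B + 3) * (c * Y)); last by rewrite mulrA [_ * c]mulrC cB mul1r.
by rewrite (_ : 4 * _ * _ = (2 * B + 3) *
  (4 * (n%:R * ln 2 + dotprod v v / r2 + ln K))) ?ler_wpM2l//; [lra|ring].
Qed.

(** The square root is the inverse of the Gaussian mean of the exponential, so each factor has mean
    exactly 1 under the model. *)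
Definition lower_functional (B : R) {S : finType} (theta : S -> 'cV[R]_d)
    (mu : S -> R) : R :=
  \sum_s mu s * \prod_(i < n)
    (expR (- B^-1 * dotprod (theta s) (x i) ^+ 2) *
     Num.sqrt (1 + 2 * B^-1 * q (theta s))).

(** A linear lower bound for the logarithm, stable under averaging: [y] is an estimate from below of
    [p] that may be negative, and [y <= 1] stays where the logarithm is comparable to its
    argument. *)
Lemma ln1D_ge_half (y p : R) : y <= 1 -> y <= p -> 0 <= p ->
  y / 2 <= ln (1 + p).
Proof.
move=> y1 yp p0; have [y0|y0] := ltP y 0.
  by rewrite (@le_trans _ _ 0)//; [lra|rewrite ln_ge0// lerDl].
apply: (@le_trans _ _ (ln (1 + y))); last by rewrite ler_ln ?posrE; lra.
rewrite -ler_expR lnK ?posrE; last by lra.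
have := expR_ge1Dx (- (y / 2)); rewrite expRN => h.
have h1 : 0 < 1 - y / 2 by lra.
have : expR (y / 2) <= (1 - y / 2)^-1 by rewrite -lef_pV2 ?posrE ?invr_gt0 ?expR_gt0// invrK.
move=> /le_trans; apply; rewrite -div1r ler_pdivrMr//.
have : 0 <= y * (1 - y) by rewrite mulr_ge0//; lra.
lra.
Qed.

(** The spread of the posterior enters twice: through [q (theta - v)], which costs [r2 * tau], and
    through the squares [<theta, x_i>^2], which cost [r2 |x_i|^2]. The second cost is why the
    empirical trace has to be controlled too. *)
Lemma lower_of_functional (B : R) {S : finType} (theta : S -> 'cV[R]_d)
    (mu w : S -> R) (v : 'cV[R]_d) (r2 : R) :
  lower_functional B theta mu < K ->
  (forall s, 0 <= w s) -> \sum_s w s = 1 ->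
  (forall y, \sum_s w s * dotprod y (theta s) = dotprod y v) ->
  (forall y, \sum_s w s * (dotprod y (theta s) - dotprod y v) ^+ 2 <=
     r2 * dotprod y y) ->
  (forall h, expR (\sum_s w s * h s) <=
     expR (dotprod v v / r2) * \sum_s mu s * expR (h s)) ->
  0 < B -> q v <= B ->
  n%:R * q v <= 4 * \sum_i dotprod v (x i) ^+ 2 + 2 * n%:R * (r2 * tau) +
    4 * (r2 * \sum_i dotprod (x i) (x i)) + 4 * B * (dotprod v v / r2 + ln K).
Proof.
move=> WK w0 w1 wm wv wexp B0 qB.
have qth s : 0 <= q (theta s) by exact: quadratic_ge0.
have D1 s : 0 < 1 + 2 * B^-1 * q (theta s).
  by rewrite ltr_pwDl// !mulr_ge0// invr_ge0 ltW.
pose f s := \sum_(i < n) dotprod (theta s) (x i) ^+ 2.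
pose h s := \sum_(i < n) (- B^-1 * dotprod (theta s) (x i) ^+ 2 +
  2^-1 * ln (1 + 2 * B^-1 * q (theta s))).
have hE : lower_functional B theta mu = \sum_s mu s * expR (h s).
  apply: eq_bigr => s _; congr (_ * _); rewrite expR_sum.
  apply: eq_bigr => i _; rewrite expRD; congr (_ * _).
  apply/eqP; rewrite -(@eqrXn2 _ 2) ?sqrtr_ge0 ?expR_ge0// sqr_sqrtr ?(ltW (D1 s))//.
  by rewrite -expRM_natl mulrA mulfV// mul1r lnK// posrE.
have Eh : \sum_s w s * h s <= dotprod v v / r2 + ln K.
  rewrite -ler_expR expRD lnK ?posrE//; apply: le_trans (wexp h) _.
  by rewrite ler_pM2l ?expR_gt0// -hE ltW.
have Evar := posterior_energy_var_le wv lam0.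
pose g s := q (theta s - v).
have half s : 2^-1 * q v - g s <= q (theta s).
  rewrite /g /q mulr_sumr -sumrB; apply: ler_sum => j _; rewrite !mxE.
  set a := theta s j 0; set b := v j 0.
  rewrite -subr_ge0 (_ : _ - _ = lam j * (2^-1 * (2 * a - b) ^+ 2)).
    by rewrite mulr_ge0// mulr_ge0 ?invr_ge0 ?sqr_ge0.
  by field.
have pt s : - B^-1 * f s + - (2^-1 * n%:R * B^-1) * g s +
    4^-1 * n%:R * B^-1 * q v <= h s.
  rewrite /h big_split /= -mulr_sumr -/(f s) -addrA lerD2l.
  rewrite sumr_const card_ord -[leRHS]mulr_natl.
  rewrite [leLHS](_ : _ = n%:R *
    (2^-1 * (2 * B^-1 * (2^-1 * q v - g s) / 2))); last first.
    by field; rewrite gt_eqF.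
  rewrite ler_wpM2l// ler_pM2l ?invr_gt0//.
  have g0 : 0 <= g s by exact: quadratic_ge0.
  (* Here [y = (2 / B) (q v / 2 - q (theta - v))], at most 1 since [q v <= B]. *)
  apply: ln1D_ge_half.
  - rewrite mulrAC ler_pdivrMr// mul1r; lra.
  - by rewrite ler_wpM2l ?half// mulr_ge0// invr_ge0 ltW.
  - by rewrite !mulr_ge0// invr_ge0 ltW.
have Ef : \sum_s w s * f s <= \sum_i dotprod v (x i) ^+ 2 +
    r2 * \sum_i dotprod (x i) (x i).
  rewrite /f; under eq_bigr do rewrite mulr_sumr.
  rewrite exchange_big mulr_sumr -big_split; apply: ler_sum => i _ /=.
  rewrite (dotprodC v); under eq_bigr do rewrite dotprodC.
  exact: posterior_sqr_le.
set Y := \sum_i dotprod v _ ^+ 2 in Ef *.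
set F := \sum_i dotprod (x i) (x i) in Ef *.
have low : - B^-1 * (\sum_s w s * f s) +
    - (2^-1 * n%:R * B^-1) * (\sum_s w s * g s) + 4^-1 * n%:R * B^-1 * q v <=
    \sum_s w s * h s.
  rewrite -(weighted_sum_affine f g _ _ _ w1).
  by apply: ler_sum => s _; rewrite ler_wpM2l.
have := le_trans low Eh; rewrite -(ler_pM2l (_ : 0 < 4 * B)); last by rewrite mulr_gt0.
have -> : 4 * B * (- B^-1 * (\sum_s w s * f s) +
    - (2^-1 * n%:R * B^-1) * (\sum_s w s * g s) + 4^-1 * n%:R * B^-1 * q v) =
  n%:R * q v - 4 * (\sum_s w s * f s) - 2 * n%:R * (\sum_s w s * g s).
  by field; rewrite gt_eqF.
have hg : 2 * n%:R * (\sum_s w s * g s) <= 2 * n%:R * (r2 * tau).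
  by rewrite ler_wpM2l// mulr_ge0.
lra.
Qed.

End exponential_functionals.

(** * Functionals for the empirical trace and the noise *)

Section weighted_exponential_functionals.
Context {R : realType} {n d : nat}.
Variables (lam : 'I_d -> R) (x : 'I_n -> 'cV[R]_d) (e : 'I_n -> R) (K : R).
Hypothesis lam0 : forall j, 0 <= lam j.
Hypothesis K2 : 2 <= K.
Let tau := \sum_j lam j.
Hypothesis tau0 : 0 < tau.
Hypothesis d0 : (0 < d)%N.

(* The variances are regularised by their mean so that the weights
   [reg_var j / (2 tau)] never vanish. *)
Definition reg_var (j : 'I_d) : R := lam j + (\sum_k lam k) / d%:R.

Lemma reg_var_gt0 j : 0 < reg_var j.
Proof. by rewrite ltr_wpDl// divr_gt0// ltr0n. Qed.

Lemma sum_reg_var : \sum_j reg_var j / (2 * tau) = 1.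
Proof.
rewrite -mulr_suml big_split /= sumr_const card_ord -[_ *+ d]mulr_natr -/tau.
have d0' : d%:R != 0 :> R by rewrite pnatr_eq0 -lt0n.
by field; rewrite d0' gt_eqF.
Qed.

Lemma reg_weight_ge0 j : 0 <= reg_var j / (2 * tau).
Proof. by rewrite divr_ge0 ?mulr_ge0// ltW// reg_var_gt0. Qed.

Definition trace_functional : R :=
  \sum_j reg_var j / (2 * tau) * \prod_(i < n)
    (expR ((4 * reg_var j)^-1 * x i j 0 ^+ 2) / 2).

(** Weights proportional to [reg_var j] cancel the normalisation [1 / (4 reg_var j)], so Jensen's
    inequality yields the unweighted trace with the factor [1 / (8 tau)]. *)
Lemma trace_of_functional : trace_functional < K ->
  \sum_i dotprod (x i) (x i) <= 8 * tau * (n%:R * ln 2 + ln K).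
Proof.
move=> WK; have K0 : 0 < K by exact: lt_le_trans K2.
pose h j := \sum_(i < n) ((4 * reg_var j)^-1 * x i j 0 ^+ 2 - ln 2).
have hE : trace_functional = \sum_j reg_var j / (2 * tau) * expR (h j).
  apply: eq_bigr => j _; congr (_ * _); rewrite expR_sum.
  by apply: eq_bigr => i _; rewrite expRD expRN lnK// posrE.
have Eh : \sum_j reg_var j / (2 * tau) * h j <= ln K.
  rewrite -ler_expR lnK ?posrE//; apply: le_trans (_ : trace_functional <= _).
    by rewrite hE; apply: expR_jensen (sum_reg_var); exact: reg_weight_ge0.
  exact: ltW.
have hs : \sum_j reg_var j / (2 * tau) * h j =
    (8 * tau)^-1 * (\sum_i dotprod (x i) (x i)) - n%:R * ln 2.
  transitivity (\sum_j ((8 * tau)^-1 * (\sum_i x i j 0 ^+ 2) -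
      reg_var j / (2 * tau) * (n%:R * ln 2))).
    apply: eq_bigr => j _; rewrite /h sumrB sumr_const card_ord.
    rewrite -[ln 2 *+ n]mulr_natl mulrBr; congr (_ - _).
    rewrite -mulr_sumr mulrA; congr (_ * _); field.
    by rewrite !gt_eqF ?reg_var_gt0.
  rewrite sumrB -mulr_suml sum_reg_var mul1r -mulr_sumr exchange_big.
  by congr (_ * _ - _); apply: eq_bigr => i _; apply: eq_bigr => j _.
rewrite -ler_pdivrMl ?mulr_gt0//; move: Eh; rewrite hs; lra.
Qed.

(** The average of [cosh(a_j S_j)] damped by [exp(- n v)], where [a_j = s / sqrt (reg_var j)] and
    [S_j] is the sum of the [x_ij e_i]. Both signs are present to control [|S_j|]. *)
Definition noise_functional (s v : R) : R :=
  2^-1 * \sum_j reg_var j / (2 * tau) *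
    (\prod_(i < n) expR (s / Num.sqrt (reg_var j) * (x i j 0 * e i) - v) +
     \prod_(i < n) expR (- (s / Num.sqrt (reg_var j)) * (x i j 0 * e i) - v)).

(** Seen as a function of [u^2], the exponential lies above its tangent at [v^2]. It is convex only
    for [u >= 1]; the margin [v >= 2] takes care of smaller [u]. *)
Lemma expR_tangent_sqr (u v : R) : 0 <= u -> 2 <= v ->
  expR v * (1 + (u ^+ 2 - v ^+ 2) / (2 * v)) <= expR u.
Proof.
move=> u0 v2; have v0 : 0 < v by lra.
rewrite -[X in _ <= expR X](subrKC v) expRD ler_pM2l ?expR_gt0//.
set w := u - v; have -> : 1 + (u ^+ 2 - v ^+ 2) / (2 * v) =
    1 + w + w ^+ 2 / (2 * v) by rewrite /w; field; rewrite gt_eqF.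
have wv : - v <= w by rewrite /w; lra.
have w2 : w ^+ 2 / (2 * v) <= w ^+ 2 / 4.
  by rewrite ler_wpM2l ?sqr_ge0// lef_pV2 ?posrE; lra.
have [w2'|w2'] := leP (- 2) w.
  have : (1 + w / 2) ^+ 2 <= expR (w / 2) ^+ 2.
    by rewrite ler_pXn2r ?nnegrE ?expR_ge0 ?expR_ge1Dx//; lra.
  rewrite -expRM_natl (_ : 2%:R * (w / 2) = w); last by field.
  by move=> h; apply: le_trans h; rewrite (_ : (1 + _) ^+ 2 = 1 + w + w ^+ 2 / 4);
    [lra|field].
apply: le_trans (_ : 0 <= _); last exact: expR_ge0.
have : w ^+ 2 / (2 * v) <= - w / 2.
  rewrite ler_pdivrMr ?mulr_gt0// (_ : - w / 2 * (2 * v) = - w * v); last by field.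
  by rewrite expr2 -mulrNN ler_wpM2l//; lra.
lra.
Qed.

Lemma noise_of_functional (s v : R) : 0 < s -> n%:R * v = ln (4 * K) ->
  noise_functional s v < K ->
  s ^+ 2 * (\sum_j (\sum_i x i j 0 * e i) ^+ 2) <= 8 * tau * ln (4 * K) ^+ 2.
Proof.
move=> s0 nv WK; have K0 : 0 < K by exact: lt_le_trans K2.
set l := ln (4 * K) in nv *; pose S j := \sum_i x i j 0 * e i.
have l1 : 1 <= l.
  rewrite /l -ler_expR lnK ?posrE ?mulr_gt0//.
  have := @expR_ge1Dx R (- (1 / 2)); have : expR (- (1 / 2)) ^+ 2 * expR 1 = 1 :> R.
    by rewrite -expRM_natl -expRD (_ : _ + _ = 0) ?expR0//; field.
  have := expR_gt0 (1 : R); set a := expR (- _); set b := expR 1 => b0 ab a1.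
  have : (2^-1) ^+ 2 * b <= a ^+ 2 * b.
    by rewrite ler_pM2r// ler_pXn2r ?nnegrE//; lra.
  by rewrite ab; move: K2; lra.
pose p j := reg_var j / (2 * tau); pose a j := s / Num.sqrt (reg_var j).
have a2 j : a j ^+ 2 = s ^+ 2 / reg_var j.
  by rewrite /a exprMn exprVn sqr_sqrtr// ltW// reg_var_gt0.
have p0 j : 0 <= p j by exact: reg_weight_ge0.
have V2E : \sum_j p j * (a j * S j) ^+ 2 =
    s ^+ 2 / (2 * tau) * \sum_j S j ^+ 2.
  rewrite mulr_sumr; apply: eq_bigr => j _; rewrite exprMn a2 /p.
  by field; rewrite !gt_eqF ?reg_var_gt0.
set V2 := \sum_j _ in V2E.
have V20 : 0 <= V2 by apply: sumr_ge0 => j _; rewrite mulr_ge0 ?sqr_ge0.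
pose V := Num.sqrt V2; have VV : V ^+ 2 = V2 by rewrite sqr_sqrtr.
suff Vl : V <= 2 * l.
  have : V2 <= 4 * l ^+ 2.
    rewrite -VV (_ : 4 * l ^+ 2 = (2 * l) ^+ 2); last by ring.
    by rewrite ler_pXn2r ?nnegrE ?sqrtr_ge0//; lra.
  rewrite V2E mulrAC ler_pdivrMr ?mulr_gt0//.
  by rewrite (_ : 4 * l ^+ 2 * (2 * tau) = 8 * tau * l ^+ 2)//; ring.
have [V_2|V_2] := leP V 2; first lra.
have V0 : 0 < V by lra.
have WE : noise_functional s v = 2^-1 * (expR (- l) *
    \sum_j p j * (expR (a j * S j) + expR (- (a j * S j)))).
  rewrite /noise_functional; congr (_ * _); rewrite mulr_sumr.
  apply: eq_bigr => j _; rewrite mulrCA -/(p j); congr (_ * _).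
  rewrite -!expR_sum mulrDr -!expRD !sumrB sumr_const card_ord -!mulr_sumr.
  rewrite -[v *+ n]mulr_natl nv mulNr -/(S j) -/(a j).
  by congr (expR _ + expR _); ring.
have eV : expR V <= \sum_j p j * (expR (a j * S j) + expR (- (a j * S j))).
  have pt j : expR V * (1 + ((a j * S j) ^+ 2 - V2) / (2 * V)) <=
      expR (a j * S j) + expR (- (a j * S j)).
    apply: le_trans (_ : expR `|a j * S j| <= _).
      by rewrite -VV -(real_normK (num_real (a j * S j))) expR_tangent_sqr// ltW.
    by case: ger0P => _; rewrite ?lerDl ?lerDr expR_ge0.
  apply: le_trans (_ : \sum_j p j *
    (expR V * (1 + ((a j * S j) ^+ 2 - V2) / (2 * V))) <= _); last first.
    by apply: ler_sum => j _; rewrite ler_wpM2l.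
  rewrite (_ : \sum_j _ = (expR V / (2 * V)) * (\sum_j p j * (a j * S j) ^+ 2) +
    expR V * (1 - V2 / (2 * V)) * \sum_j p j); last first.
    rewrite !mulr_sumr -big_split; apply: eq_bigr => j _ /=.
    by field; rewrite gt_eqF.
  rewrite sum_reg_var -/V2 le_eqVlt; apply/orP; left; apply/eqP.
  by field; rewrite gt_eqF.
have : expR V <= 2 * K * expR l.
  apply: le_trans eV _; move: WK; rewrite WE => /ltW.
  rewrite -(ler_pM2l (_ : 0 < 2 * expR l)) ?mulr_gt0 ?expR_gt0//.
  rewrite mulrACA mulfV// mul1r mulrA -expRD subrr expR0 mul1r => h.
  by apply: le_trans h _; rewrite mulrAC.
rewrite -[2 * K]lnK ?posrE ?mulr_gt0// -expRD ler_expR => /le_trans; apply.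
suff : ln (2 * K) <= l by lra.
by rewrite /l ler_ln ?posrE; move: K0; lra.
Qed.

End weighted_exponential_functionals.

(** * Markov's inequality for mixtures of products *)

Section mixture_tail.
Context {R : realType} {d dV : measure_display} {T : measurableType d}
  {V : measurableType dV} (P : probability T R) (D : probability V R)
  {n : nat} (Z : 'I_n -> {mfun T >-> V}) {S : finType}.
Variables (mu : S -> R) (F : S -> V -> R) (e : S -> R).
Hypothesis ZD : forall A : 'I_n -> set V, (forall i, measurable (A i)) ->
  P (\bigcap_i (Z i @^-1` A i)) = (\prod_i D (A i))%E.
Hypothesis mu0 : forall s, 0 <= mu s.
Hypothesis mF : forall s, measurable_fun [set: V] (F s).
Hypothesis F0 : forall s y, 0 <= F s y.
Let W o := \sum_s mu s * \prod_i F s (Z i o).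

Lemma measurable_mixture : measurable_fun [set: T] W.
Proof.
apply: measurable_sum => s; apply: measurable_funM => //.
by apply: measurable_fun_prodr => i; exact: measurableT_comp.
Qed.

(** By independence each product has mean [e s ^+ n <= 1], hence so does the mixture. *)
Lemma mixture_tail (W' : T -> R) (K : R) : (forall o, W' o = W o) ->
  0 < K -> \sum_s mu s = 1 ->
  (forall s, (\int[D]_y (F s y)%:E = (e s)%:E)%E) -> (forall s, e s <= 1) ->
  measurable [set o | K <= W' o] /\
  (P [set o | (K <= W' o)%R] <= (K^-1)%:E)%E.
Proof.
move=> WE K0 mu1 Fe e1; have -> : W' = W by exact/funext.
have e0 s : 0 <= e s.
  by rewrite -lee_fin -Fe integral_ge0// => y _; rewrite lee_fin.
have W0 o : 0 <= W o.
  by apply: sumr_ge0 => s _; rewrite mulr_ge0// prodr_ge0.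
have mW := measurable_mixture.
have EW : (\int[P]_o (W o)%:E <= 1)%E.
  rewrite (_ : \int[P]_o _ =
      \int[P]_o (\sum_s (mu s * \prod_i F s (Z i o))%:E))%E; last first.
    by apply: eq_integral => o _; rewrite sumEFin.
  rewrite ge0_integral_sum//; last 2 first.
  - move=> s; apply/measurable_EFinP; apply: measurable_funM => //.
    by apply: measurable_fun_prodr => i; exact: measurableT_comp.
  - by move=> s o _; rewrite lee_fin mulr_ge0// prodr_ge0.
  apply: (@le_trans _ _ (\sum_s (mu s)%:E)%E); last by rewrite sumEFin mu1.
  apply: lee_sum => s _.
  under eq_integral do rewrite EFinM.
  rewrite ge0_integralZl_EFin//; last 2 first.
  - by move=> o _; rewrite lee_fin prodr_ge0.
  - apply/measurable_EFinP.
    by apply: measurable_fun_prodr => i; exact: measurableT_comp.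
  rewrite (integral_prod_independent (f := fun=> F s) (e := fun=> e s) ZD)//.
  rewrite -EFinM lee_fin ler_piMr// prodr_const exprn_ile1//.
have mA : measurable [set o | K <= W o].
  rewrite (_ : [set o | K <= W o] = W @^-1` `[K, +oo[%classic); last first.
    by apply/seteqP; split => o /=; rewrite in_itv/= andbT.
  by rewrite -[X in measurable X]setTI; exact: mW.
split=> //; rewrite -[leLHS]mul1e -(_ : (K^-1)%:E * K%:E = 1)%E; last first.
  by rewrite -EFinM mulVf// gt_eqF.
rewrite -muleA -[leRHS]mule1 lee_pmul2l//; last by rewrite lte_fin invr_gt0.
apply: le_trans EW.
have -> : (K%:E * P [set o | (K <= W o)%R])%E =
    (\int[P]_o (K * \1_[set o | (K <= W o)%R] o)%:E)%E.
  under eq_integral do rewrite EFinM.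
  rewrite ge0_integralZl_EFin ?integral_indic ?setIT// ?ltW//.
  exact/measurable_EFinP.
apply: ge0_le_integral => //.
- by move=> o _; rewrite lee_fin mulr_ge0// ltW.
- by apply/measurable_EFinP; apply: measurable_funM.
- exact/measurable_EFinP.
- move=> o _; rewrite lee_fin indicE.
  by case: (boolP (o \in _)) => [/set_mem/=|_]; rewrite ?mulr1 ?mulr0.
Qed.

End mixture_tail.

Section functional_tails.
Context {R : realType} {d n : nat} {dT : measure_display} {T : measurableType dT}
  (P : probability T R).
Variables (Sigma : 'M[R]_d) (wstar : 'cV[R]_d) (sigma : R)
  (D : probability (d.-tuple R * R)%type R) (lam : 'I_d -> R)
  (Z : 'I_n -> {mfun T >-> (d.-tuple R * R)%type}).
Hypothesis hD : linear_model Sigma wstar sigma D.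
Hypothesis ZD : forall A : 'I_n -> set (d.-tuple R * R),
  (forall i, measurable (A i)) ->
  P (\bigcap_i (Z i @^-1` A i)) = (\prod_i D (A i))%E.
Hypothesis lam0 : forall j, 0 <= lam j.
Hypothesis SigmaE : forall u : 'cV[R]_d,
  dotprod u (Sigma *m u) = \sum_j lam j * u j 0 ^+ 2.
Let tau := \sum_j lam j.
Hypothesis tau0 : 0 < tau.
Hypothesis d0 : (0 < d)%N.
Variable K : R.
Hypothesis K0 : 0 < K.
Let q (u : 'cV[R]_d) := \sum_j lam j * u j 0 ^+ 2.
Let X o (i : 'I_n) : 'cV[R]_d := vec (Z i o).1.
Let eps o (i : 'I_n) : R := (Z i o).2 - dotprod wstar (vec (Z i o).1).

Let mX2 (c : R) (u : 'cV[R]_d) : measurable_fun [set: d.-tuple R * R]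
  (fun y => expR (c * dotprod u (vec y.1) ^+ 2)).
Proof.
apply: measurableT_comp => //; apply: measurable_funM => //.
by apply: measurable_funX; exact: measurable_dotprod_vec1.
Qed.

Lemma integral_expR_feature_sqr (c k : R) (u : 'cV[R]_d) :
  0 <= k -> 2 * c * q u < 1 ->
  (\int[D]_y (expR (c * dotprod u (vec y.1) ^+ 2) * k)%:E =
   ((Num.sqrt (1 - 2 * c * q u))^-1 * k)%:E)%E.
Proof.
move=> k0 cq; under eq_integral do rewrite EFinM muleC.
rewrite ge0_integralZl_EFin//; last first.
  by apply/measurable_EFinP; exact: mX2.
have law A : measurable A -> D ((fun y => dotprod u (vec y.1)) @^-1` A) =
    centred_normal (q u) A.
  by move=> mA; rewrite (feature_law hD u mA) SigmaE.
rewrite (integral_centred_normal_expR_sqr (measurable_dotprod_vec1 u) law)//.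
  by rewrite -EFinM mulrC.
exact: quadratic_ge0.
Qed.

Lemma upper_functional_tail {S : finType} (theta : S -> 'cV[R]_d)
    (mu : S -> R) : (forall s, 0 <= mu s) -> \sum_s mu s = 1 ->
  measurable [set o | K <= upper_functional lam (X o) theta mu] /\
  (P [set o | (K <= upper_functional lam (X o) theta mu)%R] <= (K^-1)%:E)%E.
Proof.
move=> mu0 mu1.
have q0 u : 0 <= q u by exact: quadratic_ge0.
have cq u : 2 * (4 * (q u + 1))^-1 * q u <= 2^-1.
  have qp : 0 < q u + 1 by rewrite ltr_wpDl.
  rewrite (_ : 2 * _ * _ = 2^-1 * (q u / (q u + 1))); last by field; rewrite gt_eqF.
  by rewrite ler_piMr ?invr_ge0// ler_pdivrMr// mul1r lerDl.
apply: (mixture_tail (mu := mu) (F := fun s y =>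
  expR ((4 * (q (theta s) + 1))^-1 * dotprod (theta s) (vec y.1) ^+ 2) / 2)
  (e := fun s => (Num.sqrt (1 - 2 * (4 * (q (theta s) + 1))^-1 *
    q (theta s)))^-1 / 2) ZD) => //.
- by move=> s; apply: measurable_funM.
- move=> s; rewrite integral_expR_feature_sqr//.
  by apply: le_lt_trans (cq _) _; lra.
- move=> s; rewrite ler_pdivrMr// mul1r; have := cq (theta s) => h.
  by apply: invr_sqrt_le => //; lra.
Qed.

Lemma lower_functional_tail (B : R) {S : finType} (theta : S -> 'cV[R]_d)
    (mu : S -> R) : 0 < B -> (forall s, 0 <= mu s) -> \sum_s mu s = 1 ->
  measurable [set o | K <= lower_functional lam (X o) B theta mu] /\
  (P [set o | (K <= lower_functional lam (X o) B theta mu)%R] <= (K^-1)%:E)%E.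
Proof.
move=> B0 mu0 mu1.
have q0 u : 0 <= q u by exact: quadratic_ge0.
have Bq u : 0 <= 2 * B^-1 * q u by rewrite !mulr_ge0// invr_ge0 ltW.
apply: (mixture_tail (mu := mu) (F := fun s y =>
  expR (- B^-1 * dotprod (theta s) (vec y.1) ^+ 2) *
    Num.sqrt (1 + 2 * B^-1 * q (theta s))) (e := fun=> 1) ZD) => //.
- by move=> s; apply: measurable_funM.
- move=> s; have E : 1 - 2 * - B^-1 * q (theta s) = 1 + 2 * B^-1 * q (theta s).
    by ring.
  rewrite integral_expR_feature_sqr ?sqrtr_ge0//.
    rewrite E mulVf// gt_eqF// sqrtr_gt0.
    by rewrite ltr_pwDl.
  rewrite mulrN mulNr; apply: le_lt_trans ltr01.
  by rewrite oppr_le0.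
Qed.

Let coordE (j : 'I_d) (u : 'cV[R]_d) : dotprod (delta_mx j 0) u = u j 0.
Proof.
rewrite /dotprod (bigD1 j)//= big1 ?addr0 ?mxE ?eqxx ?mul1r//.
by move=> k /negbTE kj; rewrite !mxE kj mul0r.
Qed.

Let q_coord (j : 'I_d) : q (delta_mx j 0) = lam j.
Proof.
rewrite /q (bigD1 j)//= big1 ?addr0 ?mxE ?eqxx ?expr1n ?mulr1//.
by move=> k /negbTE kj; rewrite !mxE kj expr0n mulr0.
Qed.

Lemma trace_functional_tail :
  measurable [set o | K <= trace_functional lam (X o)] /\
  (P [set o | (K <= trace_functional lam (X o))%R] <= (K^-1)%:E)%E.
Proof.
have r0 j : 0 < reg_var lam j by exact: reg_var_gt0.
have lr j : 2 * (4 * reg_var lam j)^-1 * q (delta_mx j 0) <= 2^-1.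
  rewrite q_coord (_ : 2 * _ * _ = 2^-1 * (lam j / reg_var lam j)); last first.
    by field; rewrite gt_eqF.
  rewrite ler_piMr ?invr_ge0// ler_pdivrMr// mul1r lerDl.
  by rewrite divr_ge0// ltW.
apply: (mixture_tail (mu := fun j => reg_var lam j / (2 * tau))
  (F := fun j y => expR ((4 * reg_var lam j)^-1 *
    dotprod (delta_mx j 0) (vec y.1) ^+ 2) / 2)
  (e := fun j => (Num.sqrt (1 - 2 * (4 * reg_var lam j)^-1 *
    q (delta_mx j 0)))^-1 / 2) ZD) => //.
- by move=> j; exact: reg_weight_ge0.
- by move=> s; apply: measurable_funM.
- move=> o; apply: eq_bigr => j _; congr (_ * _).
  by apply: eq_bigr => i _; rewrite coordE.
- exact: sum_reg_var.
- move=> j; rewrite integral_expR_feature_sqr//.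
  by apply: le_lt_trans (lr j) _; lra.
- move=> j; rewrite ler_pdivrMr// mul1r; have := lr j => h.
  by apply: invr_sqrt_le => //; lra.
Qed.

(** A mixture over coordinates and signs. Each factor has mean [(1 - y)^(-1/2) exp(- v)] with
    [y <= v <= 1/2], and then [exp(2 v) (1 - y) >= (1 + 2 y) (1 - y) >= 1]. *)
Lemma noise_functional_tail (s v : R) : s ^+ 2 * sigma ^+ 2 = v -> v <= 2^-1 ->
  measurable [set o | K <= noise_functional lam (X o) (eps o) s v] /\
  (P [set o | (K <= noise_functional lam (X o) (eps o) s v)%R] <= (K^-1)%:E)%E.
Proof.
move=> sv v2; have v0 : 0 <= v by rewrite -sv mulr_ge0 ?sqr_ge0.
have r0 j : 0 < reg_var lam j by exact: reg_var_gt0.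
pose sg (b : bool) : R := if b then 1 else -1.
pose a (k : 'I_d * bool) := sg k.2 * (s / Num.sqrt (reg_var lam k.1)).
pose F (k : 'I_d * bool) (y : d.-tuple R * R) := expR (a k *
  (dotprod (delta_mx k.1 0) (vec y.1) * (y.2 - dotprod wstar (vec y.1)))) *
  expR (- v).
pose mu (k : 'I_d * bool) := 2^-1 * (reg_var lam k.1 / (2 * tau)).
have a2 k : a k ^+ 2 = s ^+ 2 / reg_var lam k.1.
  rewrite /a exprMn (_ : sg _ ^+ 2 = 1) ?mul1r; last first.
    by case: k.2; rewrite /= ?sqrrN expr1n.
  by rewrite exprMn exprVn sqr_sqrtr// ltW.
have ay k : a k ^+ 2 * lam k.1 * sigma ^+ 2 <= v.
  rewrite a2 -sv [leLHS](_ : _ = s ^+ 2 * sigma ^+ 2 *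
    (lam k.1 / reg_var lam k.1)); last by field; rewrite gt_eqF.
  have r1 : lam k.1 / reg_var lam k.1 <= 1.
    by rewrite ler_pdivrMr// mul1r lerDl divr_ge0// ltW.
  by apply: ler_piMr r1; rewrite mulr_ge0 ?sqr_ge0.
have ay0 k : 0 <= a k ^+ 2 * lam k.1 * sigma ^+ 2.
  by rewrite mulr_ge0 ?sqr_ge0// mulr_ge0 ?sqr_ge0.
have mG k : measurable_fun [set: d.-tuple R * R] (fun y => expR (a k *
    (dotprod (delta_mx k.1 0) (vec y.1) * (y.2 - dotprod wstar (vec y.1))))).
  apply: measurableT_comp => //; apply: measurable_funM => //.
  apply: measurable_funM; first exact: measurable_dotprod_vec1.
  exact: measurable_noise.
apply: (mixture_tail (mu := mu) (F := F) (e := fun k =>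
  (Num.sqrt (1 - a k ^+ 2 * lam k.1 * sigma ^+ 2))^-1 * expR (- v)) ZD) => //.
- by move=> k; rewrite /mu mulr_ge0 ?invr_ge0 ?reg_weight_ge0.
- by move=> k; apply: measurable_funM.
- by move=> k y; rewrite mulr_ge0 ?expR_ge0.
- move=> o.
  rewrite -(pair_bigA _ (fun j b => mu (j, b) * \prod_i F (j, b) (Z i o))) /=.
  rewrite /noise_functional mulr_sumr; apply: eq_bigr => j _.
  rewrite big_bool mulrA mulrDr; congr (_ * _ + _ * _);
    apply: eq_bigr => i _; rewrite /F coordE /a /= -expRD ?mul1r//.
  by rewrite mulN1r.
- rewrite -(pair_bigA _ (fun j (b : bool) => mu (j, b))) /=.
  rewrite -[RHS](sum_reg_var tau0 d0); apply: eq_bigr => j _.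
  by rewrite big_bool /mu /= -/tau; set r := _ / _; lra.
- move=> k; under eq_integral do rewrite EFinM muleC.
  rewrite ge0_integralZl_EFin//; last first.
    by apply/measurable_EFinP; exact: mG.
  have law A : measurable A ->
      D ((fun y => dotprod (delta_mx k.1 0) (vec y.1)) @^-1` A) =
      centred_normal (lam k.1) A.
    by move=> mA; rewrite (feature_law hD _ mA) SigmaE -/(q _) q_coord.
  have lt1 : a k ^+ 2 * lam k.1 * sigma ^+ 2 < 1.
    by apply: le_lt_trans (ay k) _; lra.
  rewrite (integral_expR_normal_product (measurable_dotprod_vec1 _)
    (measurable_noise wstar) (feature_noise_independent hD _) law
    (noise_law hD) (lam0 _) (sqr_ge0 _) lt1).
  by rewrite -EFinM mulrC.
- move=> k; rewrite expRN ler_pdivrMr ?expR_gt0// mul1r.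
  have := ay k; have := ay0 k; set y := _ * _ * _ => y0 yv.
  apply: invr_sqrt_le; [lra|exact: expR_ge0|].
  rewrite -expRM_natl; apply: le_trans (_ : (1 + 2 * y) * (1 - y) <= _).
    have : 0 <= y * (1 - 2 * y) by rewrite mulr_ge0//; lra.
    lra.
  rewrite ler_pM//; [lra|lra|].
  by apply: le_trans (expR_ge1Dx _); rewrite lerD2l ler_pM2l.
Qed.

End functional_tails.

(** * Excess risk of gradient descent *)

Section gd_excess_risk.
Context {R : realType} {n d : nat}.

Lemma measurable_gd {dT : measure_display} {T : measurableType dT}
    (Z : 'I_n -> {mfun T >-> (d.-tuple R * R)%type}) (eta : R) (t : nat)
    (j : 'I_d) : (0 < n)%N ->
  measurable_fun [set: T] (fun o => gd (fun i => Z i o) eta t j 0).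
Proof.
move=> n0; elim: t j => [|t IH] j.
  by rewrite /gd /=; under eq_fun do rewrite mxE; exact: measurable_cst.
have mZ1 i : measurable_fun [set: T] (fun o => (Z i o).1).
  exact: (measurableT_comp measurable_fst).
have mZ2 i : measurable_fun [set: T] (fun o => (Z i o).2).
  exact: (measurableT_comp measurable_snd).
have mX i k : measurable_fun [set: T] (fun o => vec (Z i o).1 k 0).
  under eq_fun do rewrite mxE.
  exact: (measurableT_comp (measurable_tnth k)).
rewrite (_ : (fun o => _) = (fun o => gd (fun i => Z i o) eta t j 0 -
    eta * (n%:R^-1 * \sum_(i < n)
      ((\sum_(k < d) vec (Z i o).1 k 0 * gd (fun i => Z i o) eta t k 0) -
       (Z i o).2) * vec (Z i o).1 j 0))); last first.
  (* The reference vector 0 expresses the gradient through the data alone. *)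
  apply/funext => o; rewrite {1}/gd /= (gradient_empirical_loss _ 0)// subr0.
  rewrite -/(gd _ eta t) empirical_cov_mul /mean_noise -scalerBr.
  rewrite -sumrB; set a := gd _ eta t.
  have coord (F : 'I_n -> 'cV[R]_d) : (a - eta *: (n%:R^-1 *: \sum_i F i)) j 0 =
      a j 0 - eta * (n%:R^-1 * \sum_i F i j 0) by rewrite !mxE summxE.
  rewrite coord; congr (_ - _ * (_ * _)); apply: eq_bigr => i _.
  by rewrite -scalerBl [LHS]mxE dotprod0l subr0.
apply: measurable_funB; first exact: IH.
apply: measurable_funM => //; apply: measurable_funM => //.
apply: measurable_sum => i; apply: measurable_funM; last exact: mX.
apply: measurable_funB; last exact: mZ2.
by apply: measurable_sum => k; apply: measurable_funM.
Qed.

Variables (Sigma : 'M[R]_d) (wstar : 'cV[R]_d) (sigma : R)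
  (D : probability (d.-tuple R * R)%type R) (lam : 'I_d -> R).
Hypothesis hD : linear_model Sigma wstar sigma D.
Hypothesis lam0 : forall j, 0 <= lam j.
Hypothesis SigmaE : forall u : 'cV[R]_d,
  dotprod u (Sigma *m u) = \sum_j lam j * u j 0 ^+ 2.
Hypothesis n0 : (0 < n)%N.
Let q (u : 'cV[R]_d) := \sum_j lam j * u j 0 ^+ 2.

Lemma measurable_excess_event {dT : measure_display} {T : measurableType dT}
    (Z : 'I_n -> {mfun T >-> (d.-tuple R * R)%type}) (eta c : R) (t : nat) :
  measurable [set o |
    (excess_risk D (gd (fun i => Z i o) eta t) <= c%:E)%E].
Proof.
have psd u : 0 <= dotprod u (Sigma *m u).
  by rewrite SigmaE; exact: quadratic_ge0.
have [kappa [_ _ kE]] := excess_riskE hD psd.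
pose f o := kappa * q (gd (fun i => Z i o) eta t - wstar).
have mf : measurable_fun [set: T] f.
  apply: measurable_funM => //; apply: measurable_sum => j.
  apply: measurable_funM => //; apply: measurable_funX.
  rewrite (_ : (fun o => _) =
      fun o => gd (fun i => Z i o) eta t j 0 - wstar j 0); last first.
    by apply/funext => o; rewrite !mxE.
  by apply: measurable_funB => //; exact: measurable_gd.
rewrite (_ : [set o | _] = f @^-1` `]-oo, c]%classic); last first.
  by apply/seteqP; split => o /=; rewrite kE SigmaE lee_fin in_itv.
by rewrite -[X in measurable X]setTI; exact: mf.
Qed.

Lemma excess_risk_gd_le (z : 'I_n -> d.-tuple R * R)
    (B a1 a2 M C1 kap K rho eta eta0 : R) (t : nat) :
  0 < a1 -> 0 < M -> 0 <= C1 -> 0 <= kap -> 0 <= K -> 0 < rho ->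
  0 < eta -> eta * M <= 1 -> eta <= eta0 -> (0 < t)%N ->
  a1 <= eta * t%:R * rho -> eta * t%:R * rho <= a2 ->
  dotprod wstar wstar <= B ->
  (forall v, n%:R^-1 * \sum_i dotprod v (vec (z i).1) ^+ 2 <=
     M * dotprod v v) ->
  (forall v, q v <= C1 * (n%:R^-1 * \sum_i dotprod v (vec (z i).1) ^+ 2) +
     kap / t%:R * dotprod v v) ->
  dotprod (mean_noise z wstar) (mean_noise z wstar) <= K * rho ^+ 2 ->
  (excess_risk D (gd z eta t) <= (6 * (C1 * (2 * B / a1 + 4 * a2 * K) +
     kap * (eta0 / a1) * (2 * B + 2 * a2 ^+ 2 * K)) * rho)%:E)%E.
Proof.
move=> a10 M0 C10 kap0 K0 rho0 eta_gt0 etaM eta_le t0 h1 h2 wB hM hq hxi.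
have psd u : 0 <= dotprod u (Sigma *m u).
  by rewrite SigmaE; exact: quadratic_ge0.
have [kappa [k0 k6 ->]] := excess_riskE hD psd.
rewrite lee_fin SigmaE -/(q _) gd_errorE//.
pose H := empirical_cov z.
have HE v : dotprod v (H *m v) =
    n%:R^-1 * \sum_i dotprod v (vec (z i).1) ^+ 2.
  by rewrite empirical_covE; congr (_ * _); apply: eq_bigr => i _; rewrite expr2.
have Hsym u v : dotprod u (H *m v) = dotprod (H *m u) v.
  rewrite (dotprodC (H *m u)) !empirical_covE; congr (_ * _).
  by apply: eq_bigr => i _; rewrite mulrC.
have Hpsd v : 0 <= dotprod v (H *m v).
  rewrite HE mulr_ge0 ?invr_ge0//; apply: sumr_ge0 => i _; exact: sqr_ge0.
have HM v : dotprod v (H *m v) <= M * dotprod v v by rewrite HE.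
set xi := mean_noise z wstar in hxi *.
have /= [E1 E2] :=
  gradient_descent_error Hsym Hpsd HM M0 eta_gt0 etaM xi (- wstar) t0.
set e := iter t _ _ in E1 E2 *.
rewrite dotprodNl dotprodNr opprK in E1 E2.
have xi0 : 0 <= dotprod xi xi by exact: dotprodvv_ge0.
have w0 : 0 <= dotprod wstar wstar by exact: dotprodvv_ge0.
have s0 : 0 < eta * t%:R by rewrite mulr_gt0// ltr0n.
have t0' : 0 < t%:R :> R by rewrite ltr0n.
set s := eta * t%:R in s0 h1 h2 E1 E2 *.
have B0 : 0 <= B by exact: le_trans wB.
have a20 : 0 < a2 by apply: lt_le_trans a10 _; exact: le_trans h2.
have b1 : dotprod wstar wstar / s <= B / a1 * rho.
  apply: le_trans (_ : B / s <= _); first by rewrite ler_pM2r ?invr_gt0.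
  rewrite -mulrA ler_wpM2l// mulrC ler_pdivlMr// mulrC ler_pdivrMr//.
  by rewrite mulrC.
have b2 : s * dotprod xi xi <= a2 * K * rho.
  apply: le_trans (_ : s * (K * rho ^+ 2) <= _); first by rewrite ler_pM2l.
  rewrite (_ : s * _ = s * rho * (K * rho)); last by ring.
  by rewrite -[leRHS]mulrA ler_wpM2r// mulr_ge0// ltW.
have b3 : s ^+ 2 * dotprod xi xi <= a2 ^+ 2 * K.
  apply: le_trans (_ : s ^+ 2 * (K * rho ^+ 2) <= _).
    by rewrite ler_wpM2l ?sqr_ge0.
  rewrite (_ : s ^+ 2 * _ = (s * rho) ^+ 2 * K); last by ring.
  rewrite ler_wpM2r// ler_pXn2r// nnegrE; last exact: ltW.
  by rewrite ltW// mulr_gt0.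
(* From [a1 <= eta t rho <= eta0 t rho]. *)
have b4 : (t%:R)^-1 <= eta0 / a1 * rho.
  rewrite -div1r ler_pdivrMr// -[leLHS](divff (lt0r_neq0 a10)).
  rewrite (_ : eta0 / a1 * rho * t%:R = eta0 * t%:R * rho / a1); last by ring.
  rewrite ler_pM2r ?invr_gt0//; apply: le_trans h1 _.
  by rewrite /s ler_pM2r// ler_pM2r.
have Ne : dotprod e e <= 2 * B + 2 * a2 ^+ 2 * K by lra.
have E1' : dotprod e (H *m e) <= (2 * B / a1 + 4 * a2 * K) * rho.
  apply: le_trans E1 _.
  rewrite (_ : (2 * B / a1 + 4 * a2 * K) * rho =
    2 * (B / a1 * rho) + 4 * (a2 * K * rho)); last by ring.
  by rewrite lerD// ler_pM2l.
have Ne0 : 0 <= dotprod e e by exact: dotprodvv_ge0.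
have qe : q e <= (C1 * (2 * B / a1 + 4 * a2 * K) +
     kap * (eta0 / a1) * (2 * B + 2 * a2 ^+ 2 * K)) * rho.
  apply: le_trans (hq e) _; rewrite -HE mulrDl; apply: lerD.
    by rewrite -mulrA ler_wpM2l.
  rewrite -mulrA -!mulrA ler_wpM2l// mulrA [leRHS](_ : _ =
    eta0 / a1 * rho * (2 * B + 2 * a2 ^+ 2 * K)); last by ring.
  by rewrite ler_pM ?invr_ge0.
have qe0 : 0 <= q e by exact: quadratic_ge0.
apply: le_trans (_ : 6 * q e <= _); first by rewrite ler_wpM2r.
by rewrite -[leRHS]mulrA ler_pM2l.
Qed.

End gd_excess_risk.

(** * The good event *)

Section concentration.
Context {R : realType} {d n : nat} {dT : measure_display} {T : measurableType dT}
  (P : probability T R).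
Variables (Sigma : 'M[R]_d) (wstar : 'cV[R]_d) (sigma : R)
  (D : probability (d.-tuple R * R)%type R) (lam : 'I_d -> R)
  (Z : 'I_n -> {mfun T >-> (d.-tuple R * R)%type}).
Hypothesis hD : linear_model Sigma wstar sigma D.
Hypothesis ZD : forall A : 'I_n -> set (d.-tuple R * R),
  (forall i, measurable (A i)) ->
  P (\bigcap_i (Z i @^-1` A i)) = (\prod_i D (A i))%E.
Hypothesis lam0 : forall j, 0 <= lam j.
Hypothesis SigmaE : forall u : 'cV[R]_d,
  dotprod u (Sigma *m u) = \sum_j lam j * u j 0 ^+ 2.
Let tau := \sum_j lam j.
Let q (u : 'cV[R]_d) := \sum_j lam j * u j 0 ^+ 2.

Lemma probability_setC4 (A1 A2 A3 A4 : set T) (e : R) :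
  (forall A, A \in [:: A1; A2; A3; A4] ->
     measurable A /\ (P A <= (e / 4)%:E)%E) ->
  measurable (~` (A1 `|` A2 `|` A3 `|` A4)) /\
  ((1 - e)%:E <= P (~` (A1 `|` A2 `|` A3 `|` A4)))%E.
Proof.
move=> H.
have [m1 p1] : measurable A1 /\ (P A1 <= (e / 4)%:E)%E by apply: H; rewrite !inE eqxx.
have [m2 p2] : measurable A2 /\ (P A2 <= (e / 4)%:E)%E.
  by apply: H; rewrite !inE eqxx orbT.
have [m3 p3] : measurable A3 /\ (P A3 <= (e / 4)%:E)%E.
  by apply: H; rewrite !inE eqxx !orbT.
have [m4 p4] : measurable A4 /\ (P A4 <= (e / 4)%:E)%E.
  by apply: H; rewrite !inE eqxx !orbT.
have mU : measurable (A1 `|` A2 `|` A3 `|` A4).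
  by do 3 (apply: measurableU => //).
split; first exact: measurableC.
rewrite probability_setC// EFinB leeB//.
have U2 (A A' : set T) (x y : R) : measurable A -> measurable A' ->
    (P A <= x%:E)%E -> (P A' <= y%:E)%E -> (P (A `|` A') <= (x + y)%:E)%E.
  move=> mA mA' px py; apply: le_trans (measureU2 P mA mA') _.
  by rewrite EFinD leeD.
rewrite (_ : e = e / 4 + e / 4 + e / 4 + e / 4); last by field.
apply: (U2 _ _ _ _ _ m4) => //.
  by apply: measurableU => //; exact: measurableU.
apply: (U2 _ _ _ _ _ m3) => //; first exact: measurableU.
exact: (U2 _ _ _ _ m1 m2).
Qed.

(** The noise tail produces [4 + log(1/delta)]; the lower bound [L0] of [L] turns this into
    [(4 / L0 + 1) L]. *)
Lemma good_event (B delta L L0 : R) (t : nat) :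
  1 <= B -> 0 < sigma -> 0 < delta -> delta < 1 -> (0 < d)%N -> (0 < t)%N ->
  (forall j, lam j <= B) -> B^-1 <= tau ->
  8 * B * t%:R ^+ 2 * (tau + ln (1 / delta)) <= n%:R ->
  0 < L0 -> L0 <= L -> ln (1 / delta) <= L ->
  exists G : set T, [/\ measurable G, ((1 - delta)%:E <= P G)%E &
    forall o, G o -> [/\
     forall v, n%:R^-1 * \sum_i dotprod v (vec (Z i o).1) ^+ 2 <=
       8 * (2 * B + 3) * dotprod v v,
     forall v, q v <=
       4 * (n%:R^-1 * \sum_i dotprod v (vec (Z i o).1) ^+ 2) +
       (66 + 4 * B) / t%:R * dotprod v v &
     dotprod (mean_noise (fun i => Z i o) wstar)
       (mean_noise (fun i => Z i o) wstar) <=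
       8 * (4 / L0 + 1) * (sigma ^+ 2 * tau * L / n%:R)]].
Proof.
move=> B1 sg0 dl0 dl1 d0 t0 lamB tauB nB L00 L0L lL.
set l0 := ln (1 / delta) in nB lL.
have l00 : 0 <= l0 by rewrite ln_ge0// ler_pdivlMr// mul1r ltW.
have B0 : 0 < B by lra.
have tau0 : 0 < tau by apply: lt_le_trans tauB; rewrite invr_gt0.
have t1 : 1 <= t%:R :> R by rewrite ler1n.
have t0' : 0 < t%:R :> R by lra.
have Btau : 1 <= B * tau by rewrite -ler_pdivrMl// mulr1.
have nB1 : 8 * B * t%:R * (tau + l0) <= n%:R / t%:R.
  by rewrite ler_pdivlMr// (le_trans _ nB)// le_eqVlt; apply/orP; left; apply/eqP; ring.
have tl0 : 0 <= tau + l0 by lra.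
have nt : n%:R / t%:R <= n%:R :> R by rewrite ler_pdivrMr// ler_peMr.
have nB2 : 8 * B * (tau + l0) <= n%:R / t%:R.
  apply: le_trans nB1; rewrite ler_wpM2r// ler_peMr//; lra.
have Bl : 0 <= B * l0 by rewrite mulr_ge0// ltW.
have l0B : l0 <= B * l0 by rewrite ler_peMl.
have tauBt : tau <= B * tau by rewrite ler_peMl// ltW.
have n0 : 0 < n%:R :> R.
  by apply: lt_le_trans nt; apply: lt_le_trans nB2; lra.
have n0' : n%:R != 0 :> R by rewrite gt_eqF.
(* Each of the four functionals exceeds [K] with probability at most [delta / 4]. *)
pose K := 4 / delta.
have K4 : 4 <= K by rewrite ler_pdivlMr// ler_piMr// ltW.
have K0 : 0 < K by lra.
have K2 : 2 <= K by lra.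
have ln2_1 : ln 2 <= 1 :> R.
  by have := @le_ln1Dx R 1; rewrite (_ : 1 + 1 = 2)//; apply; lra.
have ln4 : ln 4 = 2 * ln 2 :> R.
  by rewrite (_ : 4 = 2 * 2) ?lnM ?posrE//; ring.
have lnK : ln K = ln 4 + l0.
  by rewrite /K lnM ?posrE ?invr_gt0// /l0 div1r.
have lnKle : ln K <= 3 + l0 by rewrite lnK ln4; lra.
have qB u : dotprod u u <= 1 -> q u <= B.
  move=> u1; apply: le_trans (_ : B * dotprod u u <= _); last by rewrite ler_piMr// ltW.
  rewrite /q /dotprod mulr_sumr; apply: ler_sum => j _.
  by rewrite -expr2 ler_wpM2r// sqr_ge0.
have r10 : 0 < tau^-1 by rewrite invr_gt0.
have [S1 [th1 [mu1 [mu10 mu11 fam1]]]] := @randomized_vectors R d _ r10.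
have r20 : 0 < (t%:R * tau)^-1 by rewrite invr_gt0 mulr_gt0.
have [S2 [th2 [mu2 [mu20 mu21 fam2]]]] := @randomized_vectors R d _ r20.
(* With [n v = l] the damping matches the logarithm of the threshold, and [s^2 = v / sigma^2] makes
   [l^2 / s^2] linear in [l]. The sample size gives [v <= 1/2]. *)
pose l := ln (4 * K); pose v := l / n%:R.
have lE : l = 4 * ln 2 + l0.
  by rewrite /l lnM ?posrE// lnK ln4; ring.
have l4 : l <= 4 + l0 by rewrite lE; lra.
have ln2_0 : 0 < ln 2 :> R by rewrite ln_gt0// ltr1n.
have lgt0 : 0 < l by rewrite lE; lra.
have v0 : 0 < v by rewrite divr_gt0.
have v2 : v <= 2^-1.
  by rewrite ler_pdivrMr//; lra.
pose s := Num.sqrt v / sigma.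
have s0 : 0 < s by rewrite divr_gt0// sqrtr_gt0.
have sv : s ^+ 2 * sigma ^+ 2 = v.
  rewrite /s exprMn exprVn sqr_sqrtr ?(ltW v0)// divfK//.
  by rewrite expf_neq0// gt_eqF.
pose X o (i : 'I_n) : 'cV[R]_d := vec (Z i o).1.
pose eps o (i : 'I_n) : R := (Z i o).2 - dotprod wstar (vec (Z i o).1).
pose A1 := [set o | K <= upper_functional lam (X o) th1 mu1].
pose A2 := [set o | K <= lower_functional lam (X o) B th2 mu2].
pose A3 := [set o | K <= trace_functional lam (X o)].
pose A4 := [set o | K <= noise_functional lam (X o) (eps o) s v].
have Kinv : delta / 4 = K^-1 by rewrite /K invf_div.
have [mG pG] : measurable (~` (A1 `|` A2 `|` A3 `|` A4)) /\
    ((1 - delta)%:E <= P (~` (A1 `|` A2 `|` A3 `|` A4)))%E.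
  apply: probability_setC4 => A; rewrite !inE Kinv.
  move=> /or4P[] /eqP ->.
  - exact: (upper_functional_tail hD ZD lam0 SigmaE).
  - exact: (lower_functional_tail hD ZD lam0 SigmaE).
  - exact: (trace_functional_tail hD ZD lam0 SigmaE).
  - exact: (noise_functional_tail hD ZD lam0 SigmaE).
exists (~` (A1 `|` A2 `|` A3 `|` A4)); split => // o oG.
have h1 : upper_functional lam (X o) th1 mu1 < K.
  by rewrite ltNge; apply/negP => h; apply: oG; left; left; left.
have h2 : lower_functional lam (X o) B th2 mu2 < K.
  by rewrite ltNge; apply/negP => h; apply: oG; left; left; right.
have h3 : trace_functional lam (X o) < K.
  by rewrite ltNge; apply/negP => h; apply: oG; left; right.
have h4 : noise_functional lam (X o) (eps o) s v < K.
  by rewrite ltNge; apply/negP => h; apply: oG; right.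
pose Y (u : 'cV[R]_d) := n%:R^-1 * \sum_i dotprod u (X o i) ^+ 2.
have Yscale c u : Y (c *: u) = c ^+ 2 * Y u.
  rewrite /Y [RHS]mulrCA [c ^+ 2 * _]mulr_sumr; congr (_ * _); apply: eq_bigr => i _.
  by rewrite dotprodZl exprMn.
have F : \sum_i dotprod (X o i) (X o i) <= 16 * tau * n%:R.
  apply: le_trans (trace_of_functional lam0 K2 tau0 d0 h3) _.
  rewrite (_ : 16 * tau * n%:R = 8 * tau * (2 * n%:R)); last by ring.
  rewrite ler_pM2l ?mulr_gt0//.
  have : n%:R * ln 2 <= n%:R :> R by rewrite ler_piMr// ltW.
  lra.
split.
- have := @quadratic_le_homogeneous R d Y (fun=> 0) (8 * (2 * B + 3)) Yscale.
  move=> H u; rewrite -[leRHS]add0r; apply: H.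
    by move=> c w; rewrite mulr0.
  move=> {}u u1; rewrite add0r.
  have [w [w0 w1 wm wv wexp]] := fam1 u u1.
  have := upper_of_functional lam0 K0 h1 w0 w1 wm wv wexp (qB _ u1) _ (ltW B0).
  rewrite mulVf ?gt_eqF// lexx => /(_ isT) h.
  rewrite /Y mulrC ler_pdivrMr//; apply: le_trans h _.
  rewrite (_ : 8 * _ * n%:R = 4 * (2 * B + 3) * (2 * n%:R)); last by ring.
  rewrite ler_pM2l; last by lra.
  rewrite invrK.
  have : dotprod u u * tau <= tau by rewrite ler_piMl// ltW.
  have : n%:R * ln 2 <= n%:R :> R by rewrite ler_piMr// ltW.
  lra.
- apply: (@quadratic_le_homogeneous R d q (fun u => 4 * Y u)).
  + exact: quadratic_scale.
  + by move=> c w; rewrite Yscale; ring.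
  move=> u u1.
  have [w [w0 w1 wm wv wexp]] := fam2 u u1.
  have := lower_of_functional lam0 K0 h2 w0 w1 wm wv wexp B0 (qB _ u1).
  rewrite invrK => h; rewrite -(ler_pM2l n0); apply: le_trans h _.
  (* In [66 = 2 + 64], the 2 is the spread of [q] and [64 = 4 * 16] that of the squares, by the
     trace bound [F]. The term [4 * B] pays for the change of measure and [ln K]. *)
  rewrite [leRHS](_ : _ = 4 * \sum_i dotprod u (X o i) ^+ 2 +
    2 * n%:R / t%:R + 64 * n%:R / t%:R + 4 * B * (n%:R / t%:R)); last first.
    by rewrite /Y; field; rewrite n0' gt_eqF.
  rewrite (_ : 2 * n%:R * ((t%:R * tau)^-1 * _) = 2 * n%:R / t%:R); last first.
    by rewrite -/tau; field; rewrite !gt_eqF.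
  apply: lerD; first (apply: lerD; first by []).
    apply: le_trans (_ : 4 * ((t%:R * tau)^-1 * (16 * tau * n%:R)) <= _).
      by rewrite ler_pM2l// ler_wpM2l// ltW.
    by rewrite le_eqVlt; apply/orP; left; apply/eqP; field; rewrite !gt_eqF.
  rewrite ler_pM2l ?mulr_gt0//.
  have e1 : dotprod u u * (t%:R * tau) <= t%:R * tau.
    by rewrite ler_piMl// mulr_ge0// ltW.
  have e2 : t%:R * tau <= B * (t%:R * tau) by rewrite ler_peMl// mulr_ge0 ?ltW.
  have e3 : 1 <= t%:R * (B * tau) by rewrite mulr_ege1.
  have e4 : l0 <= t%:R * (B * l0).
    by rewrite (le_trans l0B)// ler_peMl.
  have e5 : 8 * B * t%:R * (tau + l0) =
    8 * (t%:R * (B * tau)) + 8 * (t%:R * (B * l0)) by ring.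
  have e6 : B * (t%:R * tau) = t%:R * (B * tau) by ring.
  lra.
- have nv : n%:R * v = l by rewrite /v mulrC divfK.
  have := noise_of_functional lam0 K2 tau0 d0 s0 nv h4.
  rewrite -/l; set S := \sum_j _ => hS.
  have NE : dotprod (mean_noise (fun i => Z i o) wstar)
      (mean_noise (fun i => Z i o) wstar) = n%:R^-1 ^+ 2 * S.
    rewrite /mean_noise dotprodZl dotprodZr mulrA -expr2; congr (_ * _).
    apply: eq_bigr => j _; rewrite -expr2 summxE; congr (_ ^+ 2).
    by apply: eq_bigr => i _; rewrite mxE mulrC.
  rewrite NE.
  have sE : s ^+ 2 = l / n%:R / sigma ^+ 2.
    by rewrite -[LHS](@mulfK _ (sigma ^+ 2)) ?expf_neq0 ?gt_eqF// sv.
  have hS' : S <= 8 * tau * l * sigma ^+ 2 * n%:R.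
    rewrite -(ler_pM2l (_ : 0 < s ^+ 2)) ?exprn_gt0//.
    apply: le_trans hS _; rewrite sE -/tau le_eqVlt; apply/orP; left; apply/eqP.
    by field; rewrite n0' gt_eqF.
  apply: le_trans (_ : n%:R^-1 ^+ 2 * (8 * tau * l * sigma ^+ 2 * n%:R) <= _).
    by rewrite ler_wpM2l// sqr_ge0.
  rewrite (_ : n%:R^-1 ^+ 2 * _ = 8 * (sigma ^+ 2 * tau / n%:R) * l); last by field.
  rewrite [leRHS](_ : _ = 8 * (sigma ^+ 2 * tau / n%:R) * ((4 / L0 + 1) * L)); last by ring.
  rewrite ler_wpM2l//.
    rewrite mulr_ge0// divr_ge0 ?ler0n// mulr_ge0 ?sqr_ge0//; exact: ltW.
  rewrite mulrDl mul1r; apply: le_trans l4 _; rewrite lerD//.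
  by rewrite -mulrA ler_peMr// mulrC ler_pdivlMr// mul1r.
Qed.

End concentration.

(** * Failure probabilities close to one *)

Section tuple_measures.
Context {R : realType} {dV : measure_display} {V : measurableType dV}.

Definition box {m : nat} (A : 'I_m -> set V) : set (m.-tuple V) :=
  [set y | forall i, A i (tnth y i)].

Lemma measurable_box (m : nat) (A : 'I_m -> set V) :
  (forall i, measurable (A i)) -> measurable (box A).
Proof.
move=> mA; rewrite (_ : box A = \bigcap_i ((@tnth m V)^~ i @^-1` A i)).
  apply: fin_bigcap_measurable => // i _.
  by rewrite -[X in measurable X]setTI; exact: measurable_tnth.
by apply/seteqP; split => y /= h i; [move=> _|]; exact: h.
Qed.

(** Boxes form a generating family closed under intersection. *)
Lemma tuple_measure_ext (m : nat) (m1 m2 : {measure set (m.-tuple V) -> \bar R}) :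
  (m1 setT < +oo)%E ->
  (forall A : 'I_m -> set V, (forall i, measurable (A i)) ->
     m1 (box A) = m2 (box A)) ->
  forall X, measurable X -> m1 X = m2 X.
Proof.
move=> fin H X mX.
pose G := [set box A | A in [set A : 'I_m -> set V | forall i, measurable (A i)]].
have boxT : box (fun=> setT) = [set: m.-tuple V] by apply/seteqP; split.
apply: (@measure_unique _ _ _ G (fun=> setT)) => //.
- apply/seteqP; split.
    apply: smallest_sub; first exact: smallest_sigma_algebra.
    rewrite -bigcup_seq => A [i _ [B mB <-]]; rewrite setTI.
    apply: sub_sigma_algebra; exists (fun j => if j == i then B else setT).
      by move=> j; case: ifP.
    apply/seteqP; split => y /=; first by move=> /(_ i); rewrite eqxx.
    by move=> By j; case: eqP => [->|].
  apply: smallest_sub; first exact: sigma_algebra_measurable.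
  by move=> _ [A mA <-]; exact: measurable_box.
- move=> _ _ [A mA <-] [B mB <-]; exists (fun i => A i `&` B i).
    by move=> i; exact: measurableI.
  apply/seteqP; split => y /=.
    by move=> h; split => i; have [] := h i.
  by move=> [hA hB] i; split.
- by move=> _; exists (fun=> setT).
- by rewrite bigcup_const.
- by move=> _ [A mA <-]; exact: H.
Qed.

End tuple_measures.

(** * Two equal blocks of a sample and a remainder *)

Section independent_blocks.
Context {R : realType} {dT dV : measure_display} {T : measurableType dT}
  {V : measurableType dV} (P : probability T R) (nu : probability V R).
Variables (m r : nat) (W : 'I_(m + m + r) -> {mfun T >-> V}).
Hypothesis WD : forall A : 'I_(m + m + r) -> set V,
  (forall i, measurable (A i)) ->
  P (\bigcap_i (W i @^-1` A i)) = (\prod_i nu (A i))%E.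

Let i1 (i : 'I_m) : 'I_(m + m + r) := lshift r (lshift m i).
Let i2 (i : 'I_m) : 'I_(m + m + r) := lshift r (rshift m i).
Let i3 (k : 'I_r) : 'I_(m + m + r) := rshift (m + m) k.

Definition first_block (o : T) : m.-tuple V := [tuple W (i1 i) o | i < m].
Definition second_block (o : T) : m.-tuple V := [tuple W (i2 i) o | i < m].
Definition rest_in (C : set V) : set T := [set o | forall k, C (W (i3 k) o)].

Lemma measurable_first_block : measurable_fun [set: T] first_block.
Proof.
apply/measurable_fun_tnthP => i.
by rewrite (_ : _ \o _ = W (i1 i))//; apply/funext => o; rewrite /= tnth_mktuple.
Qed.

Lemma measurable_second_block : measurable_fun [set: T] second_block.
Proof.
apply/measurable_fun_tnthP => i.
by rewrite (_ : _ \o _ = W (i2 i))//; apply/funext => o; rewrite /= tnth_mktuple.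
Qed.

Let mpre (f : T -> m.-tuple V) (A : set (m.-tuple V)) :
  measurable_fun [set: T] f -> measurable A -> measurable (f @^-1` A).
Proof. by move=> mf mA; rewrite -[X in measurable X]setTI; exact: mf. Qed.

Lemma measurable_rest_in (C : set V) : measurable C -> measurable (rest_in C).
Proof.
move=> mC; rewrite (_ : rest_in C = \bigcap_k (W (i3 k) @^-1` C)).
  apply: fin_bigcap_measurable => // k _.
  by rewrite -[X in measurable X]setTI; exact: measurable_funPT.
by apply/seteqP; split => o /= h k; [move=> _|]; exact: h.
Qed.

Lemma blocks_box (A B : 'I_m -> set V) (C : set V) :
  (forall i, measurable (A i)) -> (forall i, measurable (B i)) ->
  measurable C ->
  P (first_block @^-1` box A `&` (second_block @^-1` box B `&` rest_in C)) =
  (\prod_i nu (A i) * (\prod_i nu (B i) * \prod_(k < r) nu C))%E.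
Proof.
move=> mA mB mC.
pose F (i : 'I_(m + m + r)) : set V :=
  match fintype.split i with
  | inl j => match fintype.split j with inl k => A k | inr k => B k end
  | inr _ => C end.
have F1 i : F (i1 i) = A i by rewrite /F !(unsplitK (inl _)).
have F2 i : F (i2 i) = B i.
  by rewrite /F (unsplitK (inl _)) (unsplitK (inr _)).
have F3 k : F (i3 k) = C by rewrite /F (unsplitK (inr _)).
have mF i : measurable (F i).
  by rewrite /F; case: fintype.split => // j; case: fintype.split.
have := WD mF; rewrite big_split_ord big_split_ord /=.
rewrite (eq_bigr (fun i => nu (A i))) => [|i _]; last by rewrite -/(i1 i) F1.
rewrite [X in (_ * X * _)%E](eq_bigr (fun i => nu (B i))) => [|i _]; last first.
  by rewrite -/(i2 i) F2.
rewrite [X in (_ * _ * X)%E](eq_bigr (fun=> nu C)) => [|k _]; last first.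
  by rewrite -/(i3 k) F3.
rewrite -muleA => <-; congr (P _).
apply/seteqP; split => o /=.
  move=> [h1 [h2 h3]] i _ /=; case: (split_ordP i) => [j ->|k ->].
    case: (split_ordP j) => k ->.
      by rewrite -/(i1 k) F1; have := h1 k; rewrite tnth_mktuple.
    by rewrite -/(i2 k) F2; have := h2 k; rewrite tnth_mktuple.
  by rewrite -/(i3 k) F3; exact: h3.
move=> h; split; first by move=> i; rewrite tnth_mktuple -F1; exact: h.
split; first by move=> i; rewrite tnth_mktuple -F2; exact: h.
by move=> k; rewrite -(F3 k); exact: h.
Qed.

(** The identity on boxes is extended one block at a time, each time comparing two finite measures
    on tuples. The second block is expressed through the law of the first, with which it agrees. *)
Lemma blocks_independent (A B : set (m.-tuple V)) (C : set V) :
  measurable A -> measurable B -> measurable C ->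
  P (first_block @^-1` A `&` (second_block @^-1` B `&` rest_in C)) =
  (P (first_block @^-1` A) * (P (first_block @^-1` B) * \prod_(k < r) nu C))%E.
Proof.
move=> mA mB mC.
have mf1 := measurable_first_block; have mf2 := measurable_second_block.
have mR := measurable_rest_in mC.
pose Y1 : {mfun T >-> m.-tuple V} :=
  HB.pack first_block (isMeasurableFun.Build _ _ _ _ _ mf1).
pose Y2 : {mfun T >-> m.-tuple V} :=
  HB.pack second_block (isMeasurableFun.Build _ _ _ _ _ mf2).
have nub (E : set V) : measurable E -> exists2 c : R, 0 <= c & nu E = c%:E.
  move=> mE; exists (fine (nu E)); first exact: fine_ge0.
  by rewrite fineK// fin_num_measure.
have [c c0 cE] : exists2 c : R, 0 <= c & (\prod_(k < r) nu C)%E = c%:E.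
  have [c c0 ->] := nub _ mC; exists (\prod_(k < r) c); first exact: prodr_ge0.
  by rewrite prodEFin.
have boxT : box (fun=> setT) = [set: m.-tuple V] by apply/seteqP; split.
have rest_T : rest_in setT = setT by apply/seteqP; split.
have nuT k : (\prod_(i < k) nu setT = 1)%E.
  by rewrite big1// => i _; exact: probability_setT.
have first_box E : (forall i, measurable (E i)) ->
    P (first_block @^-1` box E) = (\prod_i nu (E i))%E.
  move=> mE; have := @blocks_box E (fun=> setT) setT mE.
  by rewrite boxT rest_T setIT preimage_setT setIT !nuT !mule1 => ->.
pose Q1 : {measure set (m.-tuple V) -> \bar R} := distribution P Y1.
have finP (E : set T) : measurable E -> exists2 k : R, 0 <= k & P E = k%:E.
  move=> mE; exists (fine (P E)); first exact: fine_ge0.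
  by rewrite fineK// fin_num_measure.
have ext (Y : {mfun T >-> m.-tuple V}) (G : set T) (k : R) :
    measurable G -> 0 <= k ->
    (forall E, (forall i, measurable (E i)) ->
      P (Y @^-1` box E `&` G) = (P (first_block @^-1` box E) * k%:E)%E) ->
    forall E, measurable E ->
      P (Y @^-1` E `&` G) = (P (first_block @^-1` E) * k%:E)%E.
  move=> mG k0 H E mE.
  have mY : measurable_fun [set: T] Y by exact: measurable_funPT.
  pose M1 : {measure set (m.-tuple V) -> \bar R} :=
    pushforward (mrestr P mG) Y.
  pose M2 : {measure set (m.-tuple V) -> \bar R} := mscale (NngNum k0) Q1.
  have := @tuple_measure_ext _ _ _ _ (M1 mY) M2 _ _ E mE.
  move=> M12; transitivity (M2 E); last by rewrite muleC.
  apply: M12; last by move=> F mF; rewrite [RHS]muleC -H.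
  have mYG : measurable (Y @^-1` setT `&` G).
    by rewrite preimage_setT setTI.
  exact: le_lt_trans (probability_le1 P mYG) (ltry 1).
have half (F : 'I_m -> set V) : (forall i, measurable (F i)) ->
    P (first_block @^-1` A `&` (second_block @^-1` box F `&` rest_in C)) =
    (P (first_block @^-1` A) * (P (first_block @^-1` box F) * c%:E))%E.
  move=> mF.
  have mbF := mpre mf1 (measurable_box mF).
  have [k k0 kE] := finP _ mbF; rewrite kE -EFinM.
  apply: (ext Y1) => //.
  - apply: measurableI => //; apply: mpre => //; exact: measurable_box.
  - exact: mulr_ge0.
  - by move=> E mE; rewrite blocks_box// cE -!first_box// kE EFinM.
have mbA := mpre mf1 mA.
have [k k0 kE] := finP _ mbA; rewrite kE cE muleCA -EFinM.
rewrite setICA; apply: (ext Y2) => //.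
- exact: measurableI.
- exact: mulr_ge0.
- by move=> E mE; rewrite setICA half// kE muleCA EFinM.
Qed.

End independent_blocks.

Section small_ball.
Context {R : realType} {dT dV : measure_display} {T : measurableType dT}
  {V : measurableType dV} (P : probability T R) (nu : probability V R).
Variables (m r : nat) (W : 'I_(m + m + r) -> {mfun T >-> V}).
Hypothesis WD : forall A : 'I_(m + m + r) -> set V,
  (forall i, measurable (A i)) ->
  P (\bigcap_i (W i @^-1` A i)) = (\prod_i nu (A i))%E.

(* Pigeonhole: two independent copies of [f] fall into the same interval of
   length [h] with probability at least [(sum_k p_k^2) >= (sum_k p_k)^2 / N]. *)
Lemma small_ball (f : m.-tuple V -> R) (Gd : set (m.-tuple V)) (C : set V)
    (b h c : R) :
  measurable_fun [set: m.-tuple V] f -> measurable Gd -> measurable C ->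
  0 < h -> (forall y, Gd y -> `|f y| <= b) ->
  ((2^-1)%:E <= P (first_block W @^-1` Gd))%E ->
  0 <= c -> (c%:E <= \prod_(k < r) nu C)%E ->
  exists E : set T, [/\ measurable E,
    ((4^-1 * c / (Num.trunc (2 * b / h)).+1%:R)%:E <= P E)%E &
    forall o, E o -> [/\ Gd (first_block W o), Gd (second_block W o),
      `|f (first_block W o) - f (second_block W o)| <= h &
      rest_in W C o]].
Proof.
move=> mf mGd mC h0 fb PGd c0 cC.
set N := Num.trunc _.
(* Half-open intervals of length [h] starting at [- b]. Indices 0 to [N] are needed: the value [b]
   itself falls into interval [N]. *)
pose A (k : nat) := Gd `&` f @^-1` `[k%:R * h - b, k.+1%:R * h - b[%classic.
have mA k : measurable (A k).
  by apply: measurableI => //; rewrite -[X in measurable X]setTI; exact: mf.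
have mf1 := measurable_first_block W; have mf2 := measurable_second_block W.
have mR := measurable_rest_in W mC.
have mpre (g : T -> m.-tuple V) X : measurable_fun [set: T] g ->
    measurable X -> measurable (g @^-1` X).
  by move=> mg mX; rewrite -[X in measurable X]setTI; exact: mg.
pose F k := first_block W @^-1` A k `&`
  (second_block W @^-1` A k `&` rest_in W C).
have mF k : measurable (F k).
  by apply: measurableI; [exact: mpre|apply: measurableI => //; exact: mpre].
have bucket k y : A k y -> k = Num.trunc ((f y + b) / h).
  move=> [_ /=]; rewrite in_itv/= => /andP[h1 h2]; apply/esym/truncn_def.
  by rewrite ler_pdivlMr// ltr_pdivrMr//; apply/andP; split; lra.
exists (\bigcup_(k in `I_N.+1) F k); split.
- by apply: bigcup_measurable => k _; exact: mF.
- rewrite measure_fin_bigcup//; last first.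
    move=> i j _ _ [p [[Ai _] [Aj _]]].
    by rewrite (bucket _ _ Ai) (bucket _ _ Aj).
  rewrite -(fsbig_ord _ _ (fun k => P (F k))) /=.
  pose p (k : nat) := fine (P (first_block W @^-1` A k)).
  have pE k : P (first_block W @^-1` A k) = (p k)%:E.
    by rewrite fineK// fin_num_measure//; exact: mpre.
  have p0 k : 0 <= p k by exact: fine_ge0.
  apply: (@le_trans _ _ (\sum_(k < N.+1) (p k ^+ 2 * c)%:E)%E); last first.
    apply: lee_sum => k _; rewrite /F (blocks_independent WD)// pE muleA -EFinM.
    by rewrite -expr2 EFinM lee_wpmul2l// lee_fin sqr_ge0.
  rewrite sumEFin lee_fin -mulr_suml.
  have sum_p : 2^-1 <= \sum_(k < N.+1) p k.
    rewrite -lee_fin; apply: le_trans PGd _.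
    apply: (@le_trans _ _
      (P (\big[setU/set0]_(k < N.+1) (first_block W @^-1` A k)))).
      apply: le_measure; rewrite ?inE.
      - exact: mpre.
      - by apply: bigsetU_measurable => k _; exact: mpre.
      move=> o Go; rewrite -(bigcup_mkord N.+1 (fun k => first_block W @^-1` A k)).
      set y := first_block W o in Go *.
      have := fb _ Go; rewrite ler_norml => /andP[fb1 fb2].
      have q0 : 0 <= (f y + b) / h by rewrite divr_ge0//; lra.
      exists (Num.trunc ((f y + b) / h)).
        rewrite /= ltnS; apply: le_truncn; rewrite ler_pM2r ?invr_gt0//; lra.
      split => //=; rewrite in_itv/=; have := truncn_itv q0.
      by rewrite ler_pdivlMr// ltr_pdivrMr// => /andP[u1 u2]; apply/andP; split; lra.
    have := @Boole_inequality _ _ _ P (fun k => first_block W @^-1` A k) N.+1.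
    move=> /(_ (fun i _ => mpre _ _ mf1 (mA i))) /le_trans; apply.
    by rewrite -sumEFin; apply: lee_sum => k _; rewrite -pE.
  (* The constant [4^-1] is the square of the lower bound 1/2 for [sum_k p_k]. *)
  have := sum_cauchy_schwarz (fun k : 'I_N.+1 => p k) (fun=> 1).
  under eq_bigr do rewrite mulr1.
  under [X in _ <= _ * X]eq_bigr do rewrite expr1n.
  rewrite sumr_const card_ord => cs.
  rewrite mulrAC ler_wpM2r// ler_pdivrMr ?ltr0n//.
  apply: le_trans cs; rewrite (_ : 4^-1 = 2^-1 ^+ 2); last by field.
  by rewrite ler_pXn2r// nnegrE// (le_trans _ sum_p).
- move=> o [k _ [[G1 I1] [[G2 I2] Ro]]]; split => //.
  move: I1 I2; rewrite /= !in_itv/= => /andP[u1 u2] /andP[v1 v2].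
  have e : k.+1%:R * h = k%:R * h + h by rewrite -natr1 mulrDl mul1r.
  by rewrite ler_norml; apply/andP; split; lra.
Qed.

End small_ball.

(** * Small balls for features and noise *)

Section normal_small_ball.
Context {R : realType}.

(** On [|x| <= sqrt v] the density is at least [1 / (18 sqrt v)], from [exp(- 1/2) >= 1/2] and
    [sqrt (2 pi) <= 9]; the interval has length [2 tau sqrt v]. *)
Lemma normal_small_ball (v tau : R) : 0 < v -> 0 <= tau -> tau <= 1 ->
  ((tau / 9)%:E <= centred_normal v
    [set x : R | (`|x| <= tau * Num.sqrt v)%R])%E.
Proof.
move=> v0 tau0 tau1; rewrite /centred_normal gt_eqF//.
rewrite (_ : [set x | _] =
    `[- (tau * Num.sqrt v), tau * Num.sqrt v]%classic); last first.
  by apply/seteqP; split => x /=; rewrite in_itv/= ler_norml.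
set s := Num.sqrt v; have s0 : 0 < s by rewrite sqrtr_gt0.
have s2 : s ^+ 2 = v by rewrite sqr_sqrtr// ltW.
have sn0 : s != 0 by rewrite gt_eqF.
rewrite /normal_prob.
apply: (@le_trans _ _ (\int[lebesgue_measure]_(x in `[(- (tau * s))%R, (tau * s)%R])
   ((18 * s)^-1)%:E)%E).
  rewrite integral_cst//= lebesgue_measure_itv/=.
  have [->|tn0] := eqVneq tau 0.
    by rewrite !mul0r oppr0 ltxx mule0.
  have tp : 0 < tau by rewrite lt0r tn0.
  rewrite ifT; last by rewrite lte_fin gtrN// mulr_gt0.
  rewrite -EFinD -EFinM lee_fin le_eqVlt; apply/orP; left; apply/eqP.
  by field.
apply: ge0_le_integral => //.
- by move=> x _; rewrite lee_fin invr_ge0 mulr_ge0// ltW.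
- apply/measurable_EFinP; apply: measurable_funTS; exact: measurable_normal_pdf.
move=> x /=; rewrite in_itv/= => /andP[x1 x2].
rewrite lee_fin normal_pdfE// /normal_peak /normal_fun subr0 s2.
have x2s : x ^+ 2 <= v.
  rewrite -s2 -[x ^+ 2]real_normK ?num_real// ler_pXn2r ?nnegrE ?(ltW s0)//.
  by rewrite (@le_trans _ _ (tau * s))//; [rewrite ler_norml x1|rewrite ler_piMl// ltW].
have e1 : 2^-1 <= expR (- x ^+ 2 / (v *+ 2)).
  apply: le_trans (expR_ge1Dx _).
  have : x ^+ 2 / (v *+ 2) <= 2^-1.
    by rewrite ler_pdivrMr ?pmulrn_lgt0// -mulr_natl; lra.
  rewrite mulNr; lra.
have p1 : (9 * s)^-1 <= (Num.sqrt (v * pi *+ 2))^-1.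
  rewrite lef_pV2 ?posrE ?sqrtr_gt0 ?mulr_gt0 ?pmulrn_lgt0 ?mulr_gt0 ?pi_gt0//.
  rewrite -[9 * s]ger0_norm ?mulr_ge0 ?(ltW s0)// -sqrtr_sqr ler_wsqrtr// exprMn s2.
  rewrite -mulr_natr -mulrA mulrC ler_pM2r//.
  have := @pihalf_lt2 R; lra.
rewrite (_ : (18 * s)^-1 = (9 * s)^-1 * 2^-1); last by field.
by rewrite ler_pM// invr_ge0 ?mulr_ge0// ltW.
Qed.

End normal_small_ball.

Section feature_noise_pair.
Context {R : realType} {d : nat}.
Variables (Sigma : 'M[R]_d) (wstar : 'cV[R]_d) (sigma : R)
  (D : probability (d.-tuple R * R)%type R).
Hypothesis hD : linear_model Sigma wstar sigma D.

Definition feature_noise (w u : 'cV[R]_d) (z : d.-tuple R * R) : R * R :=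
  (dotprod u (vec z.1), z.2 - dotprod w (vec z.1)).

Lemma measurable_feature_noise (w u : 'cV[R]_d) :
  measurable_fun [set: d.-tuple R * R] (feature_noise w u).
Proof.
apply: measurable_fun_pair; first exact: measurable_dotprod_vec1.
exact: measurable_noise.
Qed.

(** A centred normal law is symmetric, and the noise is independent of the features. *)
Lemma feature_noise_opp (u : 'cV[R]_d) (A : set (R * R)) : measurable A ->
  D (feature_noise wstar (- u) @^-1` A) = D (feature_noise wstar u @^-1` A).
Proof.
move=> mA.
have E v : D (feature_noise wstar v @^-1` A) =
    (\int[D]_z (\1_A (feature_noise wstar v z))%:E)%E.
  rewrite -(setIT (_ @^-1` _)) -integral_indic//.
  by rewrite -[X in measurable X]setTI; exact: measurable_feature_noise.
rewrite !E; apply: (@ge0_integral_independent2_eq _ _ _ D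
  (fun z => dotprod (- u) (vec z.1)) (fun z => dotprod u (vec z.1))
  (fun z => z.2 - dotprod wstar (vec z.1)) (fun y => (\1_A y)%:E)).
- exact: measurable_dotprod_vec1.
- exact: measurable_dotprod_vec1.
- exact: measurable_noise.
- exact: (feature_noise_independent hD).
- exact: (feature_noise_independent hD).
- move=> B mB; rewrite (feature_law hD (- u) mB) (feature_law hD u mB).
  by rewrite mulmxN dotprodNl dotprodNr opprK.
- by apply/measurable_EFinP; exact: measurable_indic.
- by move=> z; rewrite lee_fin.
Qed.

Lemma feature_noise_small_ball (u : 'cV[R]_d) (tau : R) :
  0 < dotprod u (Sigma *m u) -> 0 < sigma -> 0 <= tau -> tau <= 1 ->
  ((tau / 81)%:E <= D (feature_noise wstar u @^-1`
     [set y | (`|y.1| <= Num.sqrt (dotprod u (Sigma *m u)))%R /\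
              (`|y.2| <= tau * sigma)%R]))%E.
Proof.
move=> v0 s0 t0 t1; set v := dotprod u (Sigma *m u) in v0 *.
have mB (c : R) : measurable [set x : R | `|x| <= c].
  rewrite (_ : [set x | _] = `[- c, c]%classic)//.
  by apply/seteqP; split => x /=; rewrite in_itv/= ler_norml.
rewrite (_ : _ @^-1` _ = (fun z => dotprod u (vec z.1)) @^-1`
    [set x : R | `|x| <= Num.sqrt v] `&`
  (fun z => z.2 - dotprod wstar (vec z.1)) @^-1`
    [set x : R | `|x| <= tau * sigma])//.
rewrite (feature_noise_independent hD u (mB _) (mB _)).
rewrite (feature_law hD u (mB _)) (noise_law hD (mB _)).
have h1 := normal_small_ball v0 ler01 (lexx 1).
have h2 := normal_small_ball (exprn_gt0 2 s0) t0 t1.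
rewrite !mul1r in h1; rewrite sqrtr_sqr (gtr0_norm s0) in h2.
rewrite (_ : tau / 81 = 9^-1 * (tau / 9)); last by field.
have p1 : (0 <= (9^-1 : R)%:E)%E by rewrite lee_fin.
have p2 : (0 <= (tau / 9)%:E)%E by rewrite lee_fin divr_ge0.
rewrite EFinM; exact: (lee_pmul p1 p2 h1 h2).
Qed.

End feature_noise_pair.

Section dimension_one.
Context {R : realType}.

Lemma cV1E (v : 'cV[R]_1) : v = v 0 0 *: const_mx 1.
Proof. by apply/matrixP => i j; rewrite !ord1 !mxE mulr1. Qed.

Lemma dotprod_const1 : dotprod (const_mx 1 : 'cV[R]_1) (const_mx 1) = 1.
Proof. by rewrite /dotprod big_ord1 !mxE mulr1. Qed.

Lemma mean_noise_sqr (n : nat) (z : 'I_n -> 1.-tuple R * R) (w : 'cV[R]_1) :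
  dotprod (mean_noise z w) (mean_noise z w) =
  (n%:R^-1 * \sum_i (feature_noise w (const_mx 1) (z i)).1 *
                    (feature_noise w (const_mx 1) (z i)).2) ^+ 2.
Proof.
set e : 'cV[R]_1 := const_mx 1; set x := mean_noise z w.
have -> : dotprod x x = dotprod x e ^+ 2.
  rewrite [x]cV1E -/e dotprodZl [in LHS]dotprodZr dotprodZl.
  by rewrite dotprod_const1 !mulr1 expr2.
congr (_ ^+ 2); rewrite dotprodZl dotprod_suml; congr (_ * _).
by apply: eq_bigr => i _; rewrite dotprodZl mulrC dotprodC.
Qed.

End dimension_one.

Section cross_sum.
Context {R : realType} {m : nat}.

Definition cross_sum (y : m.-tuple (R * R)) : R :=
  \sum_i (tnth y i).1 * (tnth y i).2.
Definition square_sum (y : m.-tuple (R * R)) : R := \sum_i (tnth y i).1 ^+ 2.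

Lemma measurable_cross_sum : measurable_fun [set: m.-tuple (R * R)] cross_sum.
Proof.
apply: measurable_sum => i; apply: measurable_funM.
  exact: (measurableT_comp measurable_fst (measurable_tnth i)).
exact: (measurableT_comp measurable_snd (measurable_tnth i)).
Qed.

Lemma measurable_square_sum :
  measurable_fun [set: m.-tuple (R * R)] square_sum.
Proof.
apply: measurable_sum => i; apply: measurable_funX.
exact: (measurableT_comp measurable_fst (measurable_tnth i)).
Qed.

(** What [good_event] says about one block in dimension 1 at failure probability 1/2;
    [40 = 8 (4 / L0 + 1)] at [L0 = 1]. *)
Definition regular_block (M l s : R) : set (m.-tuple (R * R)) :=
  [set y | [/\ square_sum y <= M * m%:R, l * m%:R <= 8 * square_sum y &
               cross_sum y ^+ 2 <= 40 * (s ^+ 2 * l * m%:R)]].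

Lemma measurable_regular_block (M l s : R) :
  measurable (regular_block M l s).
Proof.
have mle (g : m.-tuple (R * R) -> R) (c : R) :
    measurable_fun [set: m.-tuple (R * R)] g -> measurable [set y | g y <= c].
  move=> mg; rewrite (_ : [set y | _] = g @^-1` `]-oo, c]%classic).
    by rewrite -[X in measurable X]setTI; exact: mg.
  by apply/seteqP; split => y /=; rewrite in_itv.
rewrite (_ : regular_block M l s = [set y | square_sum y <= M * m%:R] `&`
  ([set y | - square_sum y <= - (l * m%:R / 8)] `&`
   [set y | cross_sum y ^+ 2 <= 40 * (s ^+ 2 * l * m%:R)])); last first.
  apply/seteqP; split => y /=.
    by move=> [h1 h2 h3]; split=> //; split=> //; lra.
  by move=> [h1 [h2 h3]]; split=> //; lra.
apply: measurableI; first exact: mle measurable_square_sum.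
apply: measurableI.
  by apply: mle; apply: measurable_funN; exact: measurable_square_sum.
by apply: mle; apply: measurable_funX; exact: measurable_cross_sum.
Qed.

End cross_sum.

(** * Success with small probability in dimension one *)

Section large_delta.
Context {R : realType} {m r : nat} {dT : measure_display}
  {T : measurableType dT} (P : probability T R).
Variables (Sigma : 'M[R]_1) (wstar : 'cV[R]_1) (sigma : R)
  (D : probability (1.-tuple R * R)%type R) (lam : 'I_1 -> R)
  (Z : 'I_(m + m + r) -> {mfun T >-> (1.-tuple R * R)%type}).
Hypothesis hD : linear_model Sigma wstar sigma D.
Hypothesis ZD : forall A : 'I_(m + m + r) -> set (1.-tuple R * R),
  (forall i, measurable (A i)) ->
  P (\bigcap_i (Z i @^-1` A i)) = (\prod_i D (A i))%E.
Hypothesis lam0 : forall j, 0 <= lam j.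
Hypothesis SigmaE : forall u : 'cV[R]_1,
  dotprod u (Sigma *m u) = \sum_j lam j * u j 0 ^+ 2.

Let l := lam 0.
Let e : 'cV[R]_1 := const_mx 1.
Let n := (m + m + r)%N.
Let U (u : 'cV[R]_1) : {mfun (1.-tuple R * R)%type >-> (R * R)%type} :=
  HB.pack (feature_noise wstar u)
    (isMeasurableFun.Build _ _ _ _ _ (measurable_feature_noise wstar u)).
Let nu := distribution D (U e).

(* Flipping the features of the second half of the sample keeps its law and
   turns the sum of the cross terms into a difference of two i.i.d. copies. *)
Let flip (i : 'I_(m + m + r)) : 'cV[R]_1 :=
  if (m <= i < m + m)%N then - e else e.

Let W (i : 'I_(m + m + r)) : {mfun T >-> (R * R)%type} := (U (flip i) \o Z i).

Let flip1 (i : 'I_m) : flip (lshift r (lshift m i)) = e.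
Proof. by rewrite /flip /= leqNgt ltn_ord. Qed.

Let flip2 (i : 'I_m) : flip (lshift r (rshift m i)) = - e.
Proof. by rewrite /flip /= leq_addr ltn_add2l ltn_ord. Qed.

Let flip3 (k : 'I_r) : flip (rshift (m + m) k) = e.
Proof. by rewrite /flip /= [X in _ && X]ltnNge leq_addr andbF. Qed.

Let mpreU (u : 'cV[R]_1) (A : set (R * R)) : measurable A ->
  measurable (U u @^-1` A).
Proof. by move=> mA; rewrite -[X in measurable X]setTI; exact: measurable_funPT. Qed.

Lemma flipped_sample_law (A : 'I_(m + m + r) -> set (R * R)) :
  (forall i, measurable (A i)) ->
  P (\bigcap_i (W i @^-1` A i)) = (\prod_i nu (A i))%E.
Proof.
move=> mA.
transitivity (P (\bigcap_i (Z i @^-1` (U (flip i) @^-1` A i)))) => //.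
rewrite ZD; last by move=> i; exact: mpreU.
apply: eq_bigr => i _; rewrite /flip /nu /distribution /pushforward.
by case: ifP => _ //; exact: (feature_noise_opp hD e (mA i)).
Qed.

Let Z1 (i : 'I_m) := Z (lshift r (lshift m i)).

Let Z1D (A : 'I_m -> set (1.-tuple R * R)) : (forall i, measurable (A i)) ->
  P (\bigcap_i (Z1 i @^-1` A i)) = (\prod_i D (A i))%E.
Proof.
move=> mA.
pose F (i : 'I_(m + m + r)) : set (1.-tuple R * R) :=
  match fintype.split i with
  | inl j => match fintype.split j with inl k => A k | inr _ => setT end
  | inr _ => setT end.
have F1 i : F (lshift r (lshift m i)) = A i by rewrite /F !(unsplitK (inl _)).
have F2 i : F (lshift r (rshift m i)) = setT.
  by rewrite /F (unsplitK (inl _)) (unsplitK (inr _)).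
have F3 k : F (rshift (m + m) k) = setT by rewrite /F (unsplitK (inr _)).
have mF i : measurable (F i).
  by rewrite /F; case: fintype.split => // j; case: fintype.split.
have := ZD mF; rewrite big_split_ord big_split_ord /=.
rewrite (eq_bigr (fun i => D (A i))) => [|i _]; last by rewrite F1.
rewrite [X in (_ * X * _)%E](eq_bigr (fun=> 1%E)) => [|i _]; last first.
  by rewrite F2 probability_setT.
rewrite [X in (_ * _ * X)%E](eq_bigr (fun=> 1%E)) => [|k _]; last first.
  by rewrite F3 probability_setT.
rewrite !big1_eq !mule1 => <-; congr (P _).
apply/seteqP; split => o /= h i _ /=; last by rewrite -F1; exact: h.
case: (split_ordP i) => [j ->|k ->]; last by rewrite F3.
by case: (split_ordP j) => k ->; rewrite ?F1 ?F2//; exact: h.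
Qed.

(** [good_event] at failure probability 1/2, with [L = L0 = 1] and an auxiliary number of steps
    [t0]. The latter is so large that [(66 + 4 B) / t0 <= l / 2], which the left side absorbs; this
    doubles the factor 4 to 8. *)
Lemma regular_first_block (B : R) :
  1 <= B -> 0 < sigma -> l <= B -> B^-1 <= l -> (0 < m)%N ->
  8 * B * (Num.trunc (2 * B * (66 + 4 * B))).+1%:R ^+ 2 * (B + 1) <= m%:R ->
  ((2^-1)%:E <=
    P (first_block W @^-1` regular_block (8 * (2 * B + 3)) l sigma))%E.
Proof.
move=> B1 s0 lB Bl m0; set t0 := (Num.trunc _).+1 => mB.
have B0 : 0 < B by lra.
have lnhalf : 1 / 2^-1 = 2 :> R by rewrite invrK mul1r.
have ln21 : ln (2 : R) <= 1.
  by apply: (@le_ln1Dx R 1); lra.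
have lamB j : lam j <= B by rewrite ord1.
have tauE : \sum_j lam j = l by rewrite big_ord1.
have t0p : 0 < t0%:R :> R by rewrite ltr0n.
have t0E : (66 + 4 * B) / t0%:R * 1 <= l / 2.
  have h := ltW (truncnS_gt (2 * B * (66 + 4 * B))).
  rewrite -/t0 in h; rewrite mulr1 ler_pdivrMr//.
  apply: le_trans (_ : B^-1 * (t0%:R / 2) <= _).
    by rewrite ler_pdivlMl//; lra.
  by rewrite mulrA mulrAC ler_pM2r// ler_pM2r.
have nB : 8 * B * t0%:R ^+ 2 * (\sum_j lam j + ln (1 / 2^-1)) <= m%:R.
  apply: le_trans mB; rewrite ler_pM2l; last by rewrite !mulr_gt0// exprn_gt0.
  by rewrite tauE lnhalf; lra.
have h2 : 2^-1 < 1 :> R by lra.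
have taul : B^-1 <= \sum_j lam j by rewrite tauE.
have lln : ln (1 / 2^-1) <= 1 :> R by rewrite lnhalf.
have [G [mG PG hG]] := @good_event R 1 m dT T P Sigma wstar sigma D lam Z1
  hD Z1D lam0 SigmaE B 2^-1 1 1 t0 B1 s0 (ltac:(by lra)) h2 isT isT
  lamB taul nB ltr01 (lexx 1) lln.
rewrite (_ : 1 - 2^-1 = 2^-1 :> R) in PG; last by lra.
apply: le_trans PG _; apply: le_measure; rewrite ?inE//.
  rewrite -[X in measurable X]setTI; apply: (measurable_first_block W) => //.
  exact: measurable_regular_block.
move=> o /hG [g1 g2 g3].
have Wi i : W (lshift r (lshift m i)) o = feature_noise wstar e (Z1 i o).
  by rewrite /W /= flip1.
have QE : \sum_i dotprod e (vec (Z1 i o).1) ^+ 2 =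
    square_sum (first_block W o).
  by apply: eq_bigr => i _; rewrite tnth_mktuple Wi.
have SE : \sum_i (feature_noise wstar e (Z1 i o)).1 *
    (feature_noise wstar e (Z1 i o)).2 = cross_sum (first_block W o).
  by apply: eq_bigr => i _; rewrite tnth_mktuple Wi.
have m0' : 0 < m%:R :> R by rewrite ltr0n.
move: (g1 e) (g2 e) g3; rewrite big_ord1 mxE expr1n mulr1 mean_noise_sqr.
rewrite QE SE dotprod_const1 mulr1 tauE => {}g1 {}g2 {}g3; split.
- by move: g1; rewrite mulrC ler_pdivrMr.
- rewrite -ler_pdivlMr// -mulrA [_ / _]mulrC.
  by have : l = lam ord0 by []; lra.
- move: g3; rewrite exprMn exprVn mulrC ler_pdivrMr ?exprn_gt0// => /le_trans.
  by apply; rewrite le_eqVlt; apply/orP; left; apply/eqP; field; lra.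
Qed.

(* In [2 * (4 * 81 * 21)], the 4 is that of [small_ball], [tau / 81] bounds the
   probability of the leftover term, and [21 / sqrt (K log(1/delta))] the number
   of intervals. *)
Lemma good_event_large_delta (B delta K : R) :
  1 <= B -> 0 < sigma -> l <= B -> B^-1 <= l -> (0 < m)%N -> (r <= 1)%N ->
  8 * B * (Num.trunc (2 * B * (66 + 4 * B))).+1%:R ^+ 2 * (B + 1) <= m%:R ->
  0 < delta -> delta < 1 ->
  2 * (4 * 81 * 21) <= K -> K * ln (1 / delta) <= 1 ->
  exists G : set T, [/\ measurable G, ((1 - delta)%:E <= P G)%E &
    forall o, G o -> [/\
     forall v : 'cV[R]_1, n%:R^-1 * \sum_i dotprod v (vec (Z i o).1) ^+ 2 <=
       16 * (2 * B + 3) * dotprod v v,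
     forall v : 'cV[R]_1, \sum_j lam j * v j 0 ^+ 2 <=
       12 * (n%:R^-1 * \sum_i dotprod v (vec (Z i o).1) ^+ 2) &
     dotprod (mean_noise (fun i => Z i o) wstar)
       (mean_noise (fun i => Z i o) wstar) <=
       K * (sigma ^+ 2 * l * ln (1 / delta) / n%:R)]].
Proof.
move=> B1 s0 lB Bl m0 r1 mB d0 d1; set L := ln _.
set k : R := 4 * 81 * 21 => kK KL1.
have k0 : 0 < k by rewrite !mulr_gt0.
have K0 : 0 < K by apply: lt_le_trans kK; rewrite mulr_gt0.
have KL0 : 0 < K * L by apply: mulr_gt0 => //; rewrite ln_gt0// div1r invf_gt1.
have B0 : 0 < B by lra.
have l0 : 0 < l by apply: lt_le_trans Bl; rewrite invr_gt0.
have L0 : 0 < L by rewrite ln_gt0// div1r invf_gt1.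
have n0 : 0 < n%:R :> R by rewrite ltr0n /n ltn_addr// ltn_addr.
have n1 : 1 <= n%:R :> R by rewrite ler1n /n ltn_addr// ltn_addr.
have r1' : r%:R <= 1 :> R by rewrite -[1]/(1%:R) ler_nat.
have m0' : 0 < m%:R :> R by rewrite ltr0n.
have nE : n%:R = 2 * m%:R + r%:R :> R by rewrite /n !natrD; ring.
have rm : r%:R <= m%:R :> R by rewrite ler_nat (leq_trans r1).
(* The aim is [|sum x_i eps_i| <= w u], where [u = sigma sqrt (l n)] is the typical size; the square
   of [w u / n] is the claimed bound. *)
pose w := Num.sqrt (K * L).
have w0 : 0 < w by rewrite sqrtr_gt0.
have w2 : w * w = K * L by rewrite -expr2 sqr_sqrtr// ltW.
have w1 : w <= 1 by rewrite -sqrtr1 ler_wsqrtr.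
pose sn : R := Num.sqrt n%:R.
have sn2 : sn ^+ 2 = n%:R by rewrite sqr_sqrtr// ltW.
have sn1 : 1 <= sn by rewrite -sqrtr1 ler_wsqrtr.
have sn0 : 0 < sn by rewrite sqrtr_gt0.
pose sl := Num.sqrt l.
have sl2 : sl ^+ 2 = l by rewrite sqr_sqrtr// ltW.
have sl0 : 0 < sl by rewrite sqrtr_gt0.
pose u := sigma * (sl * sn).
have u0 : 0 < u by rewrite !mulr_gt0.
have u2 : u ^+ 2 = sigma ^+ 2 * l * n%:R by rewrite !exprMn sl2 sn2 mulrA.
(* Half of [w u] is reserved for the leftover term, of size at most [sqrt l * tau * sigma]; the
   other half is the interval length in [small_ball]. The cap at 1 is required by the Gaussian
   small-ball bound. *)
pose tau := Num.min 1 (w * sn / 2).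
have tau0 : 0 <= tau by rewrite le_min ler01/= ltW// !mulr_gt0 ?invr_gt0.
have tau1 : tau <= 1 by rewrite ge_min lexx.
have tauw : tau <= w * sn / 2 by rewrite ge_min lexx orbT.
(* The comparison of probabilities. Either value of the minimum gives at least
   [w^2 / (2 k) = K L / (2 k)], as [w <= 1 <= sqrt n], and [K >= 2 k]. *)
have tauL : L <= tau * w / k.
  rewrite ler_pdivlMr//.
  have kL : L * k <= w * w / 2.
    by rewrite w2 ler_pdivlMr// -mulrA mulrC ler_pM2r// mulrC.
  apply: le_trans kL _; rewrite /tau; case: (leP 1 (w * sn / 2)) => _.
    have ww : 0 <= w * w by rewrite mulr_ge0// ltW.
    rewrite mul1r; apply: le_trans (ler_piMl (ltW w0) w1).
    by move: ww; lra.
  rewrite mulrAC -mulrA [X in _ <= X]mulrAC -!mulrA ler_pM2l//.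
  by rewrite mulrC ler_peMl// divr_ge0// ltW.
pose C := [set y : R * R | `|y.1| <= sl /\ `|y.2| <= tau * sigma].
have mC : measurable C.
  have mle (g : R * R -> R) (c : R) :
      measurable_fun [set: R * R] g -> measurable [set y | `|g y| <= c].
    move=> mg; rewrite (_ : [set y | _] = g @^-1` `[- c, c]%classic).
      by rewrite -[X in measurable X]setTI; exact: mg.
    by apply/seteqP; split => y /=; rewrite in_itv/= ler_norml.
  rewrite (_ : C = [set y | `|y.1| <= sl] `&` [set y | `|y.2| <= tau * sigma])//.
  by apply: measurableI; apply: mle.
have nuC : ((tau / 81)%:E <= nu C)%E.
  have vE : dotprod e (Sigma *m e) = l.
    by rewrite SigmaE big_ord1 mxE expr1n mulr1.
  have v0 : 0 < dotprod e (Sigma *m e) by rewrite vE.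
  by have := feature_noise_small_ball hD v0 s0 tau0 tau1; rewrite vE.
(* For even [n] the product is empty and equals 1, so one bound serves both parities. *)
have prodC (r0 : nat) : (r0 <= 1)%N ->
    ((tau / 81)%:E <= \prod_(i < r0) nu C)%E.
  case: r0 => [_|[_|//]]; last by rewrite big_ord1.
  by rewrite big_ord0 lee_fin ler_pdivrMr// mul1r (le_trans tau1)// -[1]/(1%:R) ler_nat.
(* [40 m <= 20 n <= 25 n]. *)
have crossb (y : m.-tuple (R * R)) : regular_block (8 * (2 * B + 3)) l sigma y ->
    `|cross_sum y| <= 5 * u.
  move=> [_ _ h]; have u5 : 0 < 5 * u by rewrite mulr_gt0.
  rewrite -[leRHS]gtr0_norm// -!sqrtr_sqr; apply: ler_wsqrtr.
  apply: le_trans h _; rewrite exprMn u2 nE.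
  have p : 0 < sigma ^+ 2 * l by rewrite mulr_gt0// exprn_gt0.
  have pr : 0 <= sigma ^+ 2 * l * r%:R by rewrite mulr_ge0// ltW.
  have pm : 0 <= sigma ^+ 2 * l * m%:R by rewrite mulr_ge0// ltW.
  by rewrite mulrDr; move: pr pm; lra.
have h0 : 0 < w * u / 2 by rewrite !mulr_gt0 ?invr_gt0.
have tau81 : 0 <= tau / 81 by rewrite divr_ge0.
have [G [mG PG hG]] := small_ball flipped_sample_law measurable_cross_sum
  (measurable_regular_block _ _ _) mC h0 crossb
  (regular_first_block B1 s0 lB Bl m0 mB) tau81 (prodC _ r1).
exists G; split => //.
  apply: le_trans PG; rewrite lee_fin.
  set N := (Num.trunc _).+1%:R.
  (* Intervals of length [w u / 2] covering [[- 5 u, 5 u]]: at most [20 / w + 1], with [w <= 1]. *)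
  have Nw : N * w <= 21.
    have : N <= 20 / w + 1.
      rewrite /N -natr1 lerD2r; set x := 2 * (5 * u) / _.
      have <- : x = 20 / w by rewrite /x; field; rewrite !gt_eqF.
      have x0 : 0 <= x by rewrite divr_ge0 ?(ltW h0)// !mulr_ge0// ltW.
      by have /andP[] := truncn_itv x0.
    move=> /(fun h => ler_wpM2r (ltW w0) h) /le_trans; apply.
    by rewrite mulrDl divfK ?gt_eqF// mul1r; move: w1; lra.
  have N0 : 0 < N by rewrite ltr0n.
  have dL : 1 - delta <= L.
    have := @le_ln1Dx R (delta - 1); rewrite [1 + _]addrC subrK => h.
    have {}h := h ltac:(move: d0; lra).
    by rewrite /L div1r lnV ?posrE//; move: h; lra.
  apply: le_trans dL _; rewrite ler_pdivlMr//.
  apply: le_trans (_ : tau * w / k * N <= _); first by rewrite ler_pM2r.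
  rewrite (_ : tau * w / k * N = tau * (N * w / k)); last by ring.
  rewrite (_ : 4^-1 * (tau / 81) = tau * (21 / k)).
    by rewrite ler_wpM2l// ler_pM2r// invr_gt0.
  by rewrite /k; field.
move=> o /hG [[q1 p1 _] [q2 p2 _] hS hR].
have W1 i : W (lshift r (lshift m i)) o =
    feature_noise wstar e (Z (lshift r (lshift m i)) o).
  by rewrite /W /= flip1.
have W2 i : W (lshift r (rshift m i)) o =
    feature_noise wstar (- e) (Z (lshift r (rshift m i)) o).
  by rewrite /W /= flip2.
have W3 i : W (rshift (m + m) i) o =
    feature_noise wstar e (Z (rshift (m + m) i) o).
  by rewrite /W /= flip3.
have {}hR i : C (feature_noise wstar e (Z (rshift (m + m) i) o)).
  by rewrite -W3.
set Y1 := first_block W o in q1 p1 hS; set Y2 := second_block W o in q2 p2 hS.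
pose x i := dotprod e (vec (Z i o).1).
pose f i := x i * (feature_noise wstar e (Z i o)).2.
have QE : \sum_i x i ^+ 2 =
    square_sum Y1 + square_sum Y2 + \sum_k x (rshift (m + m) k) ^+ 2.
  rewrite big_split_ord big_split_ord; congr (_ + _ + _).
    by apply: eq_bigr => i _; rewrite tnth_mktuple W1.
  by apply: eq_bigr => i _; rewrite tnth_mktuple W2 /= dotprodNl sqrrN.
have SE : \sum_i f i =
    cross_sum Y1 - cross_sum Y2 + \sum_k f (rshift (m + m) k).
  rewrite big_split_ord big_split_ord -sumrN; congr (_ + _ + _).
    by apply: eq_bigr => i _; rewrite tnth_mktuple W1.
  by apply: eq_bigr => i _; rewrite tnth_mktuple W2 /= dotprodNl mulNr opprK.
have rest0 : 0 <= \sum_k x (rshift (m + m) k) ^+ 2.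
  by apply: sumr_ge0 => i _; exact: sqr_ge0.
have rest1 : \sum_k x (rshift (m + m) k) ^+ 2 <= r%:R * l.
  apply: le_trans (_ : \sum_(k < r) l <= _); last first.
    by rewrite sumr_const card_ord mulr_natl.
  apply: ler_sum => i _; have [h _] := hR i.
  by rewrite -sl2 -[x _ ^+ 2]real_normK ?num_real// ler_pXn2r// nnegrE ltW.
have rest2 : `|\sum_k f (rshift (m + m) k)| <= w * u / 2.
  apply: le_trans (ler_norm_sum _ _ _) _.
  apply: le_trans (_ : \sum_(k < r) sl * (tau * sigma) <= _).
    by apply: ler_sum => i _; have [h h'] := hR i; rewrite normrM ler_pM.
  apply: (@le_trans _ _ (sl * (tau * sigma))).
    rewrite sumr_const card_ord -[_ *+ r]mulr_natl ler_piMl//.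
    by rewrite !mulr_ge0// ltW.
  rewrite (_ : w * u / 2 = sl * (w * sn / 2 * sigma)); last first.
    by rewrite /u; field.
  by rewrite ler_pM2l// ler_pM2r.
have Sb : `|\sum_i f i| <= w * u.
  rewrite SE; apply: le_trans (ler_normD _ _) _.
  by rewrite [leRHS](splitr (w * u)) lerD.
have vE (v : 'cV[R]_1) : \sum_i dotprod v (vec (Z i o).1) ^+ 2 =
    v 0 0 ^+ 2 * \sum_i x i ^+ 2.
  rewrite mulr_sumr; apply: eq_bigr => i _.
  by rewrite {1}[v]cV1E dotprodZl exprMn.
have v2 (v : 'cV[R]_1) : dotprod v v = v 0 0 ^+ 2.
  by rewrite /dotprod big_ord1 expr2.
split.
- move=> v; rewrite vE v2 mulrCA mulrC ler_wpM2r ?sqr_ge0//.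
  rewrite ler_pdivrMl// QE.
  have lm : r%:R * l <= m%:R * B by rewrite ler_pM// ltW.
  have mB0 : 0 <= m%:R * B by rewrite mulr_ge0// ltW.
  have rB0 : 0 <= r%:R * B by rewrite mulr_ge0// ltW.
  have r0 : 0 <= r%:R :> R by exact: ler0n.
  by rewrite nE; move: q1 q2 rest1 lm mB0 rB0 r0 m0'; lra.
(* [12 = 8 + 4]: the blocks account for [2 m l] with the factor 8, and [r l <= m l] is half of
   that. *)
- move=> v; rewrite vE big_ord1 -/l [leLHS]mulrC.
  rewrite (_ : 12 * _ = v 0 0 ^+ 2 * (12 * (\sum_i x i ^+ 2) / n%:R)); last by ring.
  rewrite ler_wpM2l ?sqr_ge0// ler_pdivlMr// QE nE.
  have rl : r%:R * l <= m%:R * l by rewrite ler_pM2r.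
  by move: p1 p2 rl rest0; lra.
- rewrite mean_noise_sqr -/(f _).
  rewrite exprMn exprVn -ler_pdivlMl ?invr_gt0 ?exprn_gt0// invrK.
  rewrite -[X in X <= _]real_normK ?num_real//.
  apply: le_trans (_ : (w * u) ^+ 2 <= _).
    by rewrite ler_pXn2r// nnegrE ltW// mulr_gt0.
  rewrite exprMn [w ^+ 2]expr2 w2 u2 le_eqVlt; apply/orP; left; apply/eqP.
  by rewrite -/n; field; rewrite gt_eqF.
Qed.

End large_delta.

(** * Diagonal covariances *)

Section diagonal_covariance.
Context {R : realType} {d : nat}.
Implicit Types (u v : 'cV[R]_d).

Lemma l2norm_sqr v : l2norm v ^+ 2 = dotprod v v.
Proof.
rewrite sqr_sqrtr; last by apply: sumr_ge0 => j _; exact: sqr_ge0.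
by apply: eq_bigr => j _; rewrite expr2.
Qed.

Variable Sigma : 'M[R]_d.
Hypothesis Sdiag : is_diag_mx Sigma.
Hypothesis Spsd : psd Sigma.

Lemma diag_mulmx v j : (Sigma *m v) j 0 = Sigma j j * v j 0.
Proof.
rewrite mxE (bigD1 j)//= big1 ?addr0// => k kj.
by rewrite (is_diag_mxP Sdiag) ?mul0r// eq_sym.
Qed.

Lemma diag_quadratic u : dotprod u (Sigma *m u) = \sum_j Sigma j j * u j 0 ^+ 2.
Proof. by apply: eq_bigr => j _; rewrite diag_mulmx mulrCA expr2. Qed.

Lemma diag_ge0 j : 0 <= Sigma j j.
Proof.
have [_ /(_ (delta_mx j 0))] := Spsd.
rewrite diag_quadratic (bigD1 j)//= big1 => [|k kj].
  by rewrite mxE !eqxx expr1n mulr1 addr0.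
by rewrite mxE (negbTE kj) expr0n mulr0.
Qed.

Lemma diag_le_trace j : Sigma j j <= \tr Sigma.
Proof.
rewrite /mxtrace (bigD1 j)//= lerDl; apply: sumr_ge0 => k _; exact: diag_ge0.
Qed.

Lemma l2norm_diag_mulmx v : l2norm (Sigma *m v) <= \tr Sigma * l2norm v.
Proof.
have tr0 : 0 <= \tr Sigma by apply: sumr_ge0 => j _; exact: diag_ge0.
rewrite /l2norm -[X in _ <= X * _]ger0_norm// -sqrtr_sqr -sqrtrM ?sqr_ge0//.
apply: ler_wsqrtr; rewrite [leRHS]mulr_sumr; apply: ler_sum => j _.
rewrite diag_mulmx exprMn ler_wpM2r ?sqr_ge0//.
by rewrite ler_pXn2r// ?nnegrE ?diag_ge0// diag_le_trace.
Qed.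

Let image := [set l2norm (Sigma *m v) | v in [set v : 'cV[R]_d | l2norm v <= 1]].

Let image_ub : ubound image (\tr Sigma).
Proof.
move=> _ [v /= v1 <-]; apply: le_trans (l2norm_diag_mulmx v) _.
by rewrite ler_piMr//; apply: sumr_ge0 => j _; exact: diag_ge0.
Qed.

Lemma spectral_norm_le_trace : spectral_norm Sigma <= \tr Sigma.
Proof.
apply: ge_sup image_ub; exists (l2norm (Sigma *m 0)), 0 => //=.
rewrite /l2norm big1 ?sqrtr0// => j _.
by rewrite mxE expr0n.
Qed.

(** Evaluation at a basis vector. Boundedness by the trace keeps [sup] from taking its default
    value. *)
Lemma diag_le_spectral_norm j : Sigma j j <= spectral_norm Sigma.
Proof.
apply: ub_le_sup; first by exists (\tr Sigma); exact: image_ub.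
have delta_norm (c : 'cV[R]_d) (a : R) : 0 <= a ->
    (forall k, c k 0 = (k == j)%:R * a) -> l2norm c = a.
  move=> a0 cE; rewrite /l2norm (bigD1 j)//= big1 => [|k kj].
    by rewrite cE eqxx mul1r addr0 sqrtr_sqr ger0_norm.
  by rewrite cE (negbTE kj) mul0r expr0n.
exists (delta_mx j 0) => /=.
  by rewrite (delta_norm _ 1)// => k; rewrite mxE andbT mulr1.
apply: delta_norm; first exact: diag_ge0.
by move=> k; rewrite diag_mulmx mxE andbT mulrC; case: eqP => [->|]; rewrite ?mul0r.
Qed.

End diagonal_covariance.

Lemma iid_from_prod {R : realType} {d1 d2 : measure_display}
    {T : measurableType d1} {V : measurableType d2} (P : probability T R)
    (D : probability V R) (n : nat) (Z : 'I_n -> {mfun T >-> V}) :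
  iid_from P D Z -> forall A : 'I_n -> set V, (forall i, measurable (A i)) ->
  P (\bigcap_i (Z i @^-1` A i)) = (\prod_i D (A i))%E.
Proof.
move=> [indep law] A mA; have := indep [set: 'I_n]%SET A mA.
rewrite (_ : \bigcap_(i in _) _ = \bigcap_i (Z i @^-1` A i)); last first.
  by apply/seteqP; split => o /= h i _; apply: h => //=; rewrite inE.
move=> ->; apply: eq_big => [i|i _]; first by rewrite inE.
by rewrite -(law i _ (mA i)).
Qed.

(** * From a good event to the theorem *)

Section excess_risk_whp.
Context {R : realType} {n d : nat} {dT : measure_display} {T : measurableType dT}
  (P : probability T R).
Variables (Sigma : 'M[R]_d) (wstar : 'cV[R]_d) (sigma : R)
  (D : probability (d.-tuple R * R)%type R) (lam : 'I_d -> R)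
  (Z : 'I_n -> {mfun T >-> (d.-tuple R * R)%type}).
Hypothesis hD : linear_model Sigma wstar sigma D.
Hypothesis lam0 : forall j, 0 <= lam j.
Hypothesis SigmaE : forall u : 'cV[R]_d,
  dotprod u (Sigma *m u) = \sum_j lam j * u j 0 ^+ 2.
Hypothesis n0 : (0 < n)%N.

(** The common end of both regimes, which differ in [M0], [C1], [kap] and [K] but share the
    step-size condition through one [M >= M0]. *)
Lemma excess_risk_whp (G : set T) (delta B a1 a2 M M0 C1 kap K rho eta eta0 C : R)
    (t : nat) :
  measurable G -> ((1 - delta)%:E <= P G)%E ->
  0 < a1 -> 0 < M -> M0 <= M -> 0 <= C1 -> 0 <= kap -> 0 <= K -> 0 < rho ->
  0 < eta -> eta * M <= 1 -> eta <= eta0 -> (0 < t)%N ->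
  a1 <= eta * t%:R * rho -> eta * t%:R * rho <= a2 ->
  dotprod wstar wstar <= B ->
  6 * (C1 * (2 * B / a1 + 4 * a2 * K) +
     kap * (eta0 / a1) * (2 * B + 2 * a2 ^+ 2 * K)) <= C ->
  (forall o, G o -> [/\
    forall v, n%:R^-1 * \sum_i dotprod v (vec (Z i o).1) ^+ 2 <=
      M0 * dotprod v v,
    forall v : 'cV[R]_d, \sum_j lam j * v j 0 ^+ 2 <=
      C1 * (n%:R^-1 * \sum_i dotprod v (vec (Z i o).1) ^+ 2) +
      kap / t%:R * dotprod v v &
    dotprod (mean_noise (fun i => Z i o) wstar)
      (mean_noise (fun i => Z i o) wstar) <= K * rho ^+ 2]) ->
  ((1 - delta)%:E <=
   P [set o | (excess_risk D (gd (fun i => Z i o) eta t) <= (C * rho)%:E)%E])%E.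
Proof.
move=> mG PG a10 M0' MM C10 kap0 K0 rho0 eta_gt0 etaM eta_le t0 h1 h2 wB hC hG.
apply: le_trans PG _; apply: le_measure; rewrite ?inE//.
  exact: (measurable_excess_event hD lam0 SigmaE n0).
move=> o /hG [g1 g2 g3] /=.
apply: (le_trans (@excess_risk_gd_le _ _ _ _ _ _ _ _ hD lam0 SigmaE n0
  (fun i => Z i o) B a1 a2 M C1 kap K rho eta eta0 t a10 M0' C10 kap0 K0 rho0
  eta_gt0 etaM eta_le t0 h1 h2 wB _ g2 g3)).
  by move=> v; apply: le_trans (g1 v) _; rewrite ler_wpM2r// dotprodvv_ge0.
by rewrite lee_fin ler_pM2r.
Qed.

End excess_risk_whp.

Unset Implicit Arguments.

Theorem theorem6p2 (R : realType) (B a1 a2 : R)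
  (hB : 1 <= B) (ha1 : 0 < a1) (ha12 : a1 <= a2) :
  exists c C : R, [/\ 0 < c, 0 < C &
    forall (n d s t : nat) (delta sigma : R) (Sigma : 'M[R]_d)
      (wstar : 'cV[R]_d) (eta : R),
    (1 <= n)%N -> (1 <= d)%N -> (1 <= s)%N -> (2 <= t)%N ->
    0 < delta -> delta < 1 -> 0 < sigma ->
    is_diag_mx Sigma -> psd Sigma ->
    (l0norm wstar <= s)%N ->
    B^-1 <= spectral_norm Sigma -> spectral_norm Sigma <= B ->
    l2norm wstar <= B ->
    C * t%:R ^+ 2 * (\tr Sigma + ln (1 / delta)) <= n%:R ->
    0 < eta -> eta <= c / spectral_norm Sigma ->
    a1 * (sigma ^+ 2 * \tr Sigma * ln (d%:R / delta) / n%:R) `^ (- (1 / 2))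
      <= eta * t%:R ->
    eta * t%:R <=
      a2 * (sigma ^+ 2 * \tr Sigma * ln (d%:R / delta) / n%:R) `^ (- (1 / 2)) ->
    forall (D : probability (d.-tuple R * R)%type R),
    linear_model Sigma wstar sigma D ->
    forall (dT : measure_display) (T : measurableType dT)
      (Pr : probability T R) (Z : 'I_n -> {mfun T >-> (d.-tuple R * R)%type}),
    iid_from Pr D Z ->
    ((1 - delta)%:E <=
     Pr [set o | (excess_risk D (gd (fun i => Z i o) eta t) <=
       (C * ln t%:R *
        Num.sqrt (sigma ^+ 2 * \tr Sigma * ln (d%:R / delta) / n%:R))%:E)%E])%E].
Proof.
have B0 : 0 < B by lra.
have a20 : 0 < a2 by apply: lt_le_trans ha12.
(* [K] has two roles: the constant in the noise bound for [delta] near 1, and, through [K^-1], the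
   value of [log(d/delta)] that separates the two regimes. *)
have [K hK] : exists K : R, 2 * (4 * 81 * 21) <= K by eexists; exact: lexx.
have K2 : 2 <= K.
  by apply: le_trans hK; rewrite ler_peMr// -!natrM -[1]/(1%:R) ler_nat.
have K0 : 0 < K by lra.
have ln2 : 2^-1 <= ln (2 : R).
  by have := @ln1D_ge_half R 1 1; rewrite div1r; apply; rewrite ?lexx ?ler01.
(* The larger of the upper constants of the two regimes. Since the spectral norm is at least [B^-1],
   the choice of [c] below ensures [eta * M <= 1]. *)
pose M : R := 16 * (2 * B + 3).
have M0 : 0 < M by rewrite /M; lra.
pose c := (B * M)^-1.
have c0 : 0 < c by rewrite invr_gt0 mulr_gt0.
(* The noise constant of [good_event] at [L0 = K^-1]. *)
pose K1 : R := 8 * (4 / K^-1 + 1).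
have K10 : 0 <= K1 by rewrite /K1 invrK; lra.
(* The constant of [excess_risk_whp], with [a] for [C1], [b] for the pair of [K] and [kap], and
   [eta0 = M^-1]. *)
pose V a b := 6 * (a * (2 * B ^+ 2 / a1 + 4 * a2 * b.1) +
   b.2 * (M^-1 / a1) * (2 * B ^+ 2 + 2 * a2 ^+ 2 * b.1)).
have V0 a b : 0 <= a -> 0 <= b.1 -> 0 <= b.2 -> 0 <= V a b.
  move=> ha hb1 hb2; have p : 0 <= 2 * B ^+ 2 by rewrite mulr_ge0// sqr_ge0.
  have p2 : 0 <= 2 * a2 ^+ 2 * b.1 by rewrite mulr_ge0// mulr_ge0// sqr_ge0.
  have p3 : 0 <= 4 * a2 * b.1 by rewrite mulr_ge0// mulr_ge0// ltW.
  have p4 : 0 <= M^-1 / a1 by rewrite divr_ge0 ?invr_ge0// ltW.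
  apply: mulr_ge0 => //; apply: addr_ge0; apply: mulr_ge0 => //.
  - by apply: addr_ge0 => //; rewrite divr_ge0// ltW.
  - exact: mulr_ge0.
  - exact: addr_ge0.
set V1 := V 4 (K1, 66 + 4 * B); set V2 := V 12 (K, 0).
have V10 : 0 <= V1 by apply: V0 => //=; lra.
have V20 : 0 <= V2 by apply: V0 => //=; lra.
pose N0 : R := 8 * B * (Num.trunc (2 * B * (66 + 4 * B))).+1%:R ^+ 2 * (B + 1).
have N00 : 0 < N0 by rewrite !mulr_gt0 ?exprn_gt0 ?ltr0n//; lra.
(* As the trace is at least [B^-1], this part of [C] forces [n >= 2 N0 + 1], hence [N0 <= m] when
   [n = 2 m + r]. *)
pose C3 := B * (2 * N0 + 1).
have C30 : 0 < C3 by rewrite mulr_gt0//; lra.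
pose C := 8 * B + 2 * V1 + 2 * V2 + C3.
exists c, C; split => //; first by rewrite /C; lra.
move=> n d s t delta sigma Sigma wstar eta hn hd hs ht dl0 dl1 sg0 Sdiag Spsd _
  specB Bspec wB hnC eta0 etac h1 h2 D hD dT T P Z hZ.
have t2 : 2 <= t%:R :> R by rewrite -[2]/(2%:R) ler_nat.
have t0 : (0 < t)%N by rewrite (leq_trans _ ht).
have spec0 : 0 < spectral_norm Sigma.
  by apply: lt_le_trans specB; rewrite invr_gt0.
have trB : B^-1 <= \tr Sigma.
  exact: le_trans specB (spectral_norm_le_trace Sdiag Spsd).
have lamB j : Sigma j j <= B.
  exact: le_trans (diag_le_spectral_norm Sdiag Spsd j) Bspec.
have tr0 : 0 < \tr Sigma by apply: lt_le_trans trB; rewrite invr_gt0.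
have lam0 := diag_ge0 Sdiag Spsd.
have SigmaE := diag_quadratic Sdiag.
have ZD := iid_from_prod hZ.
have n0' : 0 < n%:R :> R by rewrite ltr0n.
set L := ln (d%:R / delta) in h1 h2 *.
have l0 : 0 < ln (1 / delta) by rewrite ln_gt0// div1r invf_gt1.
have lL : ln (1 / delta) <= L.
  have p : 0 < d%:R / delta by rewrite divr_gt0// ltr0n.
  rewrite ler_ln ?posrE//; first by rewrite ler_pM2r ?invr_gt0// ler1n.
  by rewrite divr_gt0.
have L0 : 0 < L by exact: lt_le_trans lL.
set rho := Num.sqrt _.
have arg0 : 0 < sigma ^+ 2 * \tr Sigma * L / n%:R.
  by rewrite divr_gt0// mulr_gt0// mulr_gt0// exprn_gt0.
have rho0 : 0 < rho by rewrite sqrtr_gt0.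
have rho2 : rho ^+ 2 = sigma ^+ 2 * \tr Sigma * L / n%:R.
  by rewrite sqr_sqrtr// ltW.
rewrite powRN div1r (powR12_sqrt (ltW arg0)) -/rho in h1 h2.
rewrite ler_pdivrMr// in h1; rewrite ler_pdivlMr// in h2.
have wB2 : dotprod wstar wstar <= B ^+ 2.
  by rewrite -l2norm_sqr ler_pXn2r// nnegrE ?sqrtr_ge0// ltW.
have etaM : eta * M <= 1.
  apply: le_trans (_ : c / spectral_norm Sigma * M <= _).
    by rewrite ler_pM2r.
  rewrite mulrAC ler_pdivrMr// mul1r /c invfM mulrVK//.
  by rewrite unitfE gt_eqF.
have eta_le : eta <= M^-1 by rewrite -[M^-1]mul1r ler_pdivlMr.
have lnt : 2^-1 <= ln (t%:R : R).
  by apply: le_trans ln2 _; rewrite ler_ln ?posrE//; lra.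
(* [ln t >= 1/2] for [t >= 2], so doubling [V1] and [V2] inside [C] bounds both by [C ln t]. *)
have Clnt v : 0 <= v -> 2 * v <= C -> v <= C * ln t%:R.
  move=> v0 vC; apply: le_trans (_ : (2 * v) * 2^-1 <= _); first by lra.
  by apply: ler_pM => //; lra.
have CV1 : V1 <= C * ln t%:R by apply: Clnt => //; rewrite /C; lra.
have CV2 : V2 <= C * ln t%:R by apply: Clnt => //; rewrite /C; lra.
have trl : 0 < \tr Sigma + ln (1 / delta) by rewrite addr_gt0.
have Kinv : 0 < K^-1 by rewrite invr_gt0.
have hnB : 8 * B * t%:R ^+ 2 * (\sum_j Sigma j j + ln (1 / delta)) <= n%:R.
  apply: le_trans hnC; rewrite ler_pM2r// ler_pM2r ?exprn_gt0 ?ltr0n//.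
  by rewrite /C; lra.
have [LK|LK] := leP K^-1 L.
  have [G [mG PG hG]] := @good_event R d n dT T P Sigma wstar sigma D
    (fun j => Sigma j j) Z hD ZD lam0 SigmaE B delta L K^-1 t hB sg0 dl0 dl1
    hd t0 lamB trB hnB Kinv LK lL.
  apply: (@excess_risk_whp _ _ _ _ _ P Sigma wstar sigma D
    (fun j => Sigma j j) Z hD lam0 SigmaE hn G delta (B ^+ 2) a1 a2 M
    (8 * (2 * B + 3)) 4 (66 + 4 * B) K1 rho eta M^-1) => //.
  - by rewrite /M; lra.
  - by lra.
  - by rewrite rho2.
(* If [d >= 2], then [L >= ln 2 >= 1/2 >= K^-1], contrary to [LK]. *)
have dE : d = 1%N.
  apply/eqP; rewrite eqn_leq hd andbT leqNgt; apply/negP => d2.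
  have : ln 2 <= L.
    rewrite ler_ln ?posrE ?divr_gt0 ?ltr0n// ler_pdivlMr//.
    have : 2 <= d%:R :> R by rewrite -[2]/(2%:R) ler_nat.
    by lra.
  have : K^-1 <= 2^-1 by rewrite lef_pV2 ?posrE.
  by lra.
have nN0 : 2 * N0 + 1 <= n%:R.
  apply: le_trans hnC; rewrite (_ : 2 * N0 + 1 = C3 * B^-1); last first.
    by rewrite /C3 mulrAC divff ?mul1r// gt_eqF.
  have tt : 1 <= t%:R ^+ 2 :> R by rewrite expr_ge1//; lra.
  have C3C : C3 <= C by rewrite /C; lra.
  apply: ler_pM; rewrite ?invr_ge0 ?(ltW C30) ?(ltW B0)//; last by lra.
  have C0 := lt_le_trans C30 C3C.
  by apply: le_trans C3C _; rewrite -[X in X <= _]mulr1 ler_pM2l.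
have [m [r [nE r1]]] : exists m r, n = (m + m + r)%N /\ (r <= 1)%N.
  by exists n./2, (odd n); rewrite addnn addnC odd_double_half leq_b1.
have mN0 : N0 <= m%:R.
  have : r%:R <= 1 :> R by rewrite -[1]/(1%:R) ler_nat.
  by move: nN0; rewrite nE !natrD; lra.
have m0 : (0 < m)%N by rewrite -(@ltr0n R); exact: lt_le_trans mN0.
have KL : K * L <= 1 by rewrite mulrC -ler_pdivlMr// div1r ltW.
subst d n.
have trE : \tr Sigma = Sigma 0 0 by rewrite /mxtrace big_ord1.
have SB : B^-1 <= Sigma 0 0 by rewrite -trE.
have [G [mG PG hG]] := @good_event_large_delta R m r dT T P Sigma wstar sigma D
  (fun j => Sigma j j) Z hD ZD lam0 SigmaE B delta K hB sg0 (lamB 0)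
  SB m0 r1 mN0 dl0 dl1 hK KL.
apply: (@excess_risk_whp _ _ _ _ _ P Sigma wstar sigma D
  (fun j => Sigma j j) Z hD lam0 SigmaE hn G delta (B ^+ 2) a1 a2 M
  (16 * (2 * B + 3)) 12 0 K rho eta M^-1) => //.
- by rewrite ltW.
- move=> o /hG [g1 g2 g3]; split => //.
    by move=> v; rewrite mul0r mul0r addr0.
  by rewrite rho2 trE.
Qed.
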